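(* Let $(\mathcal{M},\mathbf{g})$ be a four-dimensional pseudo-Riemannian manifold with a $2$-dimensional Abelian Killing algebra $\mathcal{G}_2=\langle\xi_{(1)},\xi_{(2)}\rangle$, $[\xi_{(1)},\xi_{(2)}]=0$, whose Killing leaves are non-null and orthogonally intransitive, and let $X$ be a vector field and $\Lambda\in\mathbb{R}$ a constant such that $\mathrm{Ric}(\mathbf{g})+\frac12 L_X\mathbf{g}=\Lambda\mathbf{g}$. Assume that (i) the curvature vector field $\mathcal{C}$ satisfies $\mathbf{g}(\mathcal{C},\mathcal{C})=0$; (ii) $\mathcal{G}_2$ has a null vector; (iii) $X\in\Xi=\mathrm{span}\{\xi_{(1)},\xi_{(2)}\}$ and $X$ is a symmetry of $\Xi^\perp$. Let $\mathbf{g}$ be written in adapted coordinates in the normal form (N) described in the context, and assume $\partial f_1^1/\partial t_2=0$, $\partial h_{12}/\partial t_1\neq0$ and $\Lambda\neq0$. Then, locally, for a suitable choice of adapted coordinates $\{t_1,t_2,z_1,z_2\}$, the Ricci soliton reduces to one of the following two types. Type A: $$\mathbf{g}=-\frac{3c_1^2t_1}{\Lambda(c_1^2t_1^3+1)}dt_1^2+\frac{\epsilon_0(c_1^2t_1^3+1)}{t_1}dt_2^2-\frac{6\epsilon t_2}{t_1^2}dt_1dz_1+\frac{\epsilon\psi t_1^3+\epsilon_0}{t_1}dz_1^2-2t_1^2dz_1dz_2$$ with $$X=a_1\partial_{z_1}+(a_2z_1+a_3)\partial_{z_2},$$ where $\epsilon_0,\epsilon=\pm1$ and $\Lambda,c_1,a_1,a_2,a_3\in\mathbb{R}$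 are arbitrary constants satisfying $\Lambda<0$, $c_1\neq0$, and $\psi=\psi(t_1,t_2)$ is a differentiable function satisfying $$\partial_{t_1}^2\psi-\frac{3\epsilon_0c_1^2t_1^2}{\Lambda(c_1^2t_1^3+1)^2}\,\partial_{t_2}^2\psi+\frac{4c_1^2t_1^3+1}{t_1(c_1^2t_1^3+1)}\,\partial_{t_1}\psi=\frac{6\epsilon a_2c_1^2t_1}{\Lambda(c_1^2t_1^3+1)}.$$ In particular, the Ricci soliton is expanding and the orbit metric $\tilde{\mathbf{g}}=-3c_1^2t_1\Lambda^{-1}(c_1^2t_1^3+1)^{-1}dt_1^2+\epsilon_0(c_1^2t_1^3+1)t_1^{-1}dt_2^2$ has Gauss curvature $$K=\frac{\Lambda(c_1^2t_1^3+1)}{3c_1^2t_1^3}.$$ Type B: $$\mathbf{g}=-\frac{3}{\Lambda t_1^2}\left(dt_1^2+\epsilon_0dt_2^2\right)+2t_2\,dt_1dz_1+\frac{\psi}{4t_1^2}dz_1^2+\frac{1}{t_1^2}dz_1dz_2$$ with $$X=a_1\partial_{z_1}+(a_2z_1+a_3)\partial_{z_2},$$ where $\epsilon_0=\pm1$ and $\Lambda,a_1,a_2,a_3\in\mathbb{R}$ are arbitrary constants satisfying $\Lambda<0$, and $\psi=\psi(t_1,t_2)$ is a differentiable function satisfying $$\partial_{t_1}^2\psi+\epsilon_0\,\partial_{t_2}^2\psi-\frac{2}{t_1}\,\partial_{t_1}\psi=-\frac43\epsilon_0\Lambda t_1^4-\frac{12a_2}{\Lambda t_1^2}.$$ In particular,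 the Ricci soliton is expanding and the orbit metric $\tilde{\mathbf{g}}=-3\Lambda^{-1}t_1^{-2}(dt_1^2+\epsilon_0dt_2^2)$ has constant Gauss curvature $\Lambda/3$.
   Context: All statements are local and all functions are differentiable (as often as needed). $L_X$ is the Lie derivative; the soliton is called expanding if $\Lambda<0$. Killing algebra and adapted coordinates. $\mathcal{G}_2$ is a 2-dimensional Abelian Lie algebra of Killing fields of $\mathbf{g}$, spanned by pointwise linearly independent commuting fields $\xi_{(1)},\xi_{(2)}$; $\Xi=\mathrm{span}\{\xi_{(1)},\xi_{(2)}\}$ is the distribution they generate, its integral surfaces are the Killing leaves, and $\Xi^\perp$ is the orthogonal distribution. Adapted coordinates are local coordinates $\{t_1,t_2,z_1,z_2\}$ such that $\mathcal{G}_2$ is generated by $\partial_{z_1},\partial_{z_2}$ (so $\xi_{(i)}=\partial_{z_i}$ for a basis) and the Killing leaves are the surfaces $t_1,t_2=$ const. In adapted coordinates, when the Killing leaves are non-null (i.e. $\det(h_{kl})\ne0$), $$\mathbf{g}=\tilde g_{ij}\,dt_idt_j+h_{kl}\,(dz_k+f_i^kdt_i)(dz_l+f_j^ldt_j),$$ with $\tilde g_{ij},h_{kl},f_i^k$ functions of $(t_1,t_2)$, summation over repeated indices. The orbit metric is $\tilde{\mathbf{g}}=\tilde g_{ij}dt_idt_j$ (a metric on the local orbit space), and its Gauss curvature $K$ is normalised by $\mathrm{Ric}(\tilde{\mathbf g})=K\tilde{\mathbf g}$. Curvature vector field: $\mathcal{C}=\mathcal{C}^1\partial_{z_1}+\mathcal{C}^2\partial_{z_2}$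 with $\mathcal{C}^k=(\partial_{t_2}f_1^k-\partial_{t_1}f_2^k)/\sqrt{|\det\tilde{\mathbf{g}}|}$; so $\mathbf{g}(\mathcal{C},\mathcal{C})=h_{kl}\mathcal{C}^k\mathcal{C}^l$. Orthogonally intransitive means $\Xi^\perp$ is not integrable, i.e. $\mathcal{C}\neq0$. Condition (ii): $\mathcal{G}_2$ contains a nonzero Killing field that is everywhere null. Condition (iii): $X$ is tangent to the Killing leaves, and $[X,Y]$ is a section of $\Xi^\perp$ for every section $Y$ of $\Xi^\perp$. Normal form (N). Under these assumptions adapted coordinates are chosen such that $\xi_{(2)}=\partial_{z_2}$ is null and $f_2^1=f_2^2=0$, with $$\mathbf{g}=e^{-2P}(dt_1^2+\epsilon_0dt_2^2)+h_{11}(dz_1+f_1^1dt_1)^2+2h_{12}(dz_1+f_1^1dt_1)(dz_2+f_1^2dt_1),$$ where $\epsilon_0=\pm1$, $P,h_{11},h_{12},f_1^1,f_1^2$ are functions of $(t_1,t_2)$, $h_{12}\neq0$ and $(\partial_{t_2}f_1^1)^2+(\partial_{t_2}f_1^2)^2\neq0$.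
   Formalization: Two corrections: the reduction is claimed near points where dh12 is non-null for the orbit metric (shown dense), as it fails at null points; and since solitons with Lambda>0 exist, for Lambda>0 it is (-g,-X,-Lambda) that takes type A or B. *)

(* Defs.v *)
From HB Require Import structures.
From mathcomp Require Import all_boot all_order all_algebra.
From mathcomp Require Import all_classical all_reals all_analysis.

Set Implicit Arguments.
Unset Strict Implicit.
Unset Printing Implicit Defensive.
Import Order.TTheory GRing.Theory Num.Theory.
Import numFieldNormedType.Exports.
Local Open Scope classical_set_scope.
Local Open Scope ring_scope.

(* A local chart is an open subset of R^n.  Tangent vectors are row vectors of
   components; a vector field or a tensor is a total function of the point, of
   which only the values on the chart matter. *)

Section Tensors.
Context {R : realType} {n : nat}.
Implicit Types (U : set 'rV[R]_n) (g : 'rV[R]_n -> 'M[R]_n)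
  (X Y : 'rV[R]_n -> 'rV[R]_n).

Definition partial (i : 'I_n) (f : 'rV[R]_n -> R) : 'rV[R]_n -> R :=
  fun x => 'D_(delta_mx 0 i) f x.

(* C^oo: all iterated partial derivatives are (Frechet) differentiable on U. *)
Definition smooth_on U (f : 'rV[R]_n -> R) :=
  forall (s : seq 'I_n) x, U x -> differentiable (foldr partial f s) x.

Definition smooth_mx p q U (M : 'rV[R]_n -> 'M[R]_(p, q)) :=
  forall i j, smooth_on U (fun x => M x i j).

Definition pseudo_riemannian U g :=
  smooth_mx U g /\ (forall x, U x -> (g x)^T = g x /\ \det (g x) != 0).

Definition inner (G : 'M[R]_n) (u v : 'rV[R]_n) : R := (u *m G *m v^T) 0 0.

(* Gamma^k_ij *)
Definition christoffel g (k i j : 'I_n) : 'rV[R]_n -> R := fun x =>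
  2^-1 * \sum_l invmx (g x) k l *
    (partial i (fun y => g y j l) x + partial j (fun y => g y i l) x
     - partial l (fun y => g y i j) x).

(* The sign is the one for which round spheres have positive Ricci tensor. *)
Definition ricci g (x : 'rV[R]_n) : 'M[R]_n := \matrix_(i, j)
  (\sum_k (partial k (christoffel g k i j) x
           - partial j (christoffel g k i k) x)
   + \sum_k \sum_l (christoffel g k k l x * christoffel g l i j x
                    - christoffel g k j l x * christoffel g l i k x)).

Definition lie_metric X g (x : 'rV[R]_n) : 'M[R]_n := \matrix_(i, j)
  \sum_k (X x 0 k * partial k (fun y => g y i j) x
          + g x k j * partial i (fun y => X y 0 k) x
          + g x i k * partial j (fun y => X y 0 k) x).

Definition lie_bracket X Y (x : 'rV[R]_n) : 'rV[R]_n := \row_k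
  \sum_i (X x 0 i * partial i (fun y => Y y 0 k) x
          - Y x 0 i * partial i (fun y => X y 0 k) x).

Definition ricci_soliton U g X (Lambda : R) :=
  forall x, U x -> ricci g x + 2^-1 *: lie_metric X g x = Lambda *: g x.

Definition coordinate_change (W W' : set 'rV[R]_n)
    (y x : 'rV[R]_n -> 'rV[R]_n) :=
  [/\ open W /\ open W',
      smooth_mx W y /\ smooth_mx W' x,
      forall p, W p -> W' (y p) /\ x (y p) = p &
      forall q, W' q -> W (x q) /\ y (x q) = q].

(* Components, in the coordinates y with inverse x, of a metric and of a vector
   field; row a of 'J x q holds the derivatives of x along the a-th axis. *)
Definition metric_in (x : 'rV[R]_n -> 'rV[R]_n) g (q : 'rV[R]_n) : 'M[R]_n :=
  'J x q *m g (x q) *m ('J x q)^T.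

Definition field_in (y x : 'rV[R]_n -> 'rV[R]_n) X (q : 'rV[R]_n) :
  'rV[R]_n := X (x q) *m 'J y (x q).

Section KillingPair.
Context {m : nat}.
Implicit Type xi : 'I_m -> 'rV[R]_n -> 'rV[R]_n.

(* The xi i span an m-dimensional Abelian algebra of Killing fields. *)
Definition abelian_killing_algebra U g xi :=
  [/\ forall i, smooth_mx U (xi i),
      forall i x, U x -> lie_metric (xi i) g x = 0,
      forall i j x, U x -> lie_bracket (xi i) (xi j) x = 0 &
      forall x, U x -> row_free (\matrix_i xi i x)].

Definition nonnull_leaves U g xi :=
  forall x, U x -> \det (\matrix_(i, j) inner (g x) (xi i x) (xi j x)) != 0.

Definition section_Xi U xi Y :=
  forall x, U x -> (Y x <= \matrix_i xi i x)%MS.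

Definition section_Xi_perp U g xi Y :=
  forall i x, U x -> inner (g x) (Y x) (xi i x) = 0.

Definition symmetry_Xi_perp U g xi X :=
  forall Y, smooth_mx U Y -> section_Xi_perp U g xi Y ->
    section_Xi_perp U g xi (lie_bracket X Y).

Definition has_null_vector U g xi :=
  exists2 a : 'I_m -> R, (exists i, a i != 0) &
    forall x, U x ->
      inner (g x) (\sum_i a i *: xi i x) (\sum_i a i *: xi i x) = 0.

End KillingPair.
End Tensors.

Definition gauss_curvature {R : realType} (V : set 'rV[R]_2)
    (gt : 'rV[R]_2 -> 'M[R]_2) (K : 'rV[R]_2 -> R) :=
  forall u, V u -> ricci gt u = K u *: gt u.

(* Coordinates (t1, t2, z1, z2) are points of R^(2+2). *)
Section AdaptedCoordinates.
Context {R : realType}.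
Local Notation pt := 'rV[R]_(2 + 2).
Implicit Types (W : set pt) (xi : 'I_2 -> pt -> pt) (u : 'rV[R]_2).

Definition tpart (x : pt) : 'rV[R]_2 := lsubmx x.
Definition zpart (x : pt) : 'rV[R]_2 := rsubmx x.

Definition dz (k : 'I_2) : pt := row_mx 0 (delta_mx 0 k).

Definition mx2 (a b c d : R) : 'M[R]_2 :=
  \matrix_(i, j) nth 0 (nth [::] [:: [:: a; b]; [:: c; d]] i) j.

Definition adapted W xi :=
  exists2 A : 'M[R]_2, A \in unitmx &
    forall i x, W x -> xi i x = \sum_k A i k *: dz k.

(* gt_ij dt_i dt_j + h_kl (dz_k + f_i^k dt_i) (dz_l + f_j^l dt_j),
   where f_i^k is the entry (i, k) of f. *)
Definition adapted_metric (gt h f : 'rV[R]_2 -> 'M[R]_2) (x : pt) :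
    'M[R]_(2 + 2) :=
  let u := tpart x in
  block_mx (gt u + f u *m h u *m (f u)^T) (f u *m h u)
           (h u *m (f u)^T)               (h u).

Definition orbit_metric W (g : pt -> 'M[R]_(2 + 2))
    (gt : 'rV[R]_2 -> 'M[R]_2) :=
  exists h f, forall x, W x ->
    \det (h (tpart x)) != 0 /\ g x = adapted_metric gt h f x.

Definition curvature_field (gt f : 'rV[R]_2 -> 'M[R]_2) (x : pt) : pt :=
  let u := tpart x in
  \sum_k ((partial 1 (fun v => f v 0 k) u - partial 0 (fun v => f v 1 k) u)
          / Num.sqrt `|\det (gt u)|) *: dz k.

Definition nf_orbit (eps0 : R) (P : 'rV[R]_2 -> R) u : 'M[R]_2 :=
  expR (- (2 * P u)) *: mx2 1 0 0 eps0.
Definition nf_h (h11 h12 : 'rV[R]_2 -> R) u : 'M[R]_2 :=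
  mx2 (h11 u) (h12 u) (h12 u) 0.
Definition nf_f (f11 f12 : 'rV[R]_2 -> R) u : 'M[R]_2 :=
  mx2 (f11 u) (f12 u) 0 0.

Definition normal_form W (g : pt -> 'M[R]_(2 + 2)) xi (eps0 : R)
    (P h11 h12 f11 f12 : 'rV[R]_2 -> R) :=
  let V := tpart @` W in
  [/\ eps0 = 1 \/ eps0 = -1,
      [/\ smooth_on V P, smooth_on V h11, smooth_on V h12,
          smooth_on V f11 & smooth_on V f12],
      adapted W xi /\ (forall x, W x -> xi 1 x = dz 1),
      (forall x, W x -> g x =
        adapted_metric (nf_orbit eps0 P) (nf_h h11 h12) (nf_f f11 f12) x) &
      forall u, V u -> h12 u != 0 /\
        partial 1 f11 u ^+ 2 + partial 1 f12 u ^+ 2 != 0].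

(* a11 dt1^2 + a22 dt2^2 + 2 b dt1 dz1 + h11 dz1^2 + 2 h12 dz1 dz2 *)
Definition soliton_metric (a11 a22 b h11 h12 : R) : 'M[R]_(2 + 2) :=
  block_mx (mx2 a11 0 0 a22) (mx2 b 0 0 0) (mx2 b 0 0 0) (mx2 h11 h12 h12 0).

(* a1 dz_1 + (a2 z1 + a3) dz_2 *)
Definition soliton_field (a1 a2 a3 : R) (x : pt) : pt :=
  a1 *: dz 0 + (a2 * zpart x 0 0 + a3) *: dz 1.

Definition orbitA (Lambda eps0 c1 : R) u : 'M[R]_2 :=
  let t1 := u 0 0 in
  mx2 (- (3 * c1 ^+ 2 * t1) / (Lambda * (c1 ^+ 2 * t1 ^+ 3 + 1))) 0
      0 (eps0 * (c1 ^+ 2 * t1 ^+ 3 + 1) / t1).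

Definition metricA (Lambda eps0 eps c1 : R) (psi : 'rV[R]_2 -> R) (x : pt) :
    'M[R]_(2 + 2) :=
  let u := tpart x in let t1 := u 0 0 in let t2 := u 0 1 in
  soliton_metric
    (- (3 * c1 ^+ 2 * t1) / (Lambda * (c1 ^+ 2 * t1 ^+ 3 + 1)))
    (eps0 * (c1 ^+ 2 * t1 ^+ 3 + 1) / t1)
    (- (3 * eps * t2) / t1 ^+ 2)
    ((eps * psi u * t1 ^+ 3 + eps0) / t1)
    (- t1 ^+ 2).

Definition equationA (Lambda eps0 eps c1 a2 : R) (psi : 'rV[R]_2 -> R) u :=
  let t1 := u 0 0 in let D := c1 ^+ 2 * t1 ^+ 3 + 1 in
  partial 0 (partial 0 psi) u
  - 3 * eps0 * c1 ^+ 2 * t1 ^+ 2 / (Lambda * D ^+ 2)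
    * partial 1 (partial 1 psi) u
  + (4 * c1 ^+ 2 * t1 ^+ 3 + 1) / (t1 * D) * partial 0 psi u
  = 6 * eps * a2 * c1 ^+ 2 * t1 / (Lambda * D).

Definition curvatureA (Lambda c1 : R) u : R :=
  let t1 := u 0 0 in
  Lambda * (c1 ^+ 2 * t1 ^+ 3 + 1) / (3 * c1 ^+ 2 * t1 ^+ 3).

Definition typeA W (g : pt -> 'M[R]_(2 + 2)) (X : pt -> pt)
    (Lambda eps0 : R) :=
  let V := tpart @` W in
  exists (eps c1 a1 a2 a3 : R) (psi : 'rV[R]_2 -> R),
    [/\ eps = 1 \/ eps = -1, Lambda < 0, c1 != 0, smooth_on V psi &
        forall u, V u -> [/\ u 0 0 != 0, c1 ^+ 2 * u 0 0 ^+ 3 + 1 != 0 &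
                             equationA Lambda eps0 eps c1 a2 psi u]] /\
    [/\ forall x, W x -> g x = metricA Lambda eps0 eps c1 psi x,
        forall x, W x -> X x = soliton_field a1 a2 a3 x,
        orbit_metric W g (orbitA Lambda eps0 c1) &
        gauss_curvature V (orbitA Lambda eps0 c1) (curvatureA Lambda c1)].

Definition orbitB (Lambda eps0 : R) u : 'M[R]_2 :=
  (- 3 / (Lambda * u 0 0 ^+ 2)) *: mx2 1 0 0 eps0.

Definition metricB (Lambda eps0 : R) (psi : 'rV[R]_2 -> R) (x : pt) :
    'M[R]_(2 + 2) :=
  let u := tpart x in let t1 := u 0 0 in let t2 := u 0 1 in
  soliton_metric
    (- 3 / (Lambda * t1 ^+ 2))
    (- 3 / (Lambda * t1 ^+ 2) * eps0)
    t2
    (psi u / (4 * t1 ^+ 2))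
    (2^-1 * (1 / t1 ^+ 2)).

Definition equationB (Lambda eps0 a2 : R) (psi : 'rV[R]_2 -> R) u :=
  let t1 := u 0 0 in
  partial 0 (partial 0 psi) u + eps0 * partial 1 (partial 1 psi) u
  - 2 / t1 * partial 0 psi u
  = - (4 / 3) * eps0 * Lambda * t1 ^+ 4 - 12 * a2 / (Lambda * t1 ^+ 2).

Definition typeB W (g : pt -> 'M[R]_(2 + 2)) (X : pt -> pt)
    (Lambda eps0 : R) :=
  let V := tpart @` W in
  exists (a1 a2 a3 : R) (psi : 'rV[R]_2 -> R),
    [/\ Lambda < 0, smooth_on V psi &
        forall u, V u -> u 0 0 != 0 /\ equationB Lambda eps0 a2 psi u] /\
    [/\ forall x, W x -> g x = metricB Lambda eps0 psi x,
        forall x, W x -> X x = soliton_field a1 a2 a3 x,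
        orbit_metric W g (orbitB Lambda eps0) &
        gauss_curvature V (orbitB Lambda eps0) (fun=> Lambda / 3)].

(* Around p there are adapted coordinates y in which (g, X) has one of the two
   canonical forms; both contain Lambda < 0.  If g is a soliton for (X, Lambda)
   then - g is one for (- X, - Lambda), and a soliton with Lambda > 0 reduces
   after this change of overall sign.  Such solitons exist: the metric
   metricA 1 (-1) 1 1 (fun=> 0) on -1 < t1 < 0 satisfies Ric(g) = g and has a
   positive definite orbit metric. *)
Definition reduces_at (U : set pt) (g : pt -> 'M[R]_(2 + 2)) xi (X : pt -> pt)
    (Lambda eps0 : R) (p : pt) :=
  exists (W W' : set pt) (y x : pt -> pt),
    [/\ coordinate_change W W' y x, W p, W `<=` U,
        adapted W' (fun i => field_in y x (xi i)) &
        typeA W' (metric_in x g) (field_in y x X) Lambda eps0 \/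
        typeB W' (metric_in x g) (field_in y x X) Lambda eps0].

(* Both canonical forms have coordinates in which the orbit metric is diagonal
   and h12 is a function of t1 alone, so dh12 is not null for the orbit metric.
   When eps0 = -1 it may be null along curves (horizons, where
   c1^2 t1^3 + 1 would vanish); these points have to be left out. *)
Definition nonnull_dh12 (U : set pt) (eps0 : R) (h12 : 'rV[R]_2 -> R) :
    set pt :=
  U `&` [set x | partial 0 h12 (tpart x) ^+ 2
                 + eps0 * partial 1 h12 (tpart x) ^+ 2 != 0].

End AdaptedCoordinates.

(* Main.v *)
Require Import Defs.
From HB Require Import structures.
From mathcomp Require Import all_boot all_order all_algebra.
From mathcomp Require Import all_classical all_reals all_analysis.
From mathcomp Require Import ring lra.
Import Order.TTheory GRing.Theory Num.Theory.
Import numFieldNormedType.Exports.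
Local Open Scope classical_set_scope.
Local Open Scope ring_scope.

Set Implicit Arguments.
Unset Strict Implicit.
Unset Printing Implicit Defensive.

(* Write r = h12, a = f_1^1, c = f_1^2, E = e^(-2P), and K for the curvature of the
   orbit metric gt.  Condition (iii) forces the components of X to depend on z1
   only, up to the connection form a dt1 + dz1.  With B = d_{z1} X^1, which is
   constant, the soliton equation says that r^2 d_2 c / E is constant, that
   Hess r = dr dr / (2 r) + (K - Lambda) r gt, that the Laplacian of r is
   (B - 2 Lambda) r, and gives a linear equation for h11.  The trace of the Hessian
   equation is |dr|^2 = 2 (B - 2 K) r^2; comparing its derivative with the
   compatibility condition 2 r dK = (Lambda - 3 K) dr yields B = 0, and
   (3 K - Lambda) |r|^(3/2) is constant.  If dr were null on an open set then K,
   and hence Lambda dr, would vanish there; so dr is non-null on a dense set.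
   Near a point of this set let w = |r|^(1/2), and T1 = w up to sign if 3 K is not
   Lambda (type A), T1 = 1 / w otherwise (type B).  In both cases r, K and |dT1|^2
   are functions of T1, and X(T1) * dT1 is closed for a suitable function X, so it
   has a primitive T2, orthogonal to T1.  The form a dt1 is exact, and c dt1 becomes
   a multiple of phi(T1) T2 dT1 after subtraction of an exact form; the primitives
   are absorbed in z1 and z2.  When Lambda > 0 all this is applied to
   (- g, - X, - Lambda). *)

(** * Gradients and closure properties of smooth functions *)

(** The square root has its origin in the Hessian equation: with r = s w^2, s being the sign of r,
    it becomes Hess w = (K - Lambda) w / 2 times gt. When the Hessian of a function on a surface is
    pure trace, its rotated gradient is a Killing field; hence gt becomes diagonal with coefficients
    that depend on w alone, and T2 is the coordinate along this symmetry. The constant (3 K -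
    Lambda) |r|^(3/2) is the only parameter of type A and turns into c1, its sign being absorbed in
    T1. The constant r^2 d_2 c / E only fixes the scales of z1 and z2. The change of overall sign
    when Lambda > 0 is needed in type A because T2 is normalised by the square root of - Lambda / (3
    c1^2).

    Two devices carry the proof. A tensor identity is evaluated at one point, where the values of
    the functions and of their derivatives become independent variables and the identity becomes one
    of rational functions. A function is proved smooth by means of an algebra of functions that
    contains it and is stable under partial derivatives. *)

Section Differentiability.
Context {R : realType} {V W : normedModType R}.

Lemma differentiable_epsP (f : V -> W) x (L : {linear V -> W}) :
  continuous L ->
  (forall e, 0 < e -> \forall y \near x, `|f y - f x - L (y - x)| <= e * `|y - x|) ->
  is_diff x f L.
Proof.
move=> cL fL.
have oL : f \o shift x = cst (f x) + L +o_ 0 id.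
  apply/eqaddoP => e e0; have := fL e e0.
  rewrite [X in X -> _](near_shift 0) subr0; apply: filterS => y.
  by rewrite /= addrK; congr (`|_| <= _); rewrite [in RHS]opprD [RHS]addrA.
have dE := diff_unique cL oL.
by split=> //; apply/diff_locallyP; rewrite dE.
Qed.

Lemma differentiable_eps (f : V -> W) x : differentiable f x ->
  forall e, 0 < e ->
    \forall y \near x, `|f y - f x - 'd f x (y - x)| <= e * `|y - x|.
Proof.
move=> df e e0; have /eqaddoP/(_ _ e0) := diff_locally df.
rewrite [X in _ -> X](near_shift 0) subr0; apply: filterS => y.
by rewrite /= addrK; congr (`|_| <= _); rewrite [in LHS]opprD [LHS]addrA.
Qed.

Lemma differentiable_near (f g : V -> W) x : (\near x, f x = g x) ->
  differentiable f x -> differentiable g x.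
Proof.
move=> fg df; have cdf : continuous ('d f x) by exact: diff_continuous.
have xx := nbhs_singleton fg.
suff: is_diff x g ('d f x) by case.
apply: differentiable_epsP => // e e0; near=> y.
have <- : f y = g y by near: y.
by rewrite -xx; near: y; exact: differentiable_eps.
Unshelve. all: by end_near. Qed.

End Differentiability.

Section Gradients.
Context {R : realType}.

(** Total differentiability and the values of the partials travel together: [partial] is a limit,
    with a default value where the limit does not exist, and the chain rule needs the total
    derivative. *)
Definition has_grad n (f : 'rV[R]_n -> R) (x : 'rV[R]_n) (d : 'I_n -> R) :=
  differentiable f x /\ forall i, partial i f x = d i.

Lemma diff_grad n (f : 'rV[R]_n -> R) x v : differentiable f x ->
  'd f x v = \sum_i v 0 i * partial i f x.
Proof.
move=> df; rewrite [in LHS](row_sum_delta v) linear_sum; apply: eq_bigr => i _.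
by rewrite linearZ /partial deriveE.
Qed.

Lemma has_gradE n (f : 'rV[R]_n -> R) x : differentiable f x ->
  has_grad f x (fun i => partial i f x).
Proof. by []. Qed.

Lemma has_grad_eq n (f : 'rV[R]_n -> R) x d d' : has_grad f x d -> d =1 d' ->
  has_grad f x d'.
Proof. by move=> [df e] dd; split=> // i; rewrite e. Qed.

Lemma has_grad_near n (f g : 'rV[R]_n -> R) x d : (\near x, f x = g x) ->
  has_grad f x d -> has_grad g x d.
Proof.
move=> fg [df e]; split; first exact: differentiable_near df.
by move=> i; rewrite -e /partial; apply: near_eq_derive; near do apply/esym.
Unshelve. all: by end_near. Qed.

(** For functions without a closed formula: local inverses and primitives. *)
Lemma has_grad_epsP n (f : 'rV[R]_n -> R) x d :
  (forall e, 0 < e -> \forall y \near x,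
    `|f y - f x - \sum_i (y - x) 0 i * d i| <= e * `|y - x|) ->
  has_grad f x d.
Proof.
move=> fd; pose L (v : 'rV[R]_n) := \sum_i v 0 i * d i.
have linL : linear L.
  move=> k u v; rewrite /L scaler_sumr -big_split /=; apply: eq_bigr => i _.
  by rewrite !mxE mulrDl -scalerAl.
pose LL := GRing.isLinear.Build _ _ _ _ _ linL.
pose L' : {linear _ -> _} := HB.pack L LL.
have cL : continuous L'.
  move=> v; apply: differentiable_continuous.
  have -> : (L' : 'rV[R]_n -> R) = \sum_i (d i \*: fun u : 'rV[R]_n => u 0 i).
    apply/funext => u; rewrite fct_sumE; apply: eq_bigr => i _.
    by rewrite mulrC.
  apply: differentiable_sum => i; apply: differentiableZ.
  exact: differentiable_coord.
have [df dfL] : is_diff x f L' by exact: differentiable_epsP.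
split=> // i; rewrite /partial deriveE // dfL /= /L (bigD1 i) //= big1 => [|j ji].
  by rewrite mxE !eqxx mul1r addr0.
by rewrite mxE (negPf ji) mul0r.
Qed.

Lemma has_grad_eps n (f : 'rV[R]_n -> R) x d : has_grad f x d ->
  forall e, 0 < e -> \forall y \near x,
    `|f y - f x - \sum_i (y - x) 0 i * d i| <= e * `|y - x|.
Proof.
move=> [df fd] e e0; have := differentiable_eps df e0.
apply: filterS => y; rewrite diff_grad //.
by under eq_bigr do rewrite fd.
Qed.

Section Rules.
Context {n : nat}.
Implicit Types (f g : 'rV[R]_n -> R) (x : 'rV[R]_n) (d : 'I_n -> R).

Lemma has_grad_cst c x : has_grad (fun=> c) x (fun=> 0).
Proof. by split=> [|i]; [exact: differentiable_cst|exact: derive_cst]. Qed.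

Lemma has_grad_coord x j :
  has_grad (fun y => y 0 j) x (fun i => (i == j)%:R).
Proof.
apply: has_grad_epsP => e e0; near=> y.
rewrite (bigD1 j) //= big1 => [|i ij]; last by rewrite (negPf ij) mulr0.
by rewrite eqxx mulr1 addr0 !mxE subrr normr0 mulr_ge0 // ltW.
Unshelve. all: by end_near. Qed.

Lemma has_gradD f g x df dg : has_grad f x df -> has_grad g x dg ->
  has_grad (fun y => f y + g y) x (fun i => df i + dg i).
Proof.
move=> [f1 f2] [g1 g2]; split=> [|i]; first exact: differentiableD.
rewrite -f2 -g2 /partial; apply: deriveD; exact: diff_derivable.
Qed.

Lemma has_gradN f x df : has_grad f x df ->
  has_grad (fun y => - f y) x (fun i => - df i).
Proof.
move=> [f1 f2]; split=> [|i]; first exact: differentiableN.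
rewrite -f2 /partial; apply: deriveN; exact: diff_derivable.
Qed.

Lemma has_gradM f g x df dg : has_grad f x df -> has_grad g x dg ->
  has_grad (fun y => f y * g y) x (fun i => df i * g x + f x * dg i).
Proof.
move=> [f1 f2] [g1 g2]; split=> [|i]; first exact: differentiableM.
rewrite -f2 -g2 /partial deriveM; last 2 first; try exact: diff_derivable.
by rewrite addrC mulrC.
Qed.

Lemma has_gradV f x df : f x != 0 -> has_grad f x df ->
  has_grad (fun y => (f y)^-1) x (fun i => - (df i / f x ^+ 2)).
Proof.
move=> fx [f1 f2]; split=> [|i]; first exact: differentiableV.
rewrite -f2 /partial deriveV //; last exact: diff_derivable.
by rewrite mulrC scaleNr.
Qed.

Lemma has_gradX f x df k : has_grad f x df ->
  has_grad (fun y => f y ^+ k) x (fun i => k%:R * f x ^+ k.-1 * df i).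
Proof.
move=> fd; case: k => [|k].
  by apply: has_grad_eq (has_grad_cst 1 x) _ => i; rewrite !mul0r.
elim: k => [|k IH].
  by apply: has_grad_eq fd _ => i; rewrite expr0 !mul1r.
have -> : (fun y => f y ^+ k.+2) = (fun y => f y * f y ^+ k.+1).
  by apply/funext => y; rewrite exprS.
apply: has_grad_eq (has_gradM fd IH) _ => i /=.
by rewrite -[k.+2]addn1 natrD exprS; ring.
Qed.

End Rules.

Lemma differentiable_row n m (T : 'rV[R]_n -> 'rV[R]_m) x :
  (forall j, differentiable (fun y => T y 0 j) x) -> differentiable T x.
Proof.
move=> dT; have -> : T = \sum_j (fun y => T y 0 j *: delta_mx 0 j).
  by apply/funext => y; rewrite fct_sumE -row_sum_delta.
by apply: differentiable_sum => j; exact: differentiableZl.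
Qed.

Lemma has_grad_comp n m (f : 'rV[R]_m -> R) (T : 'rV[R]_n -> 'rV[R]_m) x df dT :
  has_grad f (T x) df -> (forall j, has_grad (fun y => T y 0 j) x (dT j)) ->
  has_grad (fun y => f (T y)) x (fun i => \sum_j dT j i * df j).
Proof.
move=> [f1 f2] Td.
have dTx : differentiable T x by apply: differentiable_row => j; case: (Td j).
split=> [|i]; first exact: (differentiable_comp dTx f1).
rewrite /partial deriveE; last exact: (differentiable_comp dTx f1).
rewrite (_ : (fun y => f (T y)) = f \o T) // diff_comp //= diff_grad //.
apply: eq_bigr => j _; rewrite f2; congr (_ * _).
have [d1 /(_ i) <-] := Td j; rewrite /partial deriveE // .
rewrite (_ : (fun y => T y 0 j) = (fun z : 'rV[R]_m => z 0 j) \o T) //.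
have dc := (has_grad_coord (T x) j).1; rewrite (diff_comp dTx dc) /= diff_grad //.
under eq_bigr do rewrite (has_grad_coord _ _).2.
rewrite (bigD1 j) //= big1 => [|k kj]; last by rewrite (negPf kj) mulr0.
by rewrite eqxx mulr1 addr0.
Qed.

Lemma has_grad_comp1 n (phi : R -> R) (f : 'rV[R]_n -> R) x df dphi :
  is_derive (f x) 1 phi dphi -> has_grad f x df ->
  has_grad (fun y => phi (f y)) x (fun i => dphi * df i).
Proof.
move=> [p1 p2] [f1 f2].
have dp : differentiable phi (f x) by exact/derivable1_diffP.
have dc := differentiable_comp f1 dp.
split=> [|i]; first exact: dc.
rewrite /partial deriveE //.
rewrite (_ : (fun y => phi (f y)) = phi \o f) // diff_comp //= -f2 /partial.
by rewrite deriveE // deriv1E //= derive1E p2 mulrC.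
Qed.

End Gradients.

(** * Smooth functions as algebras stable under partial derivatives *)

Section Smooth.
Context {R : realType} {n : nat}.
Implicit Types (U : set 'rV[R]_n) (B : set ('rV[R]_n -> R)).

(** Equality on [U] is a constructor because the rules of differentiation apply only at points of
    [U]: a partial derivative has its expected expression there and nowhere else. *)
Inductive generated U B : ('rV[R]_n -> R) -> Prop :=
| gen_base f of B f : generated U B f
| gen_cst c : generated U B (fun=> c)
| gen_add f g of generated U B f & generated U B g :
    generated U B (fun x => f x + g x)
| gen_mul f g of generated U B f & generated U B g :
    generated U B (fun x => f x * g x)
| gen_inv f of generated U B f & (forall x, U x -> f x != 0) :
    generated U B (fun x => (f x)^-1)
| gen_ext f g of generated U B f & (forall x, U x -> f x = g x) :
    generated U B g.

Lemma open_near_eq U (f g : 'rV[R]_n -> R) x : open U -> U x ->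
  (forall x, U x -> f x = g x) -> \near x, f x = g x.
Proof.
move=> oU Ux fg; near=> y; apply: fg; near: y.
exact: open_nbhs_nbhs.
Unshelve. all: by end_near. Qed.

Lemma generated_grad U B : open U ->
  (forall f, B f -> forall x, U x -> differentiable f x) ->
  (forall f i, B f -> generated U B (partial i f)) ->
  forall f, generated U B f ->
    (forall x, U x -> differentiable f x) /\
    (forall i, generated U B (partial i f)).
Proof.
move=> oU dB pB f; elim=> {f}.
- by move=> f Bf; split; [exact: dB|move=> i; exact: pB].
- move=> c; split=> [x _|i]; first exact: (has_grad_cst c x).1.
  apply: (gen_ext (gen_cst _ _ 0)) => x _; by rewrite (has_grad_cst c x).2.
- move=> f g _ [df pf] _ [dg pg]; split=> [x Ux|i].
    exact: (has_gradD (has_gradE (df _ Ux)) (has_gradE (dg _ Ux))).1.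
  apply: (gen_ext (gen_add (pf i) (pg i))) => x Ux.
  by rewrite (has_gradD (has_gradE (df _ Ux)) (has_gradE (dg _ Ux))).2.
- move=> f g gf [df pf] gg [dg pg]; split=> [x Ux|i].
    exact: (has_gradM (has_gradE (df _ Ux)) (has_gradE (dg _ Ux))).1.
  apply: (gen_ext (gen_add (gen_mul (pf i) gg) (gen_mul gf (pg i)))) => x Ux.
  by rewrite (has_gradM (has_gradE (df _ Ux)) (has_gradE (dg _ Ux))).2.
- move=> f gf [df pf] f0; split=> [x Ux|i].
    exact: (has_gradV (f0 _ Ux) (has_gradE (df _ Ux))).1.
  have gi := gen_inv gf f0.
  apply: (gen_ext (gen_mul (gen_cst _ _ (-1)) (gen_mul (pf i) (gen_mul gi gi)))).
  move=> x Ux; rewrite (has_gradV (f0 _ Ux) (has_gradE (df _ Ux))).2.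
  by rewrite mulN1r expr2 invfM.
- move=> f g gf [df pf] fg; split=> [x Ux|i].
    exact: (has_grad_near (open_near_eq oU Ux fg) (has_gradE (df _ Ux))).1.
  apply: (gen_ext (pf i)) => x Ux.
  by rewrite (has_grad_near (open_near_eq oU Ux fg) (has_gradE (df _ Ux))).2.
Qed.

(** Smoothness speaks of all iterated partials. It is enough that the partials of the generators
    stay in the algebra, for then the whole algebra is stable under [partial]. *)
Lemma generated_smooth U B : open U ->
  (forall f, B f -> forall x, U x -> differentiable f x) ->
  (forall f i, B f -> generated U B (partial i f)) ->
  forall f, generated U B f -> smooth_on U f.
Proof.
move=> oU dB pB f gf s; have {gf} : generated U B (foldr partial f s).
  by elim: s => //= i s /(generated_grad oU dB pB)[_].
by move=> /(generated_grad oU dB pB)[].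
Qed.

Lemma smooth_differentiable U f : smooth_on U f ->
  forall x, U x -> differentiable f x.
Proof. by move=> sf x Ux; exact: (sf [::]). Qed.

Lemma smooth_partial U f i : smooth_on U f -> smooth_on U (partial i f).
Proof. by move=> sf s x Ux; have := sf (rcons s i) x Ux; rewrite foldr_rcons. Qed.

Lemma smooth_sub U U' f : U' `<=` U -> smooth_on U f -> smooth_on U' f.
Proof. by move=> UU sf s x /UU; exact: sf. Qed.

Lemma generated_smoothP U f : open U -> generated U (smooth_on U) f ->
  smooth_on U f.
Proof.
move=> oU; apply: generated_smooth => // [g|g i]; first exact: smooth_differentiable.
by move=> sg; exact/gen_base/smooth_partial.
Qed.

Lemma smooth_eq U f g : open U -> smooth_on U f -> (forall x, U x -> f x = g x) ->
  smooth_on U g.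
Proof.
by move=> oU sf fg; apply: generated_smoothP => //; apply: gen_ext fg; exact: gen_base.
Qed.

End Smooth.

Section SmoothClosure.
Context {R : realType} {n : nat} (U : set 'rV[R]_n) (openU : open U).
Implicit Types f g : 'rV[R]_n -> R.

Lemma smooth_cst c : smooth_on U (fun=> c).
Proof. by apply: generated_smoothP => //; exact: gen_cst. Qed.

Lemma smooth_coord j : smooth_on U (fun x => x 0 j).
Proof.
pose B := [set f : 'rV[R]_n -> R | exists j, f = fun x => x 0 j].
apply: (@generated_smooth _ _ U B) => //.
- by move=> f [k ->] x _; exact: (has_grad_coord x k).1.
- move=> f i [k ->]; apply: gen_ext (gen_cst _ _ (i == k)%:R) _ => x _.
  by rewrite (has_grad_coord x k).2.
- by apply: gen_base; exists j.
Qed.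

Lemma smooth_add f g : smooth_on U f -> smooth_on U g ->
  smooth_on U (fun x => f x + g x).
Proof. by move=> sf sg; apply/generated_smoothP/gen_add/gen_base => //; exact: gen_base. Qed.

Lemma smooth_mul f g : smooth_on U f -> smooth_on U g ->
  smooth_on U (fun x => f x * g x).
Proof. by move=> sf sg; apply/generated_smoothP/gen_mul/gen_base => //; exact: gen_base. Qed.

Lemma smooth_opp f : smooth_on U f -> smooth_on U (fun x => - f x).
Proof.
move=> sf; apply: (smooth_eq openU (smooth_mul (smooth_cst (-1)) sf)) => x _.
by rewrite mulN1r.
Qed.

Lemma smooth_inv f : smooth_on U f -> (forall x, U x -> f x != 0) ->
  smooth_on U (fun x => (f x)^-1).
Proof. by move=> sf f0; apply/generated_smoothP/gen_inv => //; exact: gen_base. Qed.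

Lemma smooth_exp f k : smooth_on U f -> smooth_on U (fun x => f x ^+ k).
Proof.
move=> sf; elim: k => [|k IH]; first exact: smooth_cst.
by apply: (smooth_eq openU (smooth_mul sf IH)) => x _; rewrite exprS.
Qed.

Lemma smooth_sum (I : Type) (s : seq I) (F : I -> 'rV[R]_n -> R) :
  (forall i, smooth_on U (F i)) -> smooth_on U (fun x => \sum_(i <- s) F i x).
Proof.
move=> sF; elim: s => [|i s IH].
  by apply: (smooth_eq openU (smooth_cst 0)) => x _; rewrite big_nil.
by apply: (smooth_eq openU (smooth_add (sF i) IH)) => x _; rewrite big_cons.
Qed.

Lemma smooth_comp m (V : set 'rV[R]_m) (T : 'rV[R]_n -> 'rV[R]_m)
    (f : 'rV[R]_m -> R) :
  smooth_mx U T -> (forall x, U x -> V (T x)) -> smooth_on V f ->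
  smooth_on U (fun x => f (T x)).
Proof.
move=> sT UV sf.
have dT j x : U x -> has_grad (fun y => T y 0 j) x (fun i => partial i (fun y => T y 0 j) x).
  by move=> Ux; apply: has_gradE; exact: (sT 0 j [::]).
(* The smooth functions on [U] are among the generators because the chain rule brings in the
   partials of the components of [T]. *)
pose B := [set h : 'rV[R]_n -> R | smooth_on U h \/
  exists2 f : 'rV[R]_m -> R, smooth_on V f & h = fun x => f (T x)].
have dB (f' : 'rV[R]_m -> R) x : smooth_on V f' -> U x ->
    has_grad (fun y => f' (T y)) x (fun i => \sum_j partial i (fun y => T y 0 j) x * partial j f' (T x)).
  move=> sf' Ux; apply: (has_grad_comp _ (fun j => dT j x Ux)).
  by apply: has_gradE; apply: (sf' [::]); exact: UV.
apply: (@generated_smooth _ _ U B) => //; last by apply: gen_base; right; exists f.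
- move=> h [sh|[f' sf' ->]] x Ux; first exact: (sh [::]).
  by case: (dB f' x sf' Ux).
- move=> h i [sh|[f' sf' ->]].
    by apply: gen_base; left; exact: smooth_partial.
  apply: (@gen_ext _ _ _ _ (fun x => \sum_j partial i (fun y => T y 0 j) x * partial j f' (T x))).
    elim: (index_enum _) => [|j s IH].
      by apply: gen_ext (gen_cst _ _ 0) _ => x _; rewrite big_nil.
    apply: (@gen_ext _ _ _ _ (fun x => partial i (fun y => T y 0 j) x * partial j f' (T x) + \sum_(j <- s) partial i (fun y => T y 0 j) x * partial j f' (T x))) => [|x _]; last by rewrite big_cons.
    apply: gen_add IH; apply: gen_mul; apply: gen_base.
      by left; apply: smooth_partial; exact: sT.
    by right; exists (partial j f') => //; exact: smooth_partial.
  by move=> x Ux; rewrite (dB f' x sf' Ux).2.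
Qed.

(* A primitive is covered by taking dphi among the smooth functions; the square
   root and the exponential satisfy a differential equation instead. *)
Lemma smooth_ode f (df : 'I_n -> ('rV[R]_n -> R) -> 'rV[R]_n -> R) :
  (forall x, U x -> has_grad f x (fun i => df i f x)) ->
  (forall i, generated U [set h | h = f \/ smooth_on U h] (df i f)) ->
  smooth_on U f.
Proof.
move=> fd gd; pose B := [set h | h = f \/ smooth_on U h].
apply: (@generated_smooth _ _ U B) => //; last by apply: gen_base; left.
- by move=> h [->|sh] x Ux; [case: (fd x Ux)|exact: (sh [::])].
- move=> h i [->|sh]; last by apply: gen_base; right; exact: smooth_partial.
  by apply: gen_ext (gd i) _ => x Ux; rewrite (fd x Ux).2.
Qed.

End SmoothClosure.

(** * Symmetry of second derivatives *)

Section MeanValue.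
Context {R : realType} {n : nat}.
Implicit Types (f : 'rV[R]_n -> R) (x y v : 'rV[R]_n).

Lemma is_derive_line f x v (s : R) : differentiable f (x + s *: v) ->
  is_derive s 1 (fun t => f (x + t *: v))
    (\sum_i v 0 i * partial i f (x + s *: v)).
Proof.
move=> df; pose l (t : R) := x + t *: v.
have lE : \forall h \near 0^', h^-1 *: ((l \o shift s) (h *: 1) - l s) = v.
  near=> h; have h0 : h != 0 by near: h; exact: nbhs_dnbhs_neq.
  rewrite /l /= [h *: 1]mulr1 opprD addrACA subrr add0r -scalerBl addrK.
  by rewrite scalerA mulVf // scale1r.
have dl : differentiable l s.
  by apply/derivable1_diffP; apply: is_cvg_near_cst lE.
have dlE : 'd l s 1 = v.
  by rewrite -derive1E' // derive1E; apply: lim_near_cst lE.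
have dc := differentiable_comp dl df.
apply: DeriveDef; first exact/derivable1_diffP.
rewrite -derive1E (_ : (fun t => _) = f \o l) // derive1E' // diff_comp //=.
by rewrite dlE diff_grad.
Unshelve. all: by end_near. Qed.

Lemma mvt_line f x v : (forall s : R, 0 <= s <= 1 -> differentiable f (x + s *: v)) ->
  exists2 s : R, 0 < s < 1 & f (x + v) - f x = \sum_i v 0 i * partial i f (x + s *: v).
Proof.
move=> df; have d (s : R) : 0 <= s <= 1 -> is_derive s 1 (fun t => f (x + t *: v))
    (\sum_i v 0 i * partial i f (x + s *: v)).
  by move=> s01; apply: is_derive_line; exact: df.
have [s||s s01] := @MVT R (fun t => f (x + t *: v))
    (fun s => \sum_i v 0 i * partial i f (x + s *: v)) 0 1 ltr01.
- by rewrite in_itv /= => /andP[s0 s1]; apply: d; rewrite !ltW.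
- apply: derivable_within_continuous => s; rewrite in_itv /= => s01.
  by case: (d s s01).
- rewrite subr0 mulr1 scale0r addr0 scale1r => ->; exists s => //.
Qed.

Lemma ballP x d y : ball x d y <-> `|y - x| < d.
Proof. by rewrite -ball_normE /= distrC. Qed.

Lemma ball_segment p d x y (s : R) : ball p d x -> ball p d y -> 0 <= s <= 1 ->
  ball p d (x + s *: (y - x)).
Proof.
move=> /ballP px /ballP py /andP[s0 s1]; apply/ballP.
have -> : x + s *: (y - x) - p = (1 - s) *: (x - p) + s *: (y - p).
  by rewrite !scalerBr scalerBl !scale1r scalerBl scale1r; apply/rowP => i;
    rewrite !mxE; ring.
apply: le_lt_trans (ler_normD _ _) _; rewrite !normrZ (ger0_norm s0).
rewrite (ger0_norm (_ : 0 <= 1 - s)) ?subr_ge0 //.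
have [->|sn0] := eqVneq s 0; first by rewrite mul0r addr0 subr0 mul1r.
have : s * `|y - p| < s * d by rewrite ltr_pM2l // lt_neqAle eq_sym sn0.
have : (1 - s) * `|x - p| <= (1 - s) * d by rewrite ler_wpM2l ?subr_ge0 // ltW.
lra.
Qed.

Lemma ball_mvt f p d x y : (forall z, ball p d z -> differentiable f z) ->
  ball p d x -> ball p d y ->
  exists2 z, ball p d z & f y - f x = \sum_i (y - x) 0 i * partial i f z.
Proof.
move=> df px py; have [s s01|s /andP[s0 s1] e] := @mvt_line f x (y - x).
  by apply: df; exact: ball_segment.
rewrite [x + (y - x)]addrC subrK in e; exists (x + s *: (y - x)) => //.
by apply: ball_segment; rewrite ?ltW.
Qed.

Lemma ball_constant f p d x : (forall z, ball p d z -> has_grad f z (fun=> 0)) ->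
  ball p d x -> f x = f p.
Proof.
move=> df px; have [z pz|||z pz] := @ball_mvt f p d p x.
- by case: (df z pz).
- by apply: ballxx; move/ballP: px; apply: le_lt_trans.
- exact: px.
- rewrite big1 => [/eqP|i _]; first by rewrite subr_eq0 => /eqP.
  by have [_ ->] := df z pz; rewrite mulr0.
Qed.

Lemma norm_coord_le v i : `|v 0 i| <= `|v|.
Proof.
rewrite [leRHS]mx_normrE.
by have := le_bigmax_cond 0 (fun j : 'I_1 * 'I_n => `|v j.1 j.2|) (isT : predT (0, i)).
Qed.

Lemma norm_le_coord v e : 0 <= e -> (forall i, `|v 0 i| <= e) -> `|v| <= e.
Proof.
move=> e0 ve; rewrite [leLHS]mx_normrE; apply: bigmax_le => // -[i j] _ /=.
by rewrite ord1.
Qed.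

Lemma norm_delta i : `|delta_mx 0 i : 'rV[R]_n| = 1.
Proof.
apply/le_anti/andP; split.
  apply: norm_le_coord => // j; rewrite mxE eqxx /=.
  by case: (_ == _); rewrite ?normr1 ?normr0.
by have := norm_coord_le (delta_mx 0 i) i; rewrite mxE !eqxx normr1.
Qed.

(* Young's argument: the second difference is h^2 times either mixed partial. *)
Lemma second_difference f x i j e : 0 < e ->
  (\near x, differentiable f x) -> differentiable (partial i f) x ->
  \forall h \near 0^'+, 
    `|f (x + h *: delta_mx 0 i + h *: delta_mx 0 j) - f (x + h *: delta_mx 0 i)
      - f (x + h *: delta_mx 0 j) + f x - h ^+ 2 * partial j (partial i f) x|
    <= e * h ^+ 2.
Proof.
move=> e0 /nbhs_ballP[d1 /= d10 df] dif.
have e3 : 0 < e / 3 by rewrite divr_gt0.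
have /nbhs_ballP[d2 /= d20 dd] := has_grad_eps (has_gradE dif) e3.
near=> h.
have h0 : 0 < h by near: h; exact: nbhs_right_gt.
have h1 : 2 * h < d1.
  rewrite -ltr_pdivlMl //; near: h; apply: nbhs_right_lt; exact: mulr_gt0.
have h2 : 2 * h < d2.
  rewrite -ltr_pdivlMl //; near: h; apply: nbhs_right_lt; exact: mulr_gt0.
have nh (s t : R) : 0 <= s <= 1 -> 0 <= t <= 1 ->
    `|(s * h) *: delta_mx 0 i + (t * h) *: delta_mx 0 j : 'rV[R]_n| <= (s + t) * h.
  move=> /andP[s0 s1] /andP[t0 t1]; apply: le_trans (ler_normD _ _) _.
  by rewrite !normrZ !norm_delta !mulr1 !ger0_norm ?mulr_ge0 ?(ltW h0) // mulrDl.
have xab (a b : 'rV[R]_n) : x + a + b - x = a + b.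
  by rewrite -[x + a + b]addrA [x + _ - x]addrAC subrr add0r.
(* [k] is the first difference in direction [j]. The mean value theorem for [k] in direction [i]
   yields the same [s] for both of its terms, and differentiability of [partial i f] at the single
   point [x] then controls both. *)
pose k y := f (y + h *: delta_mx 0 j) - f y.
have dk (s : R) : 0 <= s <= 1 -> has_grad k (x + s *: (h *: delta_mx 0 i))
    (fun m => partial m f (x + s *: (h *: delta_mx 0 i) + h *: delta_mx 0 j)
              - partial m f (x + s *: (h *: delta_mx 0 i))).
  move=> s01; apply: has_gradD; last first.
    apply/has_gradN/has_gradE/df/ballP; rewrite addrC addKr scalerA.
    have := nh s 0 s01; rewrite lexx ler01 mul0r scale0r !addr0 => /(_ isT).
    move/le_lt_trans; apply; move: s01 h1 => /andP[s0 s1].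
    have : s * h <= 1 * h by rewrite ler_wpM2r // ltW.
    lra.
  have -> : (fun m => partial m f (x + s *: (h *: delta_mx 0 i) + h *: delta_mx 0 j))
     = (fun m => \sum_l (l == m)%:R *
        partial l f (x + s *: (h *: delta_mx 0 i) + h *: delta_mx 0 j)).
    apply/funext => m; rewrite (bigD1 m) //= eqxx mul1r big1 ?addr0 // => l lm.
    by rewrite (negPf lm) mul0r.
  apply: (@has_grad_comp _ _ _ f (fun y => y + h *: delta_mx 0 j) _ _
     (fun l m => (l == m)%:R)) => [|l].
    apply: has_gradE; apply/df/ballP.
    rewrite xab scalerA.
    have := nh s 1 s01; rewrite lexx ler01 mul1r => /(_ isT).
    move/le_lt_trans; apply; move: s01 h1 => /andP[s0 s1].
    have : (s + 1) * h <= (1 + 1) * h by rewrite ler_wpM2r ?lerD ?(ltW h0).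
    lra.
  have -> : (fun y : 'rV[R]_n => (y + h *: delta_mx 0 j) 0 l) =
    (fun y => y 0 l + (h *: delta_mx 0 j : 'rV[R]_n) 0 l).
    by apply/funext => y; rewrite mxE.
  apply: has_grad_eq (has_gradD (has_grad_coord _ _) (has_grad_cst _ _)) _ => m.
  by rewrite addr0 eq_sym.
have [s s01|s /andP[s0 s1]] := @mvt_line k x (h *: delta_mx 0 i).
  by case: (dk s s01).
have s01 : 0 <= s <= 1 by rewrite !ltW.
rewrite (bigD1 i) //= big1 => [|l li]; last by rewrite !mxE (negPf li) andbF mulr0 mul0r.
rewrite (dk s s01).2 addr0 !mxE !eqxx mulr1 scalerA.
set y0 := x + (s * h) *: _; set y1 := y0 + _ => kE.
rewrite (_ : _ + f x = h * (partial i f y1 - partial i f y0)); last first.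
  by rewrite -kE /k; ring.
have b0 : `|y0 - x| <= s * h.
  rewrite /y0 addrC addKr; have := nh s 0 s01.
  by rewrite lexx ler01 mul0r scale0r !addr0 => /(_ isT).
have b1 : `|y1 - x| <= (s + 1) * h.
  rewrite /y1 xab; have := nh s 1 s01.
  by rewrite lexx ler01 mul1r => /(_ isT).
have sh : s * h <= h by rewrite -[leRHS]mul1r ler_wpM2r // ltW.
have l1 : (s + 1) * h < d2.
  by apply: le_lt_trans h2; rewrite ler_pM2r // lerD2r ltW.
have l0 : s * h < d2.
  by apply: le_lt_trans h2; rewrite ler_pM2r // (le_trans (ltW s1)) // ler1n.
have D1 := dd y1 ((ballP _ _ _).2 (le_lt_trans b1 l1)).
have D0 := dd y0 ((ballP _ _ _).2 (le_lt_trans b0 l0)).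
rewrite /= in D0 D1.
set S1 := \sum_i _ in D1; set S0 := \sum_i _ in D0.
have S10 : S1 - S0 = h * partial j (partial i f) x.
  rewrite /S1 /S0 -sumrB (bigD1 j) //= big1 => [|l lj].
    rewrite addr0 -mulrBl /y1 /y0 !mxE !eqxx [h * true%:R]mulr1; congr (_ * _); ring.
  rewrite -mulrBl /y1 /y0 !mxE (negPf lj) andbF [h * false%:R]mulr0; ring.
have -> : h * (partial i f y1 - partial i f y0) - h ^+ 2 * partial j (partial i f) x
  = h * ((partial i f y1 - partial i f x - S1) - (partial i f y0 - partial i f x - S0)).
  rewrite expr2 -mulrA -S10; ring.
rewrite normrM (gtr0_norm h0) [e * _]mulrC expr2 -mulrA ler_pM2l //.
apply: le_trans (ler_normB _ _) _.
apply: le_trans (lerD D1 D0) _.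
rewrite -mulrDr; have := ler_wpM2l (ltW e3) (lerD b1 b0).
move/le_trans; apply.
have -> : h * e = e / 3 * (3 * h) by field.
rewrite ler_pM2l //; lra.
Unshelve. all: by end_near. Qed.

(** The second difference is symmetric in [i] and [j], so divided by [h ^+ 2] it is within [e / 2]
    of either mixed partial. *)
Lemma partial_comm f x i j : (\near x, differentiable f x) ->
  differentiable (partial i f) x -> differentiable (partial j f) x ->
  partial j (partial i f) x = partial i (partial j f) x.
Proof.
move=> df di dj; apply/eqP; rewrite -subr_eq0 -normr_le0.
apply/ler_addgt0Pl => e e0; rewrite addr0.
have e2 : 0 < e / 2 by rewrite divr_gt0.
have hA := second_difference j e2 df di.
have hB := second_difference i e2 df dj.
have [h [[A B] /= hgt0]] := filter_ex (filterI (filterI hA hB) (nbhs_right_gt 0)).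
have h0 : 0 < h ^+ 2 by rewrite exprn_gt0.
rewrite [x + h *: delta_mx 0 j + _]addrAC in B.
rewrite -(ler_pM2l h0) -{1}(gtr0_norm h0) -normrM.
move: A B; move: (f (x + _ + _)) (f (x + h *: delta_mx 0 i)) => a b.
move: (f (x + _)) (f x) (partial j _ x) (partial i _ x) (h ^+ 2) => c d u v k A B.
have -> : k * (u - v) = (a - c - b + d - k * v) - (a - b - c + d - k * u) by ring.
apply: le_trans (ler_normB _ _) _; apply: le_trans (lerD B A) _.
by rewrite -mulrDl -splitr mulrC.
Qed.

Lemma smooth_partial_comm U f x i j : open U -> smooth_on U f -> U x ->
  partial j (partial i f) x = partial i (partial j f) x.
Proof.
move=> oU sf Ux; apply: partial_comm; last 2 first.
- exact: (sf [:: i]).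
- exact: (sf [:: j]).
near=> y; apply: (sf [::]); near: y; exact: open_nbhs_nbhs.
Unshelve. all: by end_near. Qed.

End MeanValue.

(** * Indices of the charts and automation of derivatives *)

Notation d1 := (partial (0 : 'I_2)).
Notation d2 := (partial (1 : 'I_2)).

Section Indices.
Context {R : realType}.
Local Notation pt2 := 'rV[R]_2.
Local Notation pt := 'rV[R]_(2 + 2).

Definition o0 : 'I_(2 + 2) := lshift 2 (0 : 'I_2).
Definition o1 : 'I_(2 + 2) := lshift 2 (1 : 'I_2).
Definition o2 : 'I_(2 + 2) := rshift 2 (0 : 'I_2).
Definition o3 : 'I_(2 + 2) := rshift 2 (1 : 'I_2).

Lemma ord2P (P : 'I_2 -> Prop) : P 0 -> P 1 -> forall i, P i.
Proof.
move=> P0 P1 [[|[|m]] i] //.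
- by rewrite (_ : Ordinal i = 0) //; exact: val_inj.
- by rewrite (_ : Ordinal i = 1) //; exact: val_inj.
Qed.

Lemma ord4P (P : 'I_(2 + 2) -> Prop) : P o0 -> P o1 -> P o2 -> P o3 ->
  forall i, P i.
Proof.
move=> P0 P1 P2 P3 i; rewrite -[i](@splitK 2 2); case: (fintype.split i) => j /=.
  by move: j; exact: ord2P.
by move: j; exact: ord2P.
Qed.

Lemma sum2E (F : 'I_2 -> R) : \sum_i F i = F 0 + F 1.
Proof.
rewrite big_ord_recl big_ord1; congr (_ + F _); exact: val_inj.
Qed.

Lemma sum4E (F : 'I_(2 + 2) -> R) : \sum_i F i = F o0 + F o1 + F o2 + F o3.
Proof. by rewrite big_split_ord /= !sum2E addrA. Qed.

Definition of_tpart (d : 'I_2 -> R) (i : 'I_(2 + 2)) : R :=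
  match fintype.split i with inl j => d j | inr _ => 0 end.

Lemma of_tpartE d : (of_tpart d o0 = d 0) * (of_tpart d o1 = d 1) *
  (of_tpart d o2 = 0) * (of_tpart d o3 = 0).
Proof. by rewrite /of_tpart !(unsplitK (inl _)) !(unsplitK (inr _)). Qed.

Lemma has_grad_tpart (f : pt2 -> R) (x : pt) d : has_grad f (tpart x) d ->
  has_grad (fun y => f (tpart y)) x (of_tpart d).
Proof.
move=> fd.
have td j : has_grad (fun y : pt => tpart y 0 j) x (fun i => (i == lshift 2 j)%:R).
  apply: has_grad_near (has_grad_coord x (lshift 2 j)).
  by near=> y; rewrite mxE.
apply: has_grad_eq (has_grad_comp fd td) _; rewrite /= => i; rewrite sum2E.
by elim/ord4P : i; rewrite of_tpartE /= ?mul1r ?mul0r ?addr0 ?add0r.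
Unshelve. all: by end_near. Qed.

Lemma mx2E (a b c d : R) :
  (mx2 a b c d 0 0 = a) * (mx2 a b c d 0 1 = b) *
  (mx2 a b c d 1 0 = c) * (mx2 a b c d 1 1 = d).
Proof. by rewrite !mxE. Qed.

End Indices.

Ltac neq0_auto :=
  repeat first [assumption | apply: mulf_neq0 | apply: expf_neq0];
  try by rewrite pnatr_eq0.

(** Syntax-directed differentiation: the gradient in the goal may be an existential variable, which
    the rules instantiate. The gradients of the atoms are taken from the context. *)
Ltac grad_auto :=
  lazymatch goal with
  | |- has_grad (fun _ => ?c) _ _ => exact: has_grad_cst
  | |- has_grad (fun v => (@?f v + @?g v)%R) _ _ =>
      apply: (@has_gradD _ _ f g); grad_auto
  | |- has_grad (fun v => (- (@?f v))%R) _ _ => apply: (@has_gradN _ _ f); grad_auto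
  | |- has_grad (fun v => (@?f v * @?g v)%R) _ _ =>
      apply: (@has_gradM _ _ f g); grad_auto
  | |- has_grad (fun v => ((@?f v)^-1)%R) _ _ =>
      apply: (@has_gradV _ _ f); [neq0_auto|grad_auto]
  | |- has_grad (fun v => (@?f v ^+ ?k)%R) _ _ =>
      apply: (@has_gradX _ _ f _ _ k); grad_auto
  | H : has_grad ?f ?u _ |- has_grad (fun v => ?f v) ?u _ => exact H
  end.

(** The side conditions that denominators have no zeros are left open. *)
Ltac smooth_auto :=
  lazymatch goal with
  | |- smooth_on _ (fun _ => ?c) => apply: smooth_cst; assumption
  | |- smooth_on _ (fun v => (@?f v + @?g v)%R) =>
      apply: (@smooth_add _ _ _ _ f g); [assumption|smooth_auto|smooth_auto]
  | |- smooth_on _ (fun v => (- (@?f v))%R) =>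
      apply: (@smooth_opp _ _ _ _ f); [assumption|smooth_auto]
  | |- smooth_on _ (fun v => (@?f v * @?g v)%R) =>
      apply: (@smooth_mul _ _ _ _ f g); [assumption|smooth_auto|smooth_auto]
  | |- smooth_on _ (fun v => ((@?f v)^-1)%R) =>
      apply: (@smooth_inv _ _ _ _ f); [assumption|smooth_auto|]
  | |- smooth_on _ (fun v => (@?f v ^+ ?k)%R) =>
      apply: (@smooth_exp _ _ _ _ f k); [assumption|smooth_auto]
  | |- smooth_on _ (fun v => v ?i ?j) => apply: smooth_coord; assumption
  | H : smooth_on ?V ?f |- smooth_on ?V (fun v => ?f v) => exact: H
  | H : smooth_on ?V ?f |- smooth_on ?V (fun v => partial ?i ?f v) =>
      exact: (smooth_partial i H)
  | |- _ => idtac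
  end.

Lemma smooth_tpart {R : realType} (U : set 'rV[R]_(2 + 2)) (V : set 'rV[R]_2)
    (f : 'rV[R]_2 -> R) : open U -> (forall x, U x -> V (tpart x)) ->
  smooth_on V f -> smooth_on U (fun x => f (tpart x)).
Proof.
move=> oU UV sf; apply: (smooth_comp oU _ UV sf) => i j.
apply: (smooth_eq oU (smooth_coord oU (lshift 2 j))) => x _.
by rewrite mxE ord1.
Qed.

(** * Ricci tensor of the normal form *)

Section Ricci.
Context {R : realType}.
Local Notation pt2 := 'rV[R]_2.
Local Notation pt := 'rV[R]_(2 + 2).
Variables (V : set pt2) (e0 : R) (E a c h r : pt2 -> R).
Hypotheses (openV : open V) (e0E : e0 = 1 \/ e0 = -1).
Hypotheses (sE : smooth_on V E) (sa : smooth_on V a) (sc : smooth_on V c)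
  (sh : smooth_on V h) (sr : smooth_on V r).
Hypotheses (E0 : forall u, V u -> E u != 0) (r0 : forall u, V u -> r u != 0)
  (d2a : forall u, V u -> d2 a u = 0).

(** The index order is t1, t2, z1, z2. The tables make every Christoffel symbol an explicit rational
    expression in [E], [a], [c], [h], [r] and their first derivatives. *)
Definition g_tab (u : pt2) : seq (seq R) := [::
    [:: E u + 2 * a u * c u * r u + a u ^+ 2 * h u; 0; a u * h u + c u * r u; a u * r u];
    [:: 0; E u * e0; 0; 0];
    [:: a u * h u + c u * r u; 0; h u; r u];
    [:: a u * r u; 0; r u; 0]].
Definition inv_tab (u : pt2) : seq (seq R) := [::
    [:: 1 / E u; 0; - (a u / E u); - (c u / E u)];
    [:: 0; e0 / E u; 0; 0];
    [:: - (a u / E u); 0; a u ^+ 2 / E u; a u * c u / E u + 1 / r u];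
    [:: - (c u / E u); 0; a u * c u / E u + 1 / r u; c u ^+ 2 / E u - h u / r u ^+ 2]].
(* The tables of derivatives use [d2 a = 0]. *)
Definition dg1_tab (u : pt2) : seq (seq R) := [::
    [:: d1 E u + 2 * a u * d1 a u * h u + 2 * a u * c u * d1 r u + 2 * a u * d1 c u * r u + a u ^+ 2 * d1 h u + 2 * d1 a u * c u * r u; 0; a u * d1 h u + d1 a u * h u + c u * d1 r u + d1 c u * r u; a u * d1 r u + d1 a u * r u];
    [:: 0; d1 E u * e0; 0; 0];
    [:: a u * d1 h u + d1 a u * h u + c u * d1 r u + d1 c u * r u; 0; d1 h u; d1 r u];
    [:: a u * d1 r u + d1 a u * r u; 0; d1 r u; 0]].
Definition dg2_tab (u : pt2) : seq (seq R) := [::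
    [:: d2 E u + 2 * a u * c u * d2 r u + 2 * a u * d2 c u * r u + a u ^+ 2 * d2 h u; 0; a u * d2 h u + c u * d2 r u + d2 c u * r u; a u * d2 r u];
    [:: 0; d2 E u * e0; 0; 0];
    [:: a u * d2 h u + c u * d2 r u + d2 c u * r u; 0; d2 h u; d2 r u];
    [:: a u * d2 r u; 0; d2 r u; 0]].
Definition chr0_tab (u : pt2) : seq (seq R) := [::
    [:: d1 E u / (2 * E u) - a u * c u * d1 r u / E u - a u ^+ 2 * d1 h u / (2 * E u); d2 E u / (2 * E u) + a u * d2 c u * r u / (2 * E u); - (a u * d1 h u / (2 * E u)) - c u * d1 r u / (2 * E u); - (a u * d1 r u / (2 * E u))];
    [:: d2 E u / (2 * E u) + a u * d2 c u * r u / (2 * E u); - (d1 E u * e0 / (2 * E u)); d2 c u * r u / (2 * E u); 0];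
    [:: - (a u * d1 h u / (2 * E u)) - c u * d1 r u / (2 * E u); d2 c u * r u / (2 * E u); - (d1 h u / (2 * E u)); - (d1 r u / (2 * E u))];
    [:: - (a u * d1 r u / (2 * E u)); 0; - (d1 r u / (2 * E u)); 0]].
Definition chr1_tab (u : pt2) : seq (seq R) := [::
    [:: - (d2 E u * e0 / (2 * E u)) - a u * c u * e0 * d2 r u / E u - a u * d2 c u * e0 * r u / E u - a u ^+ 2 * e0 * d2 h u / (2 * E u); d1 E u / (2 * E u); - (a u * e0 * d2 h u / (2 * E u)) - c u * e0 * d2 r u / (2 * E u) - d2 c u * e0 * r u / (2 * E u); - (a u * e0 * d2 r u / (2 * E u))];
    [:: d1 E u / (2 * E u); d2 E u / (2 * E u); 0; 0];
    [:: - (a u * e0 * d2 h u / (2 * E u)) - c u * e0 * d2 r u / (2 * E u) - d2 c u * e0 * r u / (2 * E u); 0; - (e0 * d2 h u / (2 * E u)); - (e0 * d2 r u / (2 * E u))];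
    [:: - (a u * e0 * d2 r u / (2 * E u)); 0; - (e0 * d2 r u / (2 * E u)); 0]].
Definition chr2_tab (u : pt2) : seq (seq R) := [::
    [:: a u ^+ 2 * c u * d1 r u / E u + a u ^+ 3 * d1 h u / (2 * E u) + a u * d1 r u / r u + d1 a u - d1 E u * a u / (2 * E u); a u * d2 r u / (2 * r u) - d2 E u * a u / (2 * E u) - a u ^+ 2 * d2 c u * r u / (2 * E u); a u * c u * d1 r u / (2 * E u) + a u ^+ 2 * d1 h u / (2 * E u) + d1 r u / (2 * r u); a u ^+ 2 * d1 r u / (2 * E u)];
    [:: a u * d2 r u / (2 * r u) - d2 E u * a u / (2 * E u) - a u ^+ 2 * d2 c u * r u / (2 * E u); d1 E u * a u * e0 / (2 * E u); d2 r u / (2 * r u) - a u * d2 c u * r u / (2 * E u); 0];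
    [:: a u * c u * d1 r u / (2 * E u) + a u ^+ 2 * d1 h u / (2 * E u) + d1 r u / (2 * r u); d2 r u / (2 * r u) - a u * d2 c u * r u / (2 * E u); a u * d1 h u / (2 * E u); a u * d1 r u / (2 * E u)];
    [:: a u ^+ 2 * d1 r u / (2 * E u); 0; a u * d1 r u / (2 * E u); 0]].
Definition chr3_tab (u : pt2) : seq (seq R) := [::
    [:: a u * c u ^+ 2 * d1 r u / E u + a u ^+ 2 * c u * d1 h u / (2 * E u) + a u * d1 h u / r u + c u * d1 r u / r u + d1 c u - d1 E u * c u / (2 * E u) - a u * h u * d1 r u / r u ^+ 2; a u * d2 h u / (2 * r u) + c u * d2 r u / (2 * r u) + d2 c u / 2 - d2 E u * c u / (2 * E u) - a u * c u * d2 c u * r u / (2 * E u) - a u * h u * d2 r u / (2 * r u ^+ 2); a u * c u * d1 h u / (2 * E u) + c u ^+ 2 * d1 r u / (2 * E u) + d1 h u / (2 * r u) - h u * d1 r u / (2 * r u ^+ 2); a u * c u * d1 r u / (2 * E u) + d1 r u / (2 * r u)];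
    [:: a u * d2 h u / (2 * r u) + c u * d2 r u / (2 * r u) + d2 c u / 2 - d2 E u * c u / (2 * E u) - a u * c u * d2 c u * r u / (2 * E u) - a u * h u * d2 r u / (2 * r u ^+ 2); d1 E u * c u * e0 / (2 * E u); d2 h u / (2 * r u) - c u * d2 c u * r u / (2 * E u) - h u * d2 r u / (2 * r u ^+ 2); d2 r u / (2 * r u)];
    [:: a u * c u * d1 h u / (2 * E u) + c u ^+ 2 * d1 r u / (2 * E u) + d1 h u / (2 * r u) - h u * d1 r u / (2 * r u ^+ 2); d2 h u / (2 * r u) - c u * d2 c u * r u / (2 * E u) - h u * d2 r u / (2 * r u ^+ 2); c u * d1 h u / (2 * E u); c u * d1 r u / (2 * E u)];
    [:: a u * c u * d1 r u / (2 * E u) + d1 r u / (2 * r u); d2 r u / (2 * r u); c u * d1 r u / (2 * E u); 0]].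

Definition chr_tab u (k : 'I_(2 + 2)) : seq (seq R) :=
  nth [::] [:: chr0_tab u; chr1_tab u; chr2_tab u; chr3_tab u] k.
(** The coefficients do not depend on z1 and z2: the tables of these two directions are empty, and
    [entry] then returns its default 0. *)
Definition dg_tab u (k : 'I_(2 + 2)) : seq (seq R) :=
  nth [::] [:: dg1_tab u; dg2_tab u; [::]; [::]] k.
Definition entry (t : seq (seq R)) (i j : 'I_(2 + 2)) : R := nth 0 (nth [::] t i) j.

Lemma smooth_grads f u : smooth_on V f -> V u ->
  has_grad f u (fun i => partial i f u).
Proof. by move=> sf Vu; apply: has_gradE; exact: (sf [::]). Qed.

Lemma has_grad_g_tab i j u : V u ->
  has_grad (fun v => entry (g_tab v) i j) u
    (fun k => entry (dg_tab u (lshift 2 k)) i j).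
Proof.
move=> Vu; have := d2a Vu.
have := smooth_grads sE Vu; have := smooth_grads sa Vu.
have := smooth_grads sc Vu; have := smooth_grads sh Vu.
have := smooth_grads sr Vu.
move=> gr gh gc ga gE a2.
elim/ord4P : i; elim/ord4P : j; rewrite /entry /=.
all: refine (has_grad_eq _ _); [by grad_auto|].
all: elim/ord2P; rewrite /= ?a2 //=; ring.
Qed.

Lemma tables_inverse u i j : V u ->
  \sum_k entry (g_tab u) i k * entry (inv_tab u) k j = (i == j)%:R.
Proof.
move=> Vu; move: (E0 Vu) (r0 Vu); rewrite sum4E.
elim/ord4P : i; elim/ord4P : j; rewrite /entry /=.
all: move: (E u) (a u) (c u) (h u) (r u) => E' a' c' h' r' En rn.
all: by case: e0E => e; rewrite ?e; field; rewrite ?En ?rn.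
Qed.

Lemma smooth_inv_tab i j : smooth_on V (fun v => entry (inv_tab v) i j).
Proof.
elim/ord4P : i; elim/ord4P : j; rewrite /entry /=; smooth_auto => //.
all: by move=> u Vu; rewrite ?expf_neq0 ?E0 ?r0.
Qed.

Variables (U : set pt) (g : pt -> 'M[R]_(2 + 2)).
Hypotheses (openU : open U) (UV : forall x, U x -> V (tpart x))
  (sg : smooth_mx U g).
Hypothesis gE : forall x, U x -> forall i j, g x i j = entry (g_tab (tpart x)) i j.

Lemma invmx_tab x : U x -> forall i j, invmx (g x) i j = entry (inv_tab (tpart x)) i j.
Proof.
move=> Ux i j; pose I : 'M[R]_(2 + 2) := \matrix_(k, l) entry (inv_tab (tpart x)) k l.
have gI : g x *m I = 1%:M.
  apply/matrixP => k l; rewrite !mxE -(@tables_inverse (tpart x) k l (UV Ux)).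
  by apply: eq_bigr => m _; rewrite mxE gE.
have [ug _] := mulmx1_unit gI.
by rewrite -[invmx _]mulmx1 -gI mulKmx // mxE.
Qed.

Lemma partial_g k i j x : U x ->
  partial k (fun y => g y i j) x = entry (dg_tab (tpart x) k) i j.
Proof.
move=> Ux; have [_ ->] := has_grad_near (open_near_eq openU Ux
    (fun y Uy => esym (gE Uy i j)))
  (has_grad_tpart (has_grad_g_tab i j (UV Ux))).
by elim/ord4P : k; rewrite of_tpartE //= /entry !nth_nil.
Qed.

Lemma christoffelE k i j x : U x ->
  christoffel g k i j x = entry (chr_tab (tpart x) k) i j.
Proof.
move=> Ux; rewrite /christoffel sum4E !invmx_tab // !partial_g //.
have := E0 (UV Ux); have := r0 (UV Ux); move: (tpart x) => u.
elim/ord4P : k; elim/ord4P : i; elim/ord4P : j; rewrite /entry /=.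
all: move: (E u) (d1 E u) (d2 E u) (a u) (d1 a u) (c u) (d1 c u) (d2 c u).
all: move=> E' E1 E2 a' a1 c' c1 c2.
all: move: (h u) (d1 h u) (d2 h u) (r u) (d1 r u) (d2 r u) => h' h1 h2 r' r1 r2 rn En.
all: by case: e0E => e; rewrite ?e; field; rewrite ?En ?rn.
Qed.

(** Differentiability of the single symbols lets the derivative be taken outside the trace that
    occurs in [ricci]. *)
Lemma smooth_christoffel k i j : smooth_on U (christoffel g k i j).
Proof.
have sp m p q : smooth_on U (partial m (fun y => g y p q)).
  exact: smooth_partial (sg p q).
apply: (@smooth_eq _ _ _ (fun x => 2^-1 * \sum_l entry (inv_tab (tpart x)) k l *
    (partial i (fun y => g y j l) x + partial j (fun y => g y i l) x
     - partial l (fun y => g y i j) x))) => // [|x Ux]; last first.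
  by rewrite /christoffel; congr (_ * _); apply: eq_bigr => l _; rewrite invmx_tab.
apply: smooth_mul; [by []|exact: smooth_cst|apply: smooth_sum => // l].
apply: smooth_mul => //.
  exact: (smooth_tpart openU UV (smooth_inv_tab k l)).
apply: smooth_add => //; last by apply: smooth_opp.
by apply: smooth_add.
Qed.

Definition tr_tab u (i : 'I_(2 + 2)) : R :=
  nth 0 [:: d1 E u / E u + d1 r u / r u; d2 E u / E u + d2 r u / r u; 0; 0] i.

(** The contracted symbol is the logarithmic derivative of [|det g|^(1/2) = |E r|]. Through it the
    symbols with upper index z1 or z2 never have to be differentiated. *)
Lemma chr_trace i u : V u -> \sum_k entry (chr_tab u k) i k = tr_tab u i.
Proof.
move=> Vu; move: (E0 Vu) (r0 Vu); rewrite sum4E.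
elim/ord4P : i; rewrite /entry /tr_tab /=.
all: move: (E u) (d1 E u) (d2 E u) (a u) (d1 a u) (c u) (d1 c u) (d2 c u).
all: move=> E' E1 E2 a' a1 c' c1 c2.
all: move: (h u) (d1 h u) (d2 h u) (r u) (d1 r u) (d2 r u) => h' h1 h2 r' r1 r2 En rn.
all: by case: e0E => e; rewrite ?e; field; rewrite ?En ?rn.
Qed.

Lemma partial_tpart_z k (F : pt2 -> R) (x : pt) :
  partial (rshift 2 k) (fun y => F (tpart y)) x = 0.
Proof.
rewrite /partial /derive; apply: lim_near_cst => //; near=> t.
rewrite /= (_ : tpart (_ + x) = tpart x) ?subrr ?scaler0 //.
by apply/rowP => j; rewrite !mxE eq_lrshift andbF mulr0 add0r.
Unshelve. all: by end_near. Qed.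

(** Nothing depends on z1 and z2, so only the two symbols with upper index t1 or t2 contribute to
    the divergence term; the other derivative term is the derivative of the trace. *)
Lemma ricci_reduced i j x (D0 D1 DT : 'I_2 -> R) : U x ->
  has_grad (fun v => entry (chr0_tab v) i j) (tpart x) D0 ->
  has_grad (fun v => entry (chr1_tab v) i j) (tpart x) D1 ->
  has_grad (fun v => tr_tab v i) (tpart x) DT ->
  ricci g x i j = D0 0 + D1 1 - of_tpart DT j
    + \sum_k \sum_l
      (entry (chr_tab (tpart x) k) k l * entry (chr_tab (tpart x) l) i j
       - entry (chr_tab (tpart x) k) j l * entry (chr_tab (tpart x) l) i k).
Proof.
move=> Ux g0 g1 gT; rewrite mxE; congr (_ + _); last first.
  by apply: eq_bigr => k _; apply: eq_bigr => l _; rewrite !christoffelE.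
rewrite sumrB; congr (_ - _).
  have nr k p q : \near x, entry (chr_tab (tpart x) k) p q = christoffel g k p q x.
    by apply: open_near_eq openU Ux _ => y Uy; rewrite christoffelE.
  rewrite sum4E (has_grad_near (nr o0 i j) (has_grad_tpart g0)).2.
  rewrite (has_grad_near (nr o1 i j) (has_grad_tpart g1)).2 !of_tpartE.
  have z k : partial (rshift 2 k) (christoffel g (rshift 2 k) i j) x = 0.
    rewrite -(partial_tpart_z k (fun u => entry (chr_tab u (rshift 2 k)) i j) x).
    rewrite /partial; apply: near_eq_derive; near do apply/esym.
    exact: nr.
  by rewrite !z !addr0.
have dc k : has_grad (christoffel g k i k) x (fun m => partial m (christoffel g k i k) x).
  by apply: has_gradE; exact: (smooth_christoffel k i k [::]).
have := has_gradD (has_gradD (has_gradD (dc o0) (dc o1)) (dc o2)) (dc o3).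
set F := (fun y => _ + _) => Fd; rewrite sum4E -(Fd.2 j).
have nF : \near x, tr_tab (tpart x) i = F x.
  apply: open_near_eq openU Ux _ => y Uy.
  by rewrite -(chr_trace _ (UV Uy)) sum4E /F !christoffelE.
by rewrite (has_grad_near nF (has_grad_tpart gT)).2.
Unshelve. all: by end_near. Qed.

(** [lap] and [dotp] belong to the flat metric [dt1^2 + e0 dt2^2]; the Laplacian and the product of
    gradients of the orbit metric are their quotients by [E]. *)
Definition lap f u := d1 (d1 f) u + e0 * d2 (d2 f) u.
Definition dotp f1 f2 u := d1 f1 u * d1 f2 u + e0 * (d2 f1 u * d2 f2 u).
(** From here on, components of the Ricci tensor in the frame e1 = d_t1 - a d_z1 - c d_z2, e2 =
    d_t2, d_z1, d_z2: [ric_zz] along the leaves, [mix] for e1 or e2 against d_z1, [hor] for the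
    horizontal pairs. *)
Definition ric_zz12 u := - lap r u / (2 * E u).
Definition ric_zz11 u := (- lap h u + dotp r h u / r u - h u * dotp r r u / r u ^+ 2
   + e0 * (r u * d2 c u) ^+ 2 / E u) / (2 * E u).

Definition mix1 u := - e0 * (d2 (d2 c) u * r u / 2 + d2 c u * d2 r u
   - d2 E u * d2 c u * r u / (2 * E u)) / E u.
Definition mix2 u := (d1 (d2 c) u * r u / 2 + d2 c u * d1 r u
   - d1 E u * d2 c u * r u / (2 * E u)) / E u.
(** This is [- lap (log E) / 2] written out, that is [E] times the Gauss curvature of the orbit
    metric. *)
Definition gauss_E u := (dotp E E u / E u - lap E u) / (2 * E u).
Definition hor11 u := gauss_E u - d1 (d1 r) u / r u + d1 r u ^+ 2 / (2 * r u ^+ 2)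
   + (d1 E u * d1 r u - e0 * (d2 E u * d2 r u)) / (2 * E u * r u).
Definition hor12 u := - d1 (d2 r) u / r u + d1 r u * d2 r u / (2 * r u ^+ 2)
   + (d1 E u * d2 r u + d2 E u * d1 r u) / (2 * E u * r u).
Definition hor22 u := e0 * gauss_E u - d2 (d2 r) u / r u + d2 r u ^+ 2 / (2 * r u ^+ 2)
   + (d2 E u * d2 r u - e0 * (d1 E u * d1 r u)) / (2 * E u * r u).

(** Once the symmetry of second derivatives and [d2 a = 0] have been substituted, the values of the
    functions and of their derivatives at the point are generalised to independent variables; what
    remains is an identity of rational functions. *)
Ltac ricci_entry x Ux :=
  let Vu := fresh in let En := fresh in let rn := fresh in let an := fresh in
  let sw := fresh in let sw' := fresh in let e := fresh in
  have Vu := UV Ux; have En := E0 Vu; have rn := r0 Vu; have an := d2a Vu;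
  have sw := smooth_partial_comm 0 1 openV sr Vu;
  have sw' := smooth_partial_comm 0 1 openV sE Vu;
  have ? := smooth_grads sE Vu; have ? := smooth_grads sa Vu;
  have ? := smooth_grads sc Vu; have ? := smooth_grads sh Vu;
  have ? := smooth_grads sr Vu;
  have ? := smooth_grads (smooth_partial 0 sE) Vu;
  have ? := smooth_grads (smooth_partial 0 sc) Vu;
  have ? := smooth_grads (smooth_partial 0 sh) Vu;
  have ? := smooth_grads (smooth_partial 0 sr) Vu;
  have ? := smooth_grads (smooth_partial 1 sE) Vu;
  have ? := smooth_grads (smooth_partial 1 sc) Vu;
  have ? := smooth_grads (smooth_partial 1 sh) Vu;
  have ? := smooth_grads (smooth_partial 1 sr) Vu;
  refine (eq_trans (ricci_reduced _ _ _ _) _);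
  [eassumption|rewrite /entry /=; grad_auto|rewrite /entry /=; grad_auto
  |rewrite /tr_tab /=; grad_auto|];
  rewrite of_tpartE sum4E !sum4E /entry /=;
  rewrite /ric_zz12 /ric_zz11 /mix1 /mix2 /hor11 /hor12 /hor22 /gauss_E /lap /dotp;
  rewrite ?an ?sw ?sw';
  clear - En rn e0E;
  move: En rn;
  move: (d1 (d1 E) (tpart x)) (d1 (d2 E) (tpart x)) (d2 (d2 E) (tpart x)) (d1 E (tpart x)) (d2 E (tpart x)) (E (tpart x));
  move=> ? ? ? ? ? ?;
  move: (d1 (d1 c) (tpart x)) (d1 (d2 c) (tpart x)) (d2 (d2 c) (tpart x)) (d1 c (tpart x)) (d2 c (tpart x)) (c (tpart x));
  move=> ? ? ? ? ? ?;
  move: (d1 (d1 r) (tpart x)) (d1 (d2 r) (tpart x)) (d2 (d2 r) (tpart x)) (d1 r (tpart x)) (d2 r (tpart x)) (r (tpart x));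
  move=> ? ? ? ? ? ?;
  move: (d1 (d1 h) (tpart x)) (d1 (d2 h) (tpart x)) (d2 (d2 h) (tpart x)) (d1 h (tpart x)) (d2 h (tpart x)) (h (tpart x));
  move=> ? ? ? ? ? ?;
  move: (d1 a (tpart x)) (a (tpart x)) => ? ? En rn;
  case: e0E => e; rewrite e; field; rewrite ?En ?rn //.

Lemma ricci_z12 x : U x -> ricci g x o2 o3 = ric_zz12 (tpart x).
Proof. move=> Ux; ricci_entry x Ux. Qed.

Lemma ricci_z11 x : U x -> ricci g x o2 o2 = ric_zz11 (tpart x).
Proof. move=> Ux; ricci_entry x Ux. Qed.

Lemma ricci_2z x : U x -> ricci g x o1 o2 = mix2 (tpart x).
Proof. move=> Ux; ricci_entry x Ux. Qed.

Lemma ricci_22 x : U x -> ricci g x o1 o1 = hor22 (tpart x).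
Proof. move=> Ux; ricci_entry x Ux. Qed.

Lemma ricci_12 x : U x -> ricci g x o0 o1 = hor12 (tpart x) + a (tpart x) * mix2 (tpart x).
Proof. move=> Ux; ricci_entry x Ux. Qed.

Lemma ricci_1z x : U x -> ricci g x o0 o2 =
  mix1 (tpart x) + a (tpart x) * ric_zz11 (tpart x) + c (tpart x) * ric_zz12 (tpart x).
Proof. move=> Ux; ricci_entry x Ux. Qed.

Lemma ricci_11 x : U x -> ricci g x o0 o0 = hor11 (tpart x)
  + 2 * a (tpart x) * mix1 (tpart x) + a (tpart x) ^+ 2 * ric_zz11 (tpart x)
  + 2 * a (tpart x) * c (tpart x) * ric_zz12 (tpart x).
Proof. move=> Ux; ricci_entry x Ux. Qed.

End Ricci.

(** Row vectors as a complete normed space, for the Banach fixed point theorem. *)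
HB.instance Definition _ (R : realType) (m n : nat) := Complete.on 'M[R]_(m, n).

(** * Inverse function theorem *)

Section InverseFunction.
Context {R : realType} {n : nat}.
Implicit Types (T : 'rV[R]_n -> 'rV[R]_n) (x y p : 'rV[R]_n) (A B : 'M[R]_n).

Definition dmx T x : 'M[R]_n := \matrix_(i, j) partial i (fun y => T y 0 j) x.

Lemma mulmx_bound B : exists2 C, 0 < C & forall v : 'rV[R]_n, `|v *m B| <= C * `|v|.
Proof.
exists (1 + \sum_i \sum_j `|B i j|) => [|v].
  by rewrite ltr_pwDl // sumr_ge0 // => i _; rewrite sumr_ge0.
have C0 : 0 <= \sum_i \sum_j `|B i j| by rewrite sumr_ge0 // => i _; rewrite sumr_ge0.
apply: norm_le_coord => [|j]; first by rewrite mulr_ge0 // addr_ge0.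
rewrite mxE; apply: le_trans (ler_norm_sum _ _ _) _.
apply: (@le_trans _ _ (\sum_i `|B i j| * `|v|)).
  by apply: ler_sum => i _; rewrite normrM mulrC ler_wpM2l // norm_coord_le.
rewrite -mulr_suml ler_wpM2r // -[leLHS]add0r lerD // ler_sum // => i _.
by rewrite (bigD1 j) //= lerDl sumr_ge0.
Qed.

(** Continuity of the partials at [p] makes the first-order estimate uniform in both end points.
    This uniformity is what makes the Newton map below a contraction. *)
Lemma strict_differentiability T p d e : 0 < e -> smooth_mx (ball p d) T -> 0 < d ->
  exists2 t : R, 0 < t <= d & forall x y, ball p t x -> ball p t y ->
    `|T y - T x - (y - x) *m dmx T p| <= e * `|y - x|.
Proof.
move=> e0 sT d0.
have e'0 : 0 < e / n.+1%:R by rewrite divr_gt0.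
have : \forall x \near p, forall i j, `|dmx T x i j - dmx T p i j| < e / n.+1%:R.
  apply: (filter_forall (nbhs_filter p)) => i; apply: (filter_forall (nbhs_filter p)) => j.
  have : {for p, continuous (fun x => dmx T x i j)}.
    have -> : (fun x => dmx T x i j) = partial i (fun y => T y 0 j).
      by apply/funext => x; rewrite mxE.
    by apply: differentiable_continuous; apply: (sT 0 j [:: i]); exact: ballxx.
  by move=> /cvgrPdist_lt/(_ _ e'0); apply: filterS => x; rewrite distrC.
move=> /nbhs_ballP[s /= s0 Ts]; exists (Num.min s d).
  by rewrite lt_min s0 d0 ge_min lexx orbT.
move=> x y px py; apply: norm_le_coord => [|j]; first by rewrite mulr_ge0 // ltW.
have [z|||z pz e1] := @ball_mvt R n (fun y => T y 0 j) p (Num.min s d) x y.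
- move=> pz; apply: (sT 0 j [::]).
  by apply: le_ball pz; rewrite ge_min lexx orbT.
- exact: px.
- exact: py.
have -> : (T y - T x - (y - x) *m dmx T p) 0 j =
    \sum_i (y - x) 0 i * (dmx T z i j - dmx T p i j).
  rewrite !mxE e1 -sumrB; apply: eq_bigr => i _.
  by rewrite !mxE mulrBr.
apply: le_trans (ler_norm_sum _ _ _) _.
apply: (@le_trans _ _ (\sum_(i < n) e / n.+1%:R * `|y - x|)).
  apply: ler_sum => i _; rewrite normrM mulrC ler_pM //; last exact: norm_coord_le.
  by apply/ltW/Ts; apply: le_ball pz; rewrite ge_min lexx.
rewrite sumr_const card_ord -[_ *+ n]mulr_natl mulrA ler_wpM2r // mulrCA.
apply: ler_piMr; first exact: ltW.
by rewrite ler_pdivrMr // mul1r ler_nat leqnSn.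
Qed.

Theorem local_inverse T p d : 0 < d -> smooth_mx (ball p d) T ->
  dmx T p \in unitmx ->
  exists (W W' : set 'rV[R]_n) (S : 'rV[R]_n -> 'rV[R]_n) (C : R),
    [/\ open W /\ open W', W p, W `<=` ball p d,
      (forall x, W x -> W' (T x) /\ S (T x) = x) /\
      (forall q, W' q -> W (S q) /\ T (S q) = q) &
      forall q q', W' q -> W' q' -> `|S q - S q'| <= C * `|q - q'|].
Proof.
move=> d0 sT uA; set A := dmx T p in uA; pose B := invmx A.
have [C C0 BC] := mulmx_bound B.
(* With this tolerance the Newton step [phi q], whose derivative is frozen at [p], contracts by 1/2
   on the ball of radius [t], whatever [q] is. *)
have e0 : 0 < (2 * C)^-1 by rewrite invr_gt0 mulr_gt0.
have [t /andP[t0 td] Tt] := strict_differentiability e0 sT d0.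
pose phi q x := x - (T x - q) *m B.
have phiL q x y : ball p t x -> ball p t y -> `|phi q y - phi q x| <= 2^-1 * `|y - x|.
  move=> px py; have -> : phi q y - phi q x = - ((T y - T x - (y - x) *m A) *m B).
    rewrite mulmxBl -mulmxA mulmxV // mulmx1 /phi !mulmxBl.
    by apply/rowP => i; rewrite !mxE; ring.
  rewrite normrN; apply: le_trans (BC _) _.
  apply: le_trans (ler_wpM2l (ltW C0) (Tt _ _ px py)) _.
  rewrite mulrA ler_wpM2r // invfM mulrCA mulfV ?gt_eqF // mulr1 //.
have TL x y : ball p t x -> ball p t y -> `|y - x| <= 2 * C * `|T y - T x|.
  move=> px py; have := phiL 0 _ _ px py.
  have -> : phi 0 y - phi 0 x = (y - x) - (T y - T x) *m B.
    by rewrite /phi !mulmxBl; apply/rowP => i; rewrite !mxE; ring.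
  have := BC (T y - T x); have := ler_distD ((y - x) - (T y - T x) *m B) (y - x) 0.
  rewrite !subr0; set u := _ *m B; have -> : y - x - (y - x - u) = u.
    by rewrite opprB addrC subrK.
  set m := `|y - x|; set k := `|T y - T x|; set l := `|u|; set w := `|_ - u|.
  move=> h1 h2 h3; have := lerD h2 h3; lra.
(* The fixed point is sought in the closed ball of radius [rho < t], closed for the sake of
   completeness. The radius [eta] keeps the displacement of the centre below [rho / 2], so that this
   ball is mapped into itself. *)
pose rho := t / 2; pose eta := rho / (2 * C).
have rho0 : 0 < rho by rewrite divr_gt0.
have eta0 : 0 < eta by rewrite divr_gt0 // mulr_gt0.
have solve q : ball (T p) eta q -> exists2 x, ball p t x & T x = q.
  move=> /ballP qe.
  pose D := [set x : 'rV[R]_n | `|x - p| <= rho].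
  have Dt x : D x -> ball p t x.
    by move=> Dx; apply/ballP; apply: le_lt_trans Dx _; rewrite /rho ltr_pdivrMr // ltr_pMr // ltr1n.
  have Dp : D p by rewrite /D /= subrr normr0 ltW.
  have phiD : set_fun D D (phi q).
    move=> x Dx; rewrite /D /=.
    have -> : phi q x - p = (phi q x - phi q p) - (T p - q) *m B.
      by rewrite /phi; apply/rowP => i; rewrite !mxE; ring.
    apply: le_trans (ler_normB _ _) _.
    have h1 := phiL q p x (Dt _ Dp) (Dt _ Dx).
    have h2 := BC (T p - q).
    have h3 : C * `|T p - q| <= 2^-1 * rho.
      rewrite distrC; apply: le_trans (ler_wpM2l (ltW C0) (ltW qe)) _.
      rewrite (_ : C * eta = 2^-1 * rho) // /eta; clearbody rho.
      by field; rewrite gt_eqF.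
    move: Dx; rewrite /D /=; set k := `|x - p| in h1 *; set l := `|phi q x - _| in h1 *.
    set m := `|_ *m B| in h2 *; lra.
  pose F := isFun.Build _ _ D D (phi q) phiD.
  pose f : {fun D >-> D} := HB.pack (phi q) F.
  have cf : is_contraction f.
    exists (2^-1)%:nng; split => /=; first by rewrite invf_lt1 // ltr1n.
    by move=> [x y] [/= Dx Dy]; apply: phiL; exact: Dt.
  have cD : closed D.
    have -> : D = closed_ball_ (@Num.norm _ _) p rho.
      by apply/seteqP; split=> x; rewrite /D /closed_ball_ /= distrC.
    exact: closed_closed_ball_.
  have [x Dx xE] := banach_fixed_point cf cD (ex_intro _ p Dp).
  exists x; first exact: Dt.
  move: xE; rewrite /= /phi => /eqP; rewrite -subr_eq0 opprB addrCA subrr addr0.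
  move=> /eqP TB; apply/eqP; rewrite -subr_eq0; apply/eqP.
  by rewrite -[LHS]mulmx1 -(mulVmx uA) mulmxA -/B TB mul0mx.
pose W' := ball (T p) eta.
pose S q := xget p [set x | ball p t x /\ T x = q].
have SP q : W' q -> ball p t (S q) /\ T (S q) = q.
  by move=> /solve[x px Tx]; rewrite /S; case: xgetP => [y -> //|/(_ x)[]].
have TC x : ball p t x -> {for x, continuous T}.
  move=> px; apply: differentiable_continuous; apply: differentiable_row => j.
  apply: (sT 0 j [::]); exact: le_ball px.
exists (ball p t `&` T @^-1` W'), W', S, (2 * C); split.
- split; last exact: ball_open.
  rewrite openE => x [px Tx]; apply: filterI.
    by apply: open_nbhs_nbhs; split => //; exact: ball_open.
  apply: TC px _ _; apply: open_nbhs_nbhs; split => //; exact: ball_open.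
- by split; [exact: ballxx|exact: ballxx].
- by move=> x [px _]; exact: le_ball px.
- split=> [x [px Tx]|q Wq]; last first.
    by have [pS TS] := SP q Wq; rewrite /= TS.
  split=> //; have [pS TS] := SP _ Tx.
  apply/eqP; rewrite -subr_eq0 -normr_le0.
  by have := TL _ _ px pS; rewrite TS subrr normr0 mulr0.
- move=> q q' Wq Wq'; have [pS TS] := SP _ Wq; have [pS' TS'] := SP _ Wq'.
  by have := TL _ _ pS' pS; rewrite TS TS'.
Qed.

End InverseFunction.

Section SmoothInverse.
Context {R : realType}.

Lemma smooth_prod n (U : set 'rV[R]_n) (I : Type) (s : seq I) (F : I -> 'rV[R]_n -> R) :
  open U -> (forall i, smooth_on U (F i)) -> smooth_on U (fun x => \prod_(i <- s) F i x).
Proof.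
move=> oU sF; elim: s => [|i s IH].
  by apply: (smooth_eq oU (smooth_cst oU 1)) => x _; rewrite big_nil.
by apply: (smooth_eq oU (smooth_mul oU (sF i) IH)) => x _; rewrite big_cons.
Qed.

Lemma smooth_det n k (U : set 'rV[R]_n) (M : 'rV[R]_n -> 'M[R]_k) :
  open U -> smooth_mx U M -> smooth_on U (fun x => \det (M x)).
Proof.
move=> oU sM; apply: smooth_sum => // s; apply: smooth_mul => //.
  exact: smooth_cst.
by apply: smooth_prod.
Qed.

Lemma smooth_invmx n k (U : set 'rV[R]_n) (M : 'rV[R]_n -> 'M[R]_k) :
  open U -> smooth_mx U M -> (forall x, U x -> M x \in unitmx) ->
  smooth_mx U (fun x => invmx (M x)).
Proof.
move=> oU sM uM i j.
apply: (@smooth_eq _ _ _ (fun x => (\det (M x))^-1 * cofactor (M x) j i)) => //; last first.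
  by move=> x Ux; rewrite /invmx uM // !mxE.
apply: smooth_mul => //.
  apply: smooth_inv => //; first exact: smooth_det.
  by move=> x Ux; rewrite -unitfE -unitmxE uM.
apply: smooth_mul => //; first exact: smooth_cst.
apply: smooth_det => // k1 k2.
by apply: (smooth_eq oU (sM (lift j k1) (lift i k2))) => x _; rewrite !mxE.
Qed.

(** The Lipschitz bound on [S] turns the expansion of [T] at [S q] into an expansion of [S] at [q],
    whose derivative is the inverse matrix of [dmx T] taken at [S q]. The functions [f (S q)] with
    [f] smooth therefore generate an algebra that is stable under partials and contains the
    components of [S]. *)
Theorem inverse_function n (T : 'rV[R]_n -> 'rV[R]_n) p d : 0 < d ->
  smooth_mx (ball p d) T -> (forall x, ball p d x -> dmx T x \in unitmx) ->
  exists (W W' : set 'rV[R]_n) (S : 'rV[R]_n -> 'rV[R]_n),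
    [/\ coordinate_change W W' T S, W p & W `<=` ball p d].
Proof.
move=> d0 sT uT; have pp : ball p d p by exact: ballxx.
have [W [W' [S [C [[oW oW'] Wp Wd [WT TS] LS]]]]] := local_inverse d0 sT (uT p pp).
pose F i j x := invmx (dmx T x) i j.
have oB : open (ball p d) by exact: ball_open.
have sF i j : smooth_on (ball p d) (F i j).
  have sd : smooth_mx (ball p d) (dmx T).
    move=> k l; apply: (smooth_eq oB (smooth_partial k (sT 0 l))) => x _.
    by rewrite mxE.
  exact: smooth_invmx.
have gS q j : W' q -> has_grad (fun q => S q 0 j) q (fun i => F i j (S q)).
  move=> Wq; apply: has_grad_epsP => e e0.
  have [WS TSq] := TS q Wq; have Bx := Wd _ WS.
  have [B B0 BF] := mulmx_bound (invmx (dmx T (S q))).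
  (* A positive Lipschitz constant is needed as a divisor, and the sign of [C] is not known. The
     error is then shrunk by [B], the bound on the inverse matrix, and by [C']. *)
  pose C' := `|C| + 1.
  have C0 : 0 < C' by rewrite ltr_wpDl.
  have e'0 : 0 < e / (B * C') by rewrite divr_gt0 // mulr_gt0.
  have : \forall y \near S q, forall k,
      `|T y 0 k - T (S q) 0 k - \sum_i (y - S q) 0 i * dmx T (S q) i k|
        <= e / (B * C') * `|y - S q|.
    apply: (filter_forall (nbhs_filter (S q))) => k.
    have /has_grad_eps/(_ _ e'0) := has_gradE (sT 0 k [::] _ Bx).
    apply: filterS => y; rewrite (eq_bigr (fun i => (y - S q) 0 i * dmx T (S q) i k)) //.
    by move=> i _; rewrite [dmx _ _ _ _]mxE.
  move=> /nbhs_ballP[t /= t0 Tt].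
  have S_Lip q' : W' q' -> `|S q' - S q| <= C' * `|q' - q|.
    move=> Wq'; apply: le_trans (LS _ _ Wq' Wq) _; rewrite ler_wpM2r //.
    by rewrite /C' -[leLHS]addr0 lerD // ler_norm.
  have nW : \forall q' \near q, W' q' by apply: open_nbhs_nbhs.
  have nt : \forall q' \near q, ball q (t / C') q' by apply: nbhsx_ballx; rewrite divr_gt0.
  near=> q'.
  have Wq' : W' q' by near: q'.
  have : ball q (t / C') q' by near: q'.
  rewrite ballP ltr_pdivlMr // mulrC => qt.
  have St : ball (S q) t (S q').
    by rewrite ballP; apply: le_lt_trans qt; exact: S_Lip.
  have [_ TSq'] := TS q' Wq'.
  have {Tt}TD : `|q' - q - (S q' - S q) *m dmx T (S q)| <= e / (B * C') * `|S q' - S q|.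
    apply: norm_le_coord => [|k]; first by rewrite mulr_ge0 // ltW.
    by have := Tt _ St k; rewrite TSq TSq' !mxE.
  have E : S q' 0 j - S q 0 j - \sum_i (q' - q) 0 i * F i j (S q) =
      - ((q' - q - (S q' - S q) *m dmx T (S q)) *m invmx (dmx T (S q))) 0 j.
    by rewrite mulmxBl -mulmxA mulmxV ?uT // mulmx1 !mxE opprB.
  rewrite E normrN; apply: le_trans (norm_coord_le _ _) _.
  apply: le_trans (BF _) _; apply: le_trans (ler_wpM2l (ltW B0) TD) _.
  have := ler_wpM2l (ltW e'0) (S_Lip _ Wq').
  move=> /(ler_wpM2l (ltW B0))/le_trans; apply.
  rewrite le_eqVlt; apply/orP; left; apply/eqP.
  by move: (gt_eqF B0) (gt_eqF C0) => b c; clearbody C'; field; rewrite b c.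
pose BB := [set h | exists2 f : 'rV[R]_n -> R, smooth_on (ball p d) f & h = fun q : 'rV[R]_n => f (S q)].
have SB q : W' q -> ball p d (S q) by move=> /TS[/Wd].
have gB (f : 'rV[R]_n -> R) q : smooth_on (ball p d) f -> W' q ->
    has_grad (fun q => f (S q)) q (fun i => \sum_j F i j (S q) * partial j f (S q)).
  move=> sf Wq; apply: (@has_grad_comp _ _ _ f S q _ (fun j i => F i j (S q))).
    by apply: has_gradE; apply: (sf [::]); exact: SB.
  by move=> j; exact: gS.
have sS : smooth_mx W' S.
  move=> i j; rewrite ord1; apply: (@generated_smooth _ _ W' BB) => //.
  - by move=> h [f sf ->] q Wq; case: (gB f q sf Wq).
  - move=> h k [f sf ->].
    apply: (@gen_ext _ _ _ _ (fun q : 'rV[R]_n => \sum_j F k j (S q) * partial j f (S q))).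
      elim: (index_enum _) => [|l s IH].
        by apply: gen_ext (gen_cst _ _ 0) _ => q _; rewrite big_nil.
      apply: (@gen_ext _ _ _ _ (fun q : 'rV[R]_n => F k l (S q) * partial l f (S q)
          + \sum_(j <- s) F k j (S q) * partial j f (S q))) => [|q _]; last by rewrite big_cons.
      apply: gen_add IH; apply: gen_mul; apply: gen_base.
        by exists (F k l).
      by exists (partial l f) => //; exact: smooth_partial.
    by move=> q Wq; rewrite (gB f q sf Wq).2.
  - by apply: gen_base; exists (fun x => x 0 j) => //; exact: smooth_coord.
exists W, W', S; split => //; split => //.
by split => // i j; apply: smooth_sub (sT i j).
Unshelve. all: by end_near. Qed.

End SmoothInverse.

(** * Jacobian matrices and metrics in new coordinates *)

Section Jacobian.
Context {R : realType} {n : nat}.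
Implicit Types (f y x : 'rV[R]_n -> 'rV[R]_n).

Lemma jacobianE f p : (forall j, differentiable (fun q => f q 0 j) p) -> 'J f p = dmx f p.
Proof.
move=> df; have dfp : differentiable f p by exact: differentiable_row.
apply/matrixP => i j; rewrite [RHS]mxE /partial deriveE //.
rewrite (_ : (fun q => f q 0 j) = (fun z : 'rV[R]_n => z 0 j) \o f) //.
have dc := (has_grad_coord (f p) j).1; rewrite (diff_comp dfp dc) /= diff_grad //.
rewrite (bigD1 j) //= (has_grad_coord _ _).2 eqxx mulr1 big1 => [|k kj].
  by rewrite addr0 /jacobian [LHS]mxE.
by rewrite (has_grad_coord _ _).2 (negPf kj) mulr0.
Qed.

Lemma smooth_jacobian (U : set 'rV[R]_n) f p : smooth_mx U f -> U p -> 'J f p = dmx f p.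
Proof. by move=> sf Up; apply: jacobianE => j; exact: (smooth_differentiable (sf 0 j)). Qed.

Lemma jacobian_inverse (W W' : set 'rV[R]_n) y x q : coordinate_change W W' y x ->
  W' q -> 'J x q *m 'J y (x q) = 1%:M.
Proof.
move=> [[oW oW'] [sy sx] xy yx] Wq; have [Wx yxq] := yx q Wq.
rewrite (smooth_jacobian sx Wq) (smooth_jacobian sy Wx).
apply/matrixP => i j; rewrite !mxE.
have dy := has_gradE (smooth_differentiable (sy 0 j) Wx).
have dx k := has_gradE (smooth_differentiable (sx 0 k) Wq).
have := (has_grad_comp dy dx).2 i.
have nr : \near q, (q : 'rV[R]_n) 0 j = y (x q) 0 j.
  by apply: (@open_near_eq _ _ W' (fun z => z 0 j) (fun z => y (x z) 0 j)) => // p /yx[_ ->].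
rewrite (has_grad_near nr (has_grad_coord q j)).2 => ->.
by apply: eq_bigr => k _; rewrite !mxE.
Qed.

(** New components of a metric are verified by pulling the candidate [M] back along [y], so the
    derivatives of the inverse map [x] never have to be computed. *)
Lemma metric_in_eq (W W' : set 'rV[R]_n) y x g (M : 'M[R]_n) q :
  coordinate_change W W' y x -> W' q ->
  g (x q) = dmx y (x q) *m M *m (dmx y (x q))^T -> metric_in x g q = M.
Proof.
move=> cc Wq gE; have JJ := jacobian_inverse cc Wq.
have [[oW oW'] [sy sx] xy yx] := cc; have [Wx _] := yx q Wq.
rewrite /metric_in gE -(smooth_jacobian sy Wx) !mulmxA JJ mul1mx.
by rewrite -mulmxA -trmx_mul JJ trmx1 mulmx1.
Qed.

End Jacobian.

(** * Poincare lemma in the plane *)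

Section Primitive1.
Context {R : realType}.
Implicit Types f : R -> R.
Let mu := @lebesgue_measure R.

Lemma integrable_segment f a b : (forall t, a <= t <= b -> {for t, continuous f}) ->
  mu.-integrable `[a, b] (EFin \o f).
Proof.
move=> cf; apply: continuous_compact_integrable; first exact: segment_compact.
apply: continuous_in_subspaceT => t; rewrite inE /= in_itv /=; exact: cf.
Qed.

Lemma is_derive_integral f lo a x hi : lo < a -> a < x -> x < hi ->
  (forall t, lo < t < hi -> {for t, continuous f}) ->
  is_derive x 1 (fun x => (\int[mu]_(t in `[a, x]) f t)%R) (f x).
Proof.
move=> la ax xh cf; pose u := (x + hi) / 2.
have xu : x < u by rewrite /u; lra.
have uh : u < hi by rewrite /u; lra.
have int : mu.-integrable `[a, u] (EFin \o f).
  by apply: integrable_segment => t /andP[at_ tu]; apply: cf; lra.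
have [|dF dFE] := continuous_FTC1_closed xu int ax; first by apply: cf; lra.
by apply: DeriveDef; [exact: dF|rewrite -derive1E; exact: dFE].
Qed.

Lemma integral_derivative (F f : R -> R) lo a b hi : lo < a -> a < b -> b < hi ->
  (forall t, lo < t < hi -> {for t, continuous f}) ->
  (forall t, lo < t < hi -> is_derive t 1 F (f t)) ->
  (\int[mu]_(t in `[a, b]) f t)%R = F b - F a.
Proof.
move=> la ab bh cf dF.
have cF t : lo < t < hi -> {for t, continuous F}.
  by move=> /dF[dt _]; apply: differentiable_continuous; exact/derivable1_diffP.
rewrite /Rintegral (@continuous_FTC2 _ f F) //.
- apply: continuous_in_subspaceT => t; rewrite inE /= in_itv /= => /andP[at_ tb].
  by apply: cf; lra.
- split.
  + by move=> t; rewrite in_itv /= => /andP[at_ tb]; case: (dF t) => //; lra.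
  + by apply: cvg_at_right_filter; apply: (cF a); lra.
  + by apply: cvg_at_left_filter; apply: (cF b); lra.
- move=> t; rewrite in_itv /= => /andP[at_ tb]; rewrite derive1E.
  by case: (dF t) => [|_ ->//]; lra.
Qed.

End Primitive1.

Section Primitive2.
Context {R : realType}.
Let mu := @lebesgue_measure R.

Definition pair2 (x y : R) : 'rV[R]_2 := \row_j (if j == 0 then x else y).

Lemma pair2E x y : (pair2 x y 0 0 = x) * (pair2 x y 0 1 = y).
Proof. by rewrite !mxE. Qed.

Lemma pair2K (u : 'rV[R]_2) : pair2 (u 0 0) (u 0 1) = u.
Proof. by apply/rowP; elim/ord2P; rewrite !mxE. Qed.

Lemma pair2_line x y : (pair2 x y = pair2 0 y + x *: delta_mx 0 0) *
  (pair2 x y = pair2 x 0 + y *: delta_mx 0 1).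
Proof. by split; apply/rowP; elim/ord2P; rewrite !mxE /=; ring. Qed.

(** The norm is the supremum norm: balls are squares, and the path along two sides used for
    primitives stays inside. *)
Lemma ball_pair2 (p : 'rV[R]_2) d x y : 0 < d ->
  ball p d (pair2 x y) <-> `|x - p 0 0| < d /\ `|y - p 0 1| < d.
Proof.
move=> d0; rewrite ballP; split=> [pd|[xd yd]].
  by split; apply: le_lt_trans pd; [have := norm_coord_le (pair2 x y - p) 0
    | have := norm_coord_le (pair2 x y - p) 1]; rewrite !mxE.
apply: (@le_lt_trans _ _ (Num.max `|x - p 0 0| `|y - p 0 1|)); last by rewrite gt_max xd.
apply: norm_le_coord; first by rewrite le_max normr_ge0.
by elim/ord2P; rewrite !mxE /= le_max lexx ?orbT.
Qed.

Lemma is_derive_pair2 (f : 'rV[R]_2 -> R) x y : differentiable f (pair2 x y) ->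
  is_derive x 1 (fun t => f (pair2 t y)) (d1 f (pair2 x y)) /\
  is_derive y 1 (fun t => f (pair2 x t)) (d2 f (pair2 x y)).
Proof.
move=> df; split.
  have := @is_derive_line _ _ f (pair2 0 y) (delta_mx 0 0) x.
  rewrite -(pair2_line x y).1 sum2E !mxE /= mul1r mul0r addr0 => /(_ df).
  by under eq_fun do rewrite -(pair2_line _ y).1.
have := @is_derive_line _ _ f (pair2 x 0) (delta_mx 0 1) y.
rewrite -(pair2_line x y).2 sum2E !mxE /= mul1r mul0r add0r => /(_ df).
by under eq_fun do rewrite -(pair2_line x _).2.
Qed.

(** Continuous partials give total differentiability: the increment is split into one leg along each
    axis, and the mean value theorem is applied to each leg. *)
Lemma has_grad_C1 (G a b : 'rV[R]_2 -> R) p d u : ball p d u ->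
  (forall x y, ball p d (pair2 x y) ->
    is_derive x 1 (fun t => G (pair2 t y)) (a (pair2 x y)) /\
    is_derive y 1 (fun t => G (pair2 x t)) (b (pair2 x y))) ->
  {for u, continuous a} -> {for u, continuous b} ->
  has_grad G u (fun i => if i == 0 then a u else b u).
Proof.
move=> pu dG ca cb; apply: has_grad_epsP => e e0.
have e2 : 0 < e / 2 by rewrite divr_gt0.
have : \forall y \near u, ball p d y /\ (`|a y - a u| < e / 2 /\ `|b y - b u| < e / 2).
  apply: filterI; first by apply: open_nbhs_nbhs; split => //; exact: ball_open.
  move/cvgrPdist_lt/(_ _ e2) : ca => ca; move/cvgrPdist_lt/(_ _ e2) : cb => cb.
  by apply: filterS (filterI ca cb) => y [h1 h2]; split; rewrite distrC.
move=> /nbhs_ballP[t /= t0 ut]; apply/nbhs_ballP; exists t => //= y uy.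
have mvt1 (F f : R -> R) (lo hi x x' : R) : lo < x < hi -> lo < x' < hi ->
    (forall s, lo < s < hi -> is_derive s 1 F (f s)) ->
    exists2 s, `|s - x| <= `|x' - x| & F x' - F x = f s * (x' - x).
  move=> xl xl' dF.
  have cF s : lo < s < hi -> {for s, continuous F}.
    by move=> /dF[ds _]; apply: differentiable_continuous; exact/derivable1_diffP.
  have [xx|xx] := leP x x'.
    have [s||s] := @MVT_segment _ F f x x' xx.
    - by rewrite in_itv /= => /andP[xs sx]; apply: dF; lra.
    - apply: continuous_in_subspaceT => s; rewrite inE /= in_itv /= => /andP[xs sx].
      by apply: cF; lra.
    - rewrite in_itv /= => /andP[xs sx] ->; exists s => //.
      by rewrite !ger0_norm; lra.
  have [s||s] := @MVT_segment _ F f x' x (ltW xx).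
  - by rewrite in_itv /= => /andP[xs sx]; apply: dF; lra.
  - apply: continuous_in_subspaceT => s; rewrite inE /= in_itv /= => /andP[xs sx].
    by apply: cF; lra.
  - rewrite in_itv /= => /andP[xs sx] E; exists s => //.
      by rewrite !ler0_norm; lra.
    by rewrite -[LHS]opprB E; ring.
set u1 := u 0 0; set u2 := u 0 1; set y1 := y 0 0; set y2 := y 0 1.
have [uy1 uy2] : `|y1 - u1| < t /\ `|y2 - u2| < t.
  by apply/ball_pair2 => //; rewrite pair2K.
have bt x z : `|x - u1| < t -> `|z - u2| < t -> ball u t (pair2 x z).
  by move=> *; apply/ball_pair2.
have [s1 s1y E1] : exists2 s, `|s - u1| <= `|y1 - u1| &
    G (pair2 y1 y2) - G (pair2 u1 y2) = a (pair2 s y2) * (y1 - u1).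
  apply: (mvt1 (fun s => G (pair2 s y2)) (fun s => a (pair2 s y2)) (u1 - t) (u1 + t)).
  - by lra.
  - by move: uy1; rewrite ltr_norml; lra.
  - move=> s su; apply: (dG s y2 _).1; apply: (ut _ _).1; apply: bt => //.
    by rewrite ltr_norml; lra.
have [s2 s2y E2] : exists2 s, `|s - u2| <= `|y2 - u2| &
    G (pair2 u1 y2) - G (pair2 u1 u2) = b (pair2 u1 s) * (y2 - u2).
  apply: (mvt1 (fun s => G (pair2 u1 s)) (fun s => b (pair2 u1 s)) (u2 - t) (u2 + t)).
  - by lra.
  - by move: uy2; rewrite ltr_norml; lra.
  - move=> s su; apply: (dG u1 s _).2; apply: (ut _ _).1; apply: bt.
      by rewrite subrr normr0.
    by rewrite ltr_norml; lra.
rewrite -[in G y](pair2K y) -[in G u](pair2K u) -/u1 -/u2 -/y1 -/y2 sum2E.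
have -> : G (pair2 y1 y2) = G (pair2 u1 u2) + a (pair2 s1 y2) * (y1 - u1)
   + b (pair2 u1 s2) * (y2 - u2) by rewrite -E1 -E2; ring.
rewrite !mxE /= -/y1 -/u1 -/y2 -/u2.
have [_ [+ _]] := ut _ (bt s1 y2 (le_lt_trans s1y uy1) uy2).
have u11 : `|u1 - u1| < t by rewrite subrr normr0.
have [_ [_ +]] := ut _ (bt u1 s2 u11 (le_lt_trans s2y uy2)).
move: (a (pair2 _ _)) (b (pair2 _ _)) (a u) (b u) (G _) => A B au bu Gu hB hA.
have -> : Gu + A * (y1 - u1) + B * (y2 - u2) - Gu - ((y1 - u1) * au + (y2 - u2) * bu)
  = (A - au) * (y1 - u1) + (B - bu) * (y2 - u2) by ring.
apply: le_trans (ler_normD _ _) _; rewrite !normrM [e]splitr mulrDl.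
have c1 : `|y1 - u1| <= `|y - u| by have := norm_coord_le (y - u) 0; rewrite !mxE.
have c2 : `|y2 - u2| <= `|y - u| by have := norm_coord_le (y - u) 1; rewrite !mxE.
by apply: lerD; apply: ler_pM => //; exact: ltW.
Qed.

Lemma continuous_bounded_ball (f : 'rV[R]_2 -> R) p d : 0 < d ->
  (forall x, `|x - p| <= d -> {for x, continuous f}) ->
  exists2 M, 0 <= M & forall x, `|x - p| <= d -> `|f x| <= M.
Proof.
move=> d0 cf; pose D := closed_ball_ (@Num.norm _ 'rV[R]_2) p d.
have DP x : D x <-> `|x - p| <= d by rewrite /D /closed_ball_ /= distrC.
have cD : compact D.
  apply: bounded_closed_compact; last exact: closed_closed_ball_.
  exists (`|p| + d); split=> [|M pM]; first exact: num_real.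
  move=> x /DP xd; apply: ltW.
  apply: le_lt_trans pM; rewrite -[x](subrK p) addrC.
  by apply: le_trans (ler_normD _ _) _; rewrite lerD2l.
have : compact (f @` D).
  apply: continuous_compact cD; apply: continuous_in_subspaceT => x.
  by rewrite inE => /DP; exact: cf.
move=> /compact_bounded[M [_ fM]]; exists (`|M| + 1); first by rewrite addr_ge0.
move=> x /DP Dx; apply: (fM (`|M| + 1)); last by exists x.
by rewrite (le_lt_trans (ler_norm M)) // ltrDl.
Qed.

(* The primitive is the integral of the form along the path that follows the
   bottom side of the square and then goes up. *)
Theorem poincare (a b : 'rV[R]_2 -> R) p d : 0 < d ->
  smooth_on (ball p d) a -> smooth_on (ball p d) b ->
  (forall u, ball p d u -> d2 a u = d1 b u) ->
  exists G, smooth_on (ball p (d / 2)) G /\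
    forall u, ball p (d / 2) u -> d1 G u = a u /\ d2 G u = b u.
Proof.
(* The paths start at the corner [(x0, y0)] of the square of half size; the larger square leaves
   room for two-sided limits on its boundary. *)
move=> d0 sa sb ab; pose e := d / 2; pose x0 := p 0 0 - e; pose y0 := p 0 1 - e.
have e0 : 0 < e by rewrite divr_gt0.
have ed : e < d by rewrite /e; lra.
have in_d x y : p 0 0 - d < x < p 0 0 + d -> p 0 1 - d < y < p 0 1 + d ->
    ball p d (pair2 x y).
  by move=> hx hy; apply/ball_pair2 => //; rewrite !ltr_norml; lra.
have in_e x y : ball p e (pair2 x y) -> x0 < x < p 0 0 + e /\ y0 < y < p 0 1 + e.
  by move/ball_pair2 => /(_ e0); rewrite !ltr_norml /x0 /y0; lra.
have cont2 (f : 'rV[R]_2 -> R) x y : smooth_on (ball p d) f -> ball p d (pair2 x y) ->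
    {for x, continuous (fun t => f (pair2 t y))} /\
    {for y, continuous (fun t => f (pair2 x t))}.
  move=> sf xy; have [[dx _] [dy _]] := is_derive_pair2 (sf [::] _ xy).
  by split; apply: differentiable_continuous; apply/derivable1_diffP;
    [exact: dx|exact: dy].
pose A x := (\int[mu]_(t in `[x0, x]) a (pair2 t y0))%R.
pose B x y := (\int[mu]_(t in `[y0, y]) b (pair2 x t))%R.
have y0d : p 0 1 - d < y0 < p 0 1 + d by rewrite /y0; lra.
have dA x : x0 < x < p 0 0 + e -> is_derive x 1 A (a (pair2 x y0)).
  move=> /andP[xx xe]; apply: (@is_derive_integral _ (fun t => a (pair2 t y0))
      (p 0 0 - d) _ _ (p 0 0 + d)) => //; try by rewrite /x0; lra.
  by move=> t td; apply: (cont2 a t y0 sa _).1; exact: in_d.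
have dB2 x y : x0 < x < p 0 0 + e -> y0 < y < p 0 1 + e ->
    is_derive y 1 (B x) (b (pair2 x y)).
  move=> xe /andP[yy ye]; apply: (@is_derive_integral _ (fun t => b (pair2 x t))
      (p 0 1 - d) _ _ (p 0 1 + d)) => //; try by rewrite /y0; lra.
  move=> t td; apply: (cont2 b x t sb _).2; apply: in_d => //.
  by move: xe; rewrite /x0; lra.
have dB1 x y : x0 < x < p 0 0 + e -> y0 < y < p 0 1 + e ->
    is_derive x 1 (B^~ y) (a (pair2 x y) - a (pair2 x y0)).
  move=> xe ye.
  have xd : p 0 0 - d < x < p 0 0 + d by move: xe; rewrite /x0; lra.
  have pd t s : x0 < t < p 0 0 + e -> y0 <= s <= y -> ball p d (pair2 t s).
    by move=> te ts; apply: in_d; move: te ts ye; rewrite /x0 /y0; lra.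
  (* The constant that dominates the integrand in the differentiation under the integral sign. *)
  have [M M0 bM] : exists2 M, 0 <= M & forall x, `|x - p| <= e -> `|d1 b x| <= M.
    apply: continuous_bounded_ball => // u up; apply: differentiable_continuous.
    by apply: (sb [:: 0]); apply/ballP; apply: le_lt_trans up ed.
  have db t s : x0 < t < p 0 0 + e -> y0 <= s <= y ->
      is_derive t 1 (fun t => b (pair2 t s)) (d1 b (pair2 t s)).
    by move=> te ts; exact: (is_derive_pair2 (sb [::] _ (pd _ _ te ts))).1.
  have intb t : t \in `]x0, p 0 0 + e[ ->
      mu.-integrable `[y0, y] (EFin \o (fun s => b (pair2 t s))).
    rewrite in_itv /= => te; apply: integrable_segment => s sy.
    by apply: (cont2 b t s sb _).2; exact: pd.
  have Ix : `]x0, p 0 0 + e[%classic x by rewrite /= in_itv.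
  have derb t s : `]x0, p 0 0 + e[%classic t -> `[y0, y]%classic s ->
      derivable (fun t => b (pair2 t s)) t 1.
    by rewrite /= !in_itv /= => te ts; case: (db t s te ts).
  have intM : mu.-integrable `[y0, y] (EFin \o (fun=> M)).
    by apply: integrable_segment => s _; exact: cvg_cst.
  have ubM t s : `]x0, p 0 0 + e[%classic t -> `[y0, y]%classic s ->
      `|partial1of2 (fun t s => b (pair2 t s)) t s| <= M.
    rewrite /= !in_itv /= partial1of2E => te ts.
    case: (db t s te ts) => _ ->; apply: bM.
    apply: norm_le_coord; first exact: ltW.
    elim/ord2P; rewrite !mxE /= ler_norml; move: te ts ye; rewrite /x0 /y0; lra.
  have mB : measurable (`[y0, y]%classic : set (measurableTypeR R)) by [].
  have dBx := @derivable_under_integral R _ _ mu (fun t s => b (pair2 t s)) _ mB x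
    x0 (p 0 0 + e) Ix intb derb (fun=> M) (fun=> M0) intM ubM.
  have dBE := @differentiation_under_integral R _ _ mu (fun t s => b (pair2 t s)) _ mB x
    x0 (p 0 0 + e) Ix intb derb (fun=> M) (fun=> M0) intM ubM.
  apply: DeriveDef; first exact: dBx.
  rewrite -derive1E [LHS]dBE.
  (* Closedness replaces [d1 b] by [d2 a], and the fundamental theorem leaves the difference of [a]
     between top and bottom. The bottom value cancels against the derivative of [A]. *)
  have -> : (\int[mu]_(s in `[y0, y]) partial1of2 (fun t s => b (pair2 t s)) x s)%R
     = (\int[mu]_(s in `[y0, y]) d2 a (pair2 x s))%R.
    apply: eq_Rintegral => s; rewrite inE /= in_itv /= partial1of2E => sy.
    case: (db x s xe sy) => _ ->; rewrite ab //; exact: pd.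
  apply: (@integral_derivative _ (fun s => a (pair2 x s)) _ (p 0 1 - d) _ _ (p 0 1 + d)).
  - by rewrite /y0; lra.
  - by case/andP: ye.
  - by move: ye; lra.
  - move=> t td; apply: (cont2 (d2 a) x t _ _).2; first exact: smooth_partial.
    exact: in_d.
  - by move=> t td; apply: (is_derive_pair2 (sa [::] _ _)).2; exact: in_d.
pose G (u : 'rV[R]_2) := A (u 0 0) + B (u 0 0) (u 0 1).
have gG u : ball p e u -> has_grad G u (fun i => if i == 0 then a u else b u).
  move=> pu; have Ud : ball p d u by apply: le_ball pu; exact: ltW.
  apply: (has_grad_C1 pu) => [x y /in_e[xe ye]||]; last 2 first.
  - exact: differentiable_continuous (sa [::] _ Ud).
  - exact: differentiable_continuous (sb [::] _ Ud).
  rewrite /G; under eq_fun do rewrite !pair2E.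
  under [X in _ /\ is_derive _ _ X _]eq_fun do rewrite !pair2E.
  split.
    have := is_deriveD (dA x xe) (dB1 x y xe ye).
    by move=> H; apply: is_derive_eq H _; ring.
  have := is_deriveD (is_derive_cst (A x) y 1) (dB2 x y xe ye).
  by move=> H; apply: is_derive_eq H _; rewrite add0r.
exists G; split; last first.
  by move=> u pu; split; rewrite (gG u pu).2.
have ob : open (ball p e) by exact: ball_open.
apply: (@smooth_ode _ _ _ ob _ (fun i _ u => if i == 0 then a u else b u)) => //.
have sub : ball p e `<=` ball p d by apply: le_ball; exact: ltW.
elim/ord2P => /=; apply: gen_base; right; exact: smooth_sub sub _.
Qed.

End Primitive2.

(** * Gauss curvature of a diagonal metric whose coefficients depend on the first coordinate *)

Section DiagonalSurface.
Context {R : realType}.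
Variables (V : set 'rV[R]_2) (A B : 'rV[R]_2 -> R).
Hypotheses (openV : open V) (sA : smooth_on V A) (sB : smooth_on V B).
Hypotheses (A0 : forall u, V u -> A u != 0) (B0 : forall u, V u -> B u != 0).
Hypotheses (d2A : forall u, V u -> d2 A u = 0) (d2B : forall u, V u -> d2 B u = 0).
Let gt u := mx2 (A u) 0 0 (B u).

Let dgt u (k i j : 'I_2) : R :=
  if k != 0 then 0 else if i != j then 0 else if i == 0 then d1 A u else d1 B u.

Let chr u (k i j : 'I_2) : R :=
  if k == 0 then (if i != j then 0 else if i == 0 then d1 A u / (2 * A u)
                  else - d1 B u / (2 * A u))
  else (if i == j then 0 else d1 B u / (2 * B u)).

Lemma diag_invmx u : V u -> invmx (gt u) = mx2 (A u)^-1 0 0 (B u)^-1.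
Proof.
move=> Vu; have gI : gt u *m mx2 (A u)^-1 0 0 (B u)^-1 = 1%:M.
  apply/matrixP; elim/ord2P; elim/ord2P; rewrite !mxE sum2E !mx2E /=.
  - by rewrite mulfV ?A0 // mul0r addr0.
  - by rewrite mulr0 mul0r addr0.
  - by rewrite mul0r mulr0 addr0.
  - by rewrite mulr0 mulfV ?B0 // add0r.
by have [ug _] := mulmx1_unit gI; rewrite -[LHS]mulmx1 -gI mulKmx.
Qed.

Lemma diag_partial u k i j : V u -> partial k (fun v => gt v i j) u = dgt u k i j.
Proof.
move=> Vu; have z : partial k (fun=> 0 : R) u = 0 by case: (has_grad_cst (0 : R) u).
move: z; elim/ord2P : k; elim/ord2P : i; elim/ord2P : j; move=> z; rewrite /dgt /=.
all: under [X in partial _ X]eq_fun do rewrite mx2E; rewrite ?z ?d2A ?d2B //.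
Qed.

Lemma diag_christoffel u k i j : V u -> christoffel gt k i j u = chr u k i j.
Proof.
move=> Vu; rewrite /christoffel sum2E diag_invmx // !diag_partial //.
have := A0 Vu; have := B0 Vu.
elim/ord2P : k; elim/ord2P : i; elim/ord2P : j; rewrite !mx2E /dgt /chr /=.
all: move: (A u) (d1 A u) (B u) (d1 B u) => a a' b b' bn an.
all: by field; rewrite ?an ?bn.
Qed.

(** Formally [- b_ss / b], where [b = |B|^(1/2)] and [ds^2 = A dt1^2]: the curvature of a surface of
    revolution. *)
Definition diag_curvature u := ((d1 B u / B u) ^+ 2 / 4 - d1 (d1 B) u / (2 * B u)
   + d1 A u * d1 B u / (4 * A u * B u)) / A u.

Lemma diag_gauss_curvature : gauss_curvature V gt diag_curvature.
Proof.
move=> u Vu; apply/matrixP => i j; rewrite !mxE.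
have gA : has_grad A u (fun i => partial i A u) by apply: has_gradE; exact: (sA [::]).
have gB : has_grad B u (fun i => partial i B u) by apply: has_gradE; exact: (sB [::]).
have gA1 : has_grad (d1 A) u (fun i => partial i (d1 A) u) by apply: has_gradE; exact: (sA [:: 0]).
have gB1 : has_grad (d1 B) u (fun i => partial i (d1 B) u) by apply: has_gradE; exact: (sB [:: 0]).
have z f : smooth_on V f -> (forall u, V u -> d2 f u = 0) -> d2 (d1 f) u = 0.
  move=> sf df; rewrite (smooth_partial_comm 0 1 openV sf Vu).
  have near0 : \near u, 0 = d2 f u by apply: open_near_eq openV Vu _ => v /df.
  by rewrite (has_grad_near near0 (has_grad_cst (0 : R) u)).2.
have zA := z A sA d2A; have zB := z B sB d2B.
have An := A0 Vu; have Bn := B0 Vu.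
have gc k i' j' d : has_grad (fun v => chr v k i' j') u d ->
    forall m, partial m (christoffel gt k i' j') u = d m.
  move=> dd m; have nr : \near u, chr u k i' j' = christoffel gt k i' j' u.
    by apply: open_near_eq openV Vu _ => v Vv; rewrite diag_christoffel.
  by rewrite (has_grad_near nr dd).2.
have A2 : 2 * A u != 0 by rewrite mulf_neq0 // pnatr_eq0.
have B2 : 2 * B u != 0 by rewrite mulf_neq0 // pnatr_eq0.
have iA := has_gradV A2 (has_gradM (has_grad_cst 2 u) gA).
have iB := has_gradV B2 (has_gradM (has_grad_cst 2 u) gB).
have g000 := has_gradM gA1 iA; have g011 := has_gradM (has_gradN gB1) iA.
have g101 := has_gradM gB1 iB.
have g0 := has_grad_cst (0 : R) u.
have e000 := gc 0 0 0 _ g000; have e011 := gc 0 1 1 _ g011.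
have e001 := gc 0 0 1 _ g0; have e010 := gc 0 1 0 _ g0.
have e101 := gc 1 0 1 _ g101; have e110 := gc 1 1 0 _ g101.
have e100 := gc 1 0 0 _ g0; have e111 := gc 1 1 1 _ g0.
rewrite !sum2E !diag_christoffel // /diag_curvature.
elim/ord2P : i; elim/ord2P : j; rewrite ?mx2E /chr /=.
all: rewrite ?e000 ?e001 ?e010 ?e011 ?e100 ?e101 ?e110 ?e111 /= ?zA ?zB ?(d2A Vu) ?(d2B Vu).
all: move: (d1 (d1 A) u) (d1 (d1 B) u) (d1 A u) (d1 B u).
all: move: (A u) (B u) An Bn => a b an bn ? ? ? ?; clear g000 g011 g101 iA iB gA gB gA1 gB1 e000 e001 e010 e011 e100 e101 e110 e111 A2 B2 g0 zA zB.
all: by field; rewrite ?an ?bn.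
Qed.

End DiagonalSurface.

#[local] Opaque partial.

Lemma has_grad2 {R : realType} (f : 'rV[R]_2 -> R) u p q : differentiable f u ->
  d1 f u = p -> d2 f u = q -> has_grad f u (fun i => if i == 0 then p else q).
Proof. by move=> df <- <-; split=> //; elim/ord2P. Qed.

(** * Consequences of the soliton equation *)

Section OrbitSpace.
Context {R : realType}.
Variables (V : set 'rV[R]_2) (e0 Lam : R) (E r : 'rV[R]_2 -> R).
Hypotheses (openV : open V) (e0E : e0 = 1 \/ e0 = -1).
Hypotheses (sE : smooth_on V E) (sr : smooth_on V r).
Hypotheses (E0 : forall u, V u -> E u != 0) (r0 : forall u, V u -> r u != 0).

Definition gaussK u := gauss_E e0 E u / E u.

Lemma smooth_gaussK : smooth_on V gaussK.
Proof.
rewrite /gaussK /gauss_E /lap /dotp.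
have sE1 := smooth_partial 0 sE; have sE2 := smooth_partial 1 sE.
have two : (2 : R) != 0 by rewrite pnatr_eq0.
smooth_auto => //; move=> u Vu; rewrite ?mulf_neq0 ?E0 //.
Qed.

(** Solved for [d1 (d1 E)], so that third derivatives of [E] enter the compatibility condition only
    through the gradient of [gaussK]. *)
Lemma lapE_gaussK u : V u -> d1 (d1 E) u = dotp e0 E E u / E u
  - 2 * E u ^+ 2 * gaussK u - e0 * d2 (d2 E) u.
Proof.
move=> Vu; rewrite /gaussK /gauss_E /lap /dotp; have := E0 Vu.
move: (d1 (d1 E) u) (d2 (d2 E) u) (d1 E u) (d2 E u) (E u) => ? ? ? ? ? En.
by field.
Qed.

Hypotheses (H11 : forall u, V u -> hor11 e0 E r u = Lam * E u)
  (H12 : forall u, V u -> hor12 E r u = 0)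
  (H22 : forall u, V u -> hor22 e0 E r u = Lam * (e0 * E u)).

Let F11 u := r u * E u * (gaussK u - Lam) + d1 r u ^+ 2 / (2 * r u)
  + (d1 E u * d1 r u - e0 * (d2 E u * d2 r u)) / (2 * E u).
Let F12 u := d1 r u * d2 r u / (2 * r u)
  + (d1 E u * d2 r u + d2 E u * d1 r u) / (2 * E u).
Let F22 u := e0 * (r u * E u * (gaussK u - Lam)) + d2 r u ^+ 2 / (2 * r u)
  + (d2 E u * d2 r u - e0 * (d1 E u * d1 r u)) / (2 * E u).

(** The horizontal equations solved for the second derivatives of [r]. The terms with derivatives of
    [E] are the Christoffel terms of the orbit metric; without them the right-hand sides are the
    Hessian equation of the overview. *)
Lemma hessian_r u : V u ->
  [/\ d1 (d1 r) u = F11 u, d1 (d2 r) u = F12 u & d2 (d2 r) u = F22 u].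
Proof.
move=> Vu; have := H11 Vu; have := H12 Vu; have := H22 Vu.
rewrite /hor11 /hor12 /hor22 /F11 /F12 /F22 /gaussK.
have := E0 Vu; have := r0 Vu.
move: (gauss_E e0 E u) (d1 (d1 r) u) (d1 (d2 r) u) (d2 (d2 r) u) (d1 E u) (d2 E u)
  (E u) (d1 r u) (d2 r u) (r u) => g r11 r12 r22 E1 E2 E' r1 r2 r' rn En h22 h12 h11.
have e1 : r11 / r' = g + r1 ^+ 2 / (2 * r' ^+ 2)
    + (E1 * r1 - e0 * (E2 * r2)) / (2 * E' * r') - Lam * E' by rewrite -h11; ring.
have e2 : r12 / r' = r1 * r2 / (2 * r' ^+ 2) + (E1 * r2 + E2 * r1) / (2 * E' * r').
  by rewrite -[RHS]subr0 -h12; ring.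
have e3 : r22 / r' = e0 * g + r2 ^+ 2 / (2 * r' ^+ 2)
    + (E2 * r2 - e0 * (E1 * r1)) / (2 * E' * r') - Lam * (e0 * E') by rewrite -h22; ring.
split.
- by rewrite -[r11](divfK rn) e1; field; rewrite En rn.
- by rewrite -[r12](divfK rn) e2; field; rewrite En rn.
- by rewrite -[r22](divfK rn) e3; field; rewrite En rn.
Qed.

(* The compatibility condition of the Hessian equation is the Ricci identity
   for the gradient of [r]. *)
Lemma gaussK_grad u : V u ->
  2 * r u * d1 gaussK u = (Lam - 3 * gaussK u) * d1 r u /\
  2 * r u * d2 gaussK u = (Lam - 3 * gaussK u) * d2 r u.
Proof.
move=> Vu; have En := E0 Vu; have rn := r0 Vu.
have gr f : smooth_on V f -> has_grad f u (fun i => partial i f u).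
  by move=> sf; apply: has_gradE; exact: (sf [::]).
have gE := gr _ sE; have gr' := gr _ sr; have gK := gr _ smooth_gaussK.
have nF f F d : (forall v, V v -> f v = F v) -> has_grad F u d ->
    forall i, partial i f u = d i.
  move=> fF gF i; rewrite (has_grad_near _ gF).2 //.
  by apply: open_near_eq openV Vu _ => v /fF.
have s1 := smooth_partial_comm 0 1 openV (smooth_partial 0 sr) Vu.
have s2 := smooth_partial_comm 0 1 openV (smooth_partial 1 sr) Vu.
have sr12 := smooth_partial_comm 0 1 openV sr.
have sE12 := smooth_partial_comm 0 1 openV sE Vu.
have [h11 h12 h22] := hessian_r Vu.
have t11 : forall v, V v -> d1 (d1 r) v = F11 v by move=> v /hessian_r[].
have t12 : forall v, V v -> d1 (d2 r) v = F12 v by move=> v /hessian_r[].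
have t21 : forall v, V v -> d2 (d1 r) v = F12 v.
  by move=> v Vv; exact: etrans (sr12 v Vv) (t12 v Vv).
have t22 : forall v, V v -> d2 (d2 r) v = F22 v by move=> v /hessian_r[].
have two : (2 : R) != 0 by rewrite pnatr_eq0.
have gE1 := has_grad2 (gr _ (smooth_partial 0 sE)).1 (lapE_gaussK Vu) sE12.
have gE2 := has_grad2 (gr _ (smooth_partial 1 sE)).1 (erefl _) (erefl _).
have gr1 := has_grad2 (gr _ (smooth_partial 0 sr)).1 (t11 _ Vu) (t21 _ Vu).
have gr2 := has_grad2 (gr _ (smooth_partial 1 sr)).1 (t12 _ Vu) (t22 _ Vu).
have gc x := has_grad_cst x u.
have ir := has_gradV (mulf_neq0 two rn) (has_gradM (gc 2) gr').
have iE := has_gradV (mulf_neq0 two En) (has_gradM (gc 2) gE).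
have gX := has_gradM (has_gradM gr' gE) (has_gradD gK (has_gradN (gc Lam))).
have G11 := has_gradD (has_gradD gX (has_gradM (has_gradX 2 gr1) ir)) (has_gradM
  (has_gradD (has_gradM gE1 gr1) (has_gradN (has_gradM (gc e0) (has_gradM gE2 gr2)))) iE).
have G12 := has_gradD (has_gradM (has_gradM gr1 gr2) ir) (has_gradM
  (has_gradD (has_gradM gE1 gr2) (has_gradM gE2 gr1)) iE).
have G22 := has_gradD (has_gradD (has_gradM (gc e0) gX) (has_gradM (has_gradX 2 gr2) ir))
  (has_gradM (has_gradD (has_gradM gE2 gr2)
  (has_gradN (has_gradM (gc e0) (has_gradM gE1 gr1)))) iE).
have g11 := nF _ _ _ t11 G11; have g12 := nF _ _ _ t12 G12.
have g21 := nF _ _ _ t21 G12; have g22 := nF _ _ _ t22 G22.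
(* The two symmetries of the third derivatives of [r]. The one for [d2 r] yields the component with
   [d1 gaussK], the one for [d1 r] the component with [d2 gaussK]. *)
have := etrans (esym (g12 1)) (etrans s2 (g22 0)).
have := etrans (esym (g11 1)) (etrans s1 (g21 0)).
rewrite /= /F11 /F12 /F22 /dotp.
move: (d1 gaussK u) (d2 gaussK u) (gaussK u) (d1 (d2 E) u) (d2 (d2 E) u)
  (d1 E u) (d2 E u) (E u) (d1 r u) (d2 r u) (r u) En rn.
move=> K1 K2 K E12 E22 E1 E2 E' r1 r2 r' En rn.
clear - En rn e0E two.
move=> /eqP; rewrite -subr_eq0 => /eqP c1 /eqP; rewrite -subr_eq0 => /eqP c2.
split; apply/eqP; rewrite -subr_eq0; apply/eqP.
  apply: (mulIf En); rewrite mul0r -[RHS](mulr0 (- 2 * e0)) -[in RHS]c2.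
  by case: e0E => ->; field; rewrite En rn.
apply: (mulIf En); rewrite mul0r -[RHS](mulr0 2) -[in RHS]c1.
by case: e0E => ->; field; rewrite En rn.
Qed.

Variable B : 'rV[R]_2 -> R.
Hypotheses (lapr : forall u, V u -> lap e0 r u = E u * (B u - 2 * Lam) * r u)
  (gB : forall u, V u -> has_grad B u (fun=> 0)).

Lemma norm_dr_B u : V u -> dotp e0 r r u = 2 * r u ^+ 2 * E u * (B u - 2 * gaussK u).
Proof.
move=> Vu; have := lapr Vu; have [h11 _ h22] := hessian_r Vu.
rewrite /lap h11 h22 /F11 /F22 /dotp; have En := E0 Vu; have rn := r0 Vu.
move: (gaussK u) (d1 E u) (d2 E u) (E u) (d1 r u) (d2 r u) (r u) (B u) En rn.
move=> K E1 E2 E' r1 r2 r' B' En rn /eqP; rewrite -subr_eq0 => /eqP e.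
apply/eqP; rewrite -subr_eq0 -(mulr0 (2 * r')) -[in X in _ == X]e; apply/eqP.
by case: e0E => ->; field; rewrite En rn.
Qed.

Hypothesis r1_neq0 : forall u, V u -> d1 r u != 0.

(** By the Hessian equation, the derivative of |dr|^2 is |dr|^2 dr / r + 2 (K - Lam) r dr. When
    |dr|^2 = 2 (B - 2 K) r^2 is differentiated instead, with dK given by the compatibility
    condition, all terms in K and Lam agree, and what remains is 2 B dr = 4 B dr. *)
Lemma weight_eq0 u : V u -> B u = 0.
Proof.
move=> Vu; have En := E0 Vu; have rn := r0 Vu; have rn1 := r1_neq0 Vu.
have [k1 _] := gaussK_grad Vu.
have gr f : smooth_on V f -> has_grad f u (fun i => partial i f u).
  by move=> sf; apply: has_gradE; exact: (sf [::]).
have gE := gr _ sE; have gr' := gr _ sr; have gK := gr _ smooth_gaussK.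
have [h11 h12 _] := hessian_r Vu.
have gc x := has_grad_cst x u.
have gr1 := gr _ (smooth_partial 0 sr); have gr2 := gr _ (smooth_partial 1 sr).
have gl := has_gradD (has_gradM gr1 gr1) (has_gradM (gc e0) (has_gradM gr2 gr2)).
have gR := has_gradM (has_gradM (has_gradM (gc 2) (has_gradX 2 gr')) gE)
  (has_gradD (gB Vu) (has_gradN (has_gradM (gc 2) gK))).
have nr : \near u, dotp e0 r r u = 2 * r u ^+ 2 * E u * (B u - 2 * gaussK u).
  exact: (open_near_eq openV Vu norm_dr_B).
have e := etrans (esym ((has_grad_near nr gl).2 0)) (gR.2 0).
rewrite /= h11 h12 /F11 /F12 in e.
have e' := norm_dr_B Vu; rewrite /dotp in e'.
move: e e' k1; move: (d1 gaussK u) (gaussK u) (d1 E u) (d2 E u) (E u) (d1 r u) (d2 r u)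
  (r u) (B u) En rn rn1.
move=> K1 K E1 E2 E' r1 r2 r' B' En rn rn1.
move=> /eqP; rewrite -subr_eq0 => /eqP e /eqP; rewrite -subr_eq0 => /eqP e' .
move=> /eqP; rewrite -subr_eq0 => /eqP k.
have : B' * r1 = 0; last by move/eqP; rewrite mulf_eq0 (negPf rn1) orbF => /eqP.
have two : (2 : R) != 0 by rewrite pnatr_eq0.
rewrite -[RHS](mul0r (2 * r' * E')^-1).
(* The coefficients of the combination: the differentiated norm equation [e], the compatibility
   condition [k], and the norm equation [e']. *)
rewrite (_ : 0 = - 0 + 2 * r' * E' * 0 + (r1 / r' + E1 / E') * 0); last by ring.
rewrite -[in X in - X]e -[in X in 2 * r' * E' * X]k -[in X in (_ + _ / E') * X]e'.
by case: e0E => ->; field; rewrite En rn.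
Qed.

Lemma norm_dr u : V u -> dotp e0 r r u = - 4 * r u ^+ 2 * E u * gaussK u.
Proof. by move=> Vu; rewrite norm_dr_B // weight_eq0 // sub0r; ring. Qed.

Lemma lap_r u : V u -> lap e0 r u = - 2 * Lam * E u * r u.
Proof. by move=> Vu; rewrite lapr // weight_eq0 // sub0r; ring. Qed.

End OrbitSpace.

(** * Splitting of the chart into orbit space and leaves *)

Section Projection.
Context {R : realType}.
Local Notation pt := 'rV[R]_(2 + 2).

Lemma rowE4 (u v : 'rV[R]_2) j : (row_mx u v 0 (lshift 2 j) = u 0 j) *
  (row_mx u v 0 (rshift 2 j) = v 0 j).
Proof. by rewrite row_mxEl row_mxEr. Qed.

Lemma tpart_row (u v : 'rV[R]_2) : tpart (row_mx u v) = u.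
Proof. exact: row_mxKl. Qed.

Lemma zpart_row (u v : 'rV[R]_2) : zpart (row_mx u v) = v.
Proof. exact: row_mxKr. Qed.

Lemma row_parts (x : pt) : row_mx (tpart x) (zpart x) = x.
Proof. exact: hsubmxK. Qed.

Lemma open_tpart (U : set pt) : open U -> open (tpart @` U).
Proof.
move=> oU; rewrite openE => _ [x Ux <-].
have /nbhs_ballP[e /= e0 eU] : nbhs x U by apply: open_nbhs_nbhs.
apply/nbhs_ballP; exists e => //= v /ballP vx.
exists (row_mx v (zpart x)); last exact: tpart_row.
apply: eU; apply/ballP; rewrite -{2}[x]row_parts opp_row_mx add_row_mx subrr.
apply: le_lt_trans vx; apply: norm_le_coord => // i.
rewrite -[i](@splitK 2 2); case: (fintype.split i) => j /=.
  by rewrite row_mxEl norm_coord_le.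
by rewrite row_mxEr mxE normr0.
Qed.

Lemma dzE k j : (dz k 0 (lshift 2 j) = 0 :> R) * (dz k 0 (rshift 2 j) = (j == k)%:R :> R).
Proof. by rewrite !rowE4 !mxE. Qed.

Lemma inner_adapted (A : 'M[R]_2) (G : 'M[R]_(2 + 2)) (y : pt) : A \in unitmx ->
  (forall i, inner G y (\sum_k A i k *: dz k) = 0) <->
  (forall k, (y *m G) 0 (rshift 2 k) = 0).
Proof.
move=> uA; pose w := \col_k (y *m G) 0 (rshift 2 k).
have E i : inner G y (\sum_k A i k *: dz k) = (A *m w) i 0.
  rewrite /inner linear_sum mulmx_sumr summxE !mxE; apply: eq_bigr => k _.
  rewrite linearZ /= -scalemxAr [LHS]mxE; congr (_ * _); rewrite [RHS]mxE.
  rewrite mxE big_split_ord /= big1 => [|j _]; last by rewrite [(dz k)^T _ _]mxE dzE mulr0.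
  rewrite add0r (bigD1 k) //= big1 => [|j jk].
    by rewrite [(dz k)^T _ _]mxE dzE eqxx mulr1 addr0.
  by rewrite [(dz k)^T _ _]mxE dzE (negPf jk) mulr0.
split=> [h k|h i]; last first.
  rewrite E.
  have -> : w = 0 by apply/colP => k; rewrite /w mxE h mxE.
  by rewrite mulmx0 mxE.
have Aw : A *m w = 0 by apply/colP => i; rewrite -E h mxE.
have : w = 0 by rewrite -[w]mul1mx -(mulVmx uA) -mulmxA Aw mulmx0.
by move=> w0; have := congr1 (fun M : 'cV_2 => M k 0) w0; rewrite /w mxE => ->; rewrite mxE.
Qed.

End Projection.

(** * Structure of the soliton field and the scalar equations *)

Section Soliton.
Context {R : realType}.
Local Notation pt := 'rV[R]_(2 + 2).
Variables (U : set pt) (g : pt -> 'M[R]_(2 + 2)) (xi : 'I_2 -> pt -> pt)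
  (X : pt -> pt) (Lam e0 : R) (P h r a c : 'rV[R]_2 -> R).
Let V := tpart @` U.
Hypotheses (openU : open U) (sg : smooth_mx U g) (sX : smooth_mx U X)
  (soliton : ricci_soliton U g X Lam)
  (N : normal_form U g xi e0 P h r a c)
  (XXi : section_Xi U xi X) (symX : symmetry_Xi_perp U g xi X)
  (d2a_ : forall x, U x -> d2 a (tpart x) = 0)
  (c2_neq0 : forall u, V u -> d2 c u != 0)
  (r1_neq0_ : forall x, U x -> d1 r (tpart x) != 0).

Definition conformal u := expR (- (2 * P u)).
Local Notation E := conformal.

Let openV : open V := open_tpart openU.
Let UV x : U x -> V (tpart x). Proof. by move=> Ux; exists x. Qed.
Let e0E : e0 = 1 \/ e0 = -1. Proof. by case: N. Qed.
Let sP : smooth_on V P. Proof. by case: N => _ []. Qed.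
Let sh : smooth_on V h. Proof. by case: N => _ []. Qed.
Let sr : smooth_on V r. Proof. by case: N => _ []. Qed.
Let sa : smooth_on V a. Proof. by case: N => _ []. Qed.
Let sc : smooth_on V c. Proof. by case: N => _ []. Qed.
Let E0 u : V u -> E u != 0. Proof. by move=> _; rewrite gt_eqF // expR_gt0. Qed.
Let r0 u : V u -> r u != 0. Proof. by case: N => _ _ _ _ H /H[]. Qed.
Let d2a u : V u -> d2 a u = 0. Proof. by case=> x Ux <-; exact: d2a_. Qed.
Let r1_neq0 u : V u -> d1 r u != 0. Proof. by case=> x Ux <-; exact: r1_neq0_. Qed.

Lemma smooth_conformal : smooth_on V E.
Proof.
apply: (@smooth_ode _ _ _ openV _ (fun i f u => f u * (- 2 * partial i P u))) => [u Vu|i].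
  have gP : has_grad P u (fun i => partial i P u) by apply: has_gradE; exact: (sP [::]).
  have := has_gradN (has_gradM (has_grad_cst 2 u) gP).
  move=> /(has_grad_comp1 (is_derive_expR _)) gE; apply: has_grad_eq gE _ => i /=.
  by rewrite /conformal; ring.
apply: gen_mul; first by apply: gen_base; left.
apply: gen_mul; first exact: gen_cst.
by apply: gen_base; right; exact: smooth_partial.
Qed.
Let sE := smooth_conformal.

Lemma metric_tab x : U x -> forall i j, g x i j = entry (g_tab e0 E a c h r (tpart x)) i j.
Proof.
move=> Ux i j; case: N => _ _ _ /(_ x Ux) -> _; rewrite /adapted_metric.
elim/ord4P : i; elim/ord4P : j; rewrite /entry /=.
all: rewrite ?block_mxEul ?block_mxEur ?block_mxEdl ?block_mxEdr.
all: rewrite /nf_orbit /nf_h /nf_f ?mxE ?sum2E ?mxE ?sum2E ?mx2E ?mxE ?sum2E ?mx2E /=.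
all: rewrite -/(conformal (tpart x)).
all: by ring.
Qed.

Let adaptedU : exists2 A : 'M[R]_2, A \in unitmx &
  forall i x, U x -> xi i x = \sum_k A i k *: dz k.
Proof. by case: N => _ _ []. Qed.

Lemma field_tpart x : U x -> X x 0 o0 = 0 /\ X x 0 o1 = 0.
Proof.
move=> Ux; have [A uA xiA] := adaptedU.
have /submxP[w ->] := XXi Ux.
have z j : (w *m \matrix_i xi i x) 0 (lshift 2 j) = 0.
  rewrite mxE big1 // => i _; rewrite mxE xiA // summxE big1 ?mulr0 // => k _.
  by rewrite mxE dzE mulr0.
by split; exact: z.
Qed.

Lemma symmetry_bracket (Y : pt -> pt) : smooth_mx U Y ->
  (forall x, U x -> forall k, (Y x *m g x) 0 (rshift 2 k) = 0) ->
  forall x, U x -> forall k, (lie_bracket X Y x *m g x) 0 (rshift 2 k) = 0.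
Proof.
move=> sY Yg x Ux; have [A uA xiA] := adaptedU.
apply/(inner_adapted _ _ uA) => i; rewrite -(xiA i x Ux); apply: symX => //.
move=> j y Uy; rewrite (xiA j y Uy); move: j; apply/(inner_adapted _ _ uA).
exact: Yg.
Qed.

Lemma bracket_vertical (Y : pt -> pt) x k : U x -> lie_bracket X Y x 0 k =
  X x 0 o2 * partial o2 (fun y => Y y 0 k) x + X x 0 o3 * partial o3 (fun y => Y y 0 k) x
  - (Y x 0 o0 * partial o0 (fun y => X y 0 k) x + Y x 0 o1 * partial o1 (fun y => X y 0 k) x
  + Y x 0 o2 * partial o2 (fun y => X y 0 k) x + Y x 0 o3 * partial o3 (fun y => X y 0 k) x).
Proof.
move=> Ux; rewrite mxE sumrB !sum4E; have [-> ->] := field_tpart Ux.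
by rewrite !mul0r !add0r.
Qed.

Lemma vertical_kernel x (v : pt) : U x -> v 0 o0 = 0 -> v 0 o1 = 0 ->
  (forall k, (v *m g x) 0 (rshift 2 k) = 0) -> v 0 o2 = 0 /\ v 0 o3 = 0.
Proof.
move=> Ux v0 v1 vg; have rn := r0 (UV Ux).
have := vg 1; have := vg 0; rewrite !mxE !sum4E v0 v1 !metric_tab // /entry /=.
rewrite !mul0r !add0r mulr0 addr0 => e0' e1.
have v2 : v 0 o2 = 0 by move/eqP: e1; rewrite mulf_eq0 (negPf rn) orbF => /eqP.
split=> //; move/eqP: e0'; rewrite v2 mul0r add0r mulf_eq0 (negPf rn) orbF.
by move/eqP.
Qed.

Lemma partial_field_tpart x i : U x ->
  partial i (fun y => X y 0 o0) x = 0 /\ partial i (fun y => X y 0 o1) x = 0.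
Proof.
move=> Ux; split.
  have nr : \near x, 0 = X x 0 o0.
    by apply: (open_near_eq openU Ux) => y /field_tpart[].
  by rewrite (has_grad_near nr (has_grad_cst (0 : R) x)).2.
have nr : \near x, 0 = X x 0 o1.
  by apply: (open_near_eq openU Ux) => y /field_tpart[].
by rewrite (has_grad_near nr (has_grad_cst (0 : R) x)).2.
Qed.

(** Test fields for the symmetry condition. Constant t-components, and z-components that do not vary
    along the leaves, reduce the bracket with the vertical field [X] to derivatives of [X]. *)
Let zframe (p q : R) (s1 s2 : 'rV[R]_2 -> R) (x : pt) : pt :=
  row_mx (pair2 p q) (pair2 (s1 (tpart x)) (s2 (tpart x))).

Lemma smooth_zframe p q s1 s2 : smooth_on V s1 -> smooth_on V s2 ->
  smooth_mx U (zframe p q s1 s2).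
Proof.
move=> ss1 ss2 i j; rewrite ord1.
have t1 := smooth_tpart openU UV ss1; have t2 := smooth_tpart openU UV ss2.
elim/ord4P : j.
- by apply: (smooth_eq openU (smooth_cst openU p)) => x _; rewrite rowE4 pair2E.
- by apply: (smooth_eq openU (smooth_cst openU q)) => x _; rewrite rowE4 pair2E.
- by apply: (smooth_eq openU t1) => x _; rewrite rowE4 pair2E.
- by apply: (smooth_eq openU t2) => x _; rewrite rowE4 pair2E.
Qed.

Lemma partial_zframe p q s1 s2 x i k :
  partial (rshift 2 i) (fun y => zframe p q s1 s2 y 0 k) x = 0.
Proof.
elim/ord4P : k.
- by under [X in partial _ X]eq_fun do rewrite rowE4 pair2E; exact: (has_grad_cst p x).2.
- by under [X in partial _ X]eq_fun do rewrite rowE4 pair2E; exact: (has_grad_cst q x).2.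
- by under [X in partial _ X]eq_fun do rewrite rowE4 pair2E; exact: partial_tpart_z.
- by under [X in partial _ X]eq_fun do rewrite rowE4 pair2E; exact: partial_tpart_z.
Qed.

(** The bracket of [X] with a horizontal test field is tangent to the leaves, because [X] has no
    t-components, and orthogonal to them by the symmetry condition. It vanishes because the leaves
    are non-null. *)
Lemma zframe_derivative p q s1 s2 x : smooth_on V s1 -> smooth_on V s2 ->
  (forall x, U x -> forall k, (zframe p q s1 s2 x *m g x) 0 (rshift 2 k) = 0) -> U x ->
  forall m, p * partial o0 (fun y => X y 0 (rshift 2 m)) x
    + q * partial o1 (fun y => X y 0 (rshift 2 m)) x
    + s1 (tpart x) * partial o2 (fun y => X y 0 (rshift 2 m)) x
    + s2 (tpart x) * partial o3 (fun y => X y 0 (rshift 2 m)) x = 0.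
Proof.
move=> ss1 ss2 Yg Ux; pose Y := zframe p q s1 s2.
have Yx : (Y x 0 o0 = p) * (Y x 0 o1 = q) * (Y x 0 o2 = s1 (tpart x)) *
    (Y x 0 o3 = s2 (tpart x)) by rewrite !rowE4 !pair2E.
have BE k : lie_bracket X Y x 0 k = - (p * partial o0 (fun y => X y 0 k) x
    + q * partial o1 (fun y => X y 0 k) x + s1 (tpart x) * partial o2 (fun y => X y 0 k) x
    + s2 (tpart x) * partial o3 (fun y => X y 0 k) x).
  by rewrite (bracket_vertical _ _ Ux) !partial_zframe !mulr0 !add0r !Yx.
have z0 : lie_bracket X Y x 0 o0 = 0.
  by rewrite BE !(partial_field_tpart _ Ux).1 !mulr0 !addr0 oppr0.
have z1 : lie_bracket X Y x 0 o1 = 0.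
  by rewrite BE !(partial_field_tpart _ Ux).2 !mulr0 !addr0 oppr0.
have [z2 z3] := vertical_kernel Ux z0 z1 (symmetry_bracket (smooth_zframe p q ss1 ss2) Yg Ux).
elim/ord2P.
  by move/eqP: z2; rewrite BE oppr_eq0 => /eqP.
by move/eqP: z3; rewrite BE oppr_eq0 => /eqP.
Qed.

(* The first equation says that [e_2 X = 0], the second one that [e_1 X = 0]; the
   commutator of the horizontal fields [e_1], [e_2] is a nonzero multiple of [dz 1]. *)
Lemma field_derivatives x m : U x ->
  [/\ partial o1 (fun y => X y 0 (rshift 2 m)) x = 0,
      partial o3 (fun y => X y 0 (rshift 2 m)) x = 0 &
      partial o0 (fun y => X y 0 (rshift 2 m)) x =
        a (tpart x) * partial o2 (fun y => X y 0 (rshift 2 m)) x].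
Proof.
pose Z y := X y 0 (rshift 2 m).
have e2 : forall x, U x -> partial o1 Z x = 0.
  move=> {}x Ux; have s0 := smooth_cst openV (0 : R).
  have Yg y : U y -> forall k, (zframe 0 1 (fun=> 0) (fun=> 0) y *m g y) 0 (rshift 2 k) = 0.
    move=> Uy; elim/ord2P; rewrite mxE sum4E !rowE4 !pair2E !metric_tab // /entry /=; ring.
  have := zframe_derivative s0 s0 Yg Ux m.
  by rewrite !mul0r add0r !addr0 mul1r.
have e1 : forall x, U x -> partial o0 Z x = a (tpart x) * partial o2 Z x
    + c (tpart x) * partial o3 Z x.
  move=> {}x Ux; have sna := smooth_opp openV sa; have snc := smooth_opp openV sc.
  have Yg y : U y -> forall k, (zframe 1 0 (fun u => - a u) (fun u => - c u) y *m g y)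
      0 (rshift 2 k) = 0.
    move=> Uy; elim/ord2P; rewrite mxE sum4E !rowE4 !pair2E !metric_tab // /entry /=; ring.
  have := zframe_derivative sna snc Yg Ux m; rewrite mul1r mul0r addr0 -/Z.
  by rewrite !mulNr -addrA -opprD => /eqP; rewrite subr_eq0 => /eqP.
move=> Ux; have Vu := UV Ux.
have sZ : smooth_on U Z by exact: sX.
have e3 : partial o3 Z x = 0.
  have ga := has_grad_tpart (has_gradE (smooth_differentiable sa Vu)).
  have gc := has_grad_tpart (has_gradE (smooth_differentiable sc Vu)).
  have g2 := has_gradE (smooth_differentiable (smooth_partial o2 sZ) Ux); have g3 := has_gradE (smooth_differentiable (smooth_partial o3 sZ) Ux).
  have ne : \near x, a (tpart x) * partial o2 Z x + c (tpart x) * partial o3 Z x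
      = partial o0 Z x.
    by apply: (open_near_eq openU Ux) => y /e1 ->.
  have := (has_grad_near ne (has_gradD (has_gradM ga g2) (has_gradM gc g3))).2 o1.
  have n0 : \near x, 0 = partial o1 Z x.
    by apply: (open_near_eq openU Ux) => y /e2 ->.
  have z i : partial i (partial o1 Z) x = 0.
    by rewrite (has_grad_near n0 (has_grad_cst (0 : R) x)).2.
  rewrite (smooth_partial_comm o0 o1 openU sZ Ux) z /= !of_tpartE d2a // mul0r add0r.
  rewrite (smooth_partial_comm o2 o1 openU sZ Ux) z mulr0.
  rewrite (smooth_partial_comm o3 o1 openU sZ Ux) z mulr0 add0r addr0.
  by move/esym/eqP; rewrite mulf_eq0 (negPf (c2_neq0 Vu)) => /eqP.
by split; [exact: e2|exact: e3|rewrite -/Z e1 // e3 mulr0 addr0].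
Qed.

(** The t2-derivative of [partial o2 Z] vanishes because [Z] does not depend on t2; its
    t1-derivative is [a] times a second derivative along z1, which vanishes because [F] is a
    function of (t1, t2). *)
Lemma derivative_of_tpart m F : smooth_on V F ->
  (forall x, U x -> partial o2 (fun y => X y 0 (rshift 2 m)) x = F (tpart x)) ->
  forall u, V u -> has_grad F u (fun=> 0).
Proof.
move=> sF ZF _ [x Ux <-]; have Vu := UV Ux; pose Z y := X y 0 (rshift 2 m).
have sZ : smooth_on U Z by exact: sX.
have gF := has_gradE (smooth_differentiable sF Vu).
have nF : \near x, F (tpart x) = partial o2 Z x.
  by apply: (open_near_eq openU Ux) => y Uy; rewrite /Z ZF.
have pF := (has_grad_near nF (has_grad_tpart gF)).2.
have z1 : partial o1 (partial o2 Z) x = 0.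
  rewrite (smooth_partial_comm o2 o1 openU sZ Ux).
  have n0 : \near x, 0 = partial o1 Z x.
    by apply: (open_near_eq openU Ux) => y Uy; have [->] := field_derivatives m Uy.
  by rewrite (has_grad_near n0 (has_grad_cst (0 : R) x)).2.
have z0 : partial o0 (partial o2 Z) x = 0.
  rewrite (smooth_partial_comm o2 o0 openU sZ Ux).
  have n0 : \near x, a (tpart x) * partial o2 Z x = partial o0 Z x.
    by apply: (open_near_eq openU Ux) => y Uy; have [_ _ ->] := field_derivatives m Uy.
  have ga := has_grad_tpart (has_gradE (smooth_differentiable sa Vu)).
  have gZ := has_gradE (smooth_differentiable (smooth_partial o2 sZ) Ux).
  rewrite (has_grad_near n0 (has_gradM ga gZ)).2 of_tpartE mul0r add0r pF.
  by rewrite of_tpartE mulr0.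
split; first by case: gF.
move: (pF o0) (pF o1); rewrite !of_tpartE z0 z1 => e0' e1.
by elim/ord2P; [exact/esym|exact/esym].
Qed.

Let b1 x := partial o2 (fun y => X y 0 o2) x.
Let b2 x := partial o2 (fun y => X y 0 o3) x.
(** The connection form a dt1 + dz1, of which the differential of each z-component of [X] is a
    multiple. *)
Let om x (i : 'I_(2 + 2)) : R := nth 0 [:: a (tpart x); 0; 1; 0] i.

Lemma partial_field x i : U x -> partial i (fun y => X y 0 o2) x = om x i * b1 x /\
  partial i (fun y => X y 0 o3) x = om x i * b2 x.
Proof.
move=> Ux; have [p1 p3 p0] := field_derivatives 0 Ux.
have [q1 q3 q0] := field_derivatives 1 Ux; rewrite /om /b1 /b2.
elim/ord4P : i => /=.
- by rewrite p0 q0.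
- by rewrite p1 q1 !mul0r.
- by rewrite !mul1r.
- by rewrite p3 q3 !mul0r.
Qed.

Lemma lie_metricE x i j : U x -> lie_metric X g x i j =
  om x i * (g x o2 j * b1 x + g x o3 j * b2 x)
  + om x j * (g x i o2 * b1 x + g x i o3 * b2 x).
Proof.
move=> Ux; rewrite mxE sum4E; have [-> ->] := field_tpart Ux.
rewrite !(partial_field_tpart _ Ux).1 !(partial_field_tpart _ Ux).2.
rewrite !(partial_field _ Ux).1 !(partial_field _ Ux).2.
rewrite !(partial_g sE sa sc sh sr d2a openU UV metric_tab _ _ _ Ux) /entry /= !nth_nil.
move: (b1 x) (b2 x) (om x i) (om x j) => ? ? ? ?; ring.
Qed.

Lemma soliton_entry x i j : U x -> ricci g x i j + 2^-1 *
  (om x i * (g x o2 j * b1 x + g x o3 j * b2 x)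
  + om x j * (g x i o2 * b1 x + g x i o3 * b2 x)) = Lam * g x i j.
Proof.
move=> Ux; rewrite -lie_metricE //.
by have := congr1 (fun M : 'M[R]_(2 + 2) => M i j) (soliton Ux); rewrite !mxE.
Qed.

Lemma soliton_z12 x : U x -> ric_zz12 e0 E r (tpart x) + 2^-1 * (r (tpart x) * b1 x)
  = Lam * r (tpart x).
Proof.
move=> Ux; have := soliton_entry o2 o3 Ux.
rewrite (ricci_z12 openV e0E sE sa sc sh sr E0 r0 d2a openU UV sg metric_tab Ux).
by rewrite !metric_tab // /entry /om /= !mul0r mul1r !addr0.
Qed.

Lemma soliton_z11 x : U x -> ric_zz11 e0 E c h r (tpart x)
  + (h (tpart x) * b1 x + r (tpart x) * b2 x) = Lam * h (tpart x).
Proof.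
move=> Ux; have := soliton_entry o2 o2 Ux.
rewrite (ricci_z11 openV e0E sE sa sc sh sr E0 r0 d2a openU UV sg metric_tab Ux).
rewrite !metric_tab // /entry /om /= mul1r => <-; congr (_ + _).
by move: (b1 x) (b2 x) => ? ?; field.
Qed.

Lemma soliton_2z x : U x -> mix2 E c r (tpart x) = 0.
Proof.
move=> Ux; have := soliton_entry o1 o2 Ux.
rewrite (ricci_2z openV e0E sE sa sc sh sr E0 r0 d2a openU UV sg metric_tab Ux).
rewrite !metric_tab // /entry /om /=.
by rewrite !(mul0r, mulr0, addr0, add0r).
Qed.

Lemma soliton_22 x : U x -> hor22 e0 E r (tpart x) = Lam * (e0 * E (tpart x)).
Proof.
move=> Ux; have := soliton_entry o1 o1 Ux.
rewrite (ricci_22 openV e0E sE sa sc sh sr E0 r0 d2a openU UV sg metric_tab Ux).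
rewrite !metric_tab // /entry /om /=.
by rewrite !(mul0r, mulr0, addr0, add0r) [e0 * _]mulrC.
Qed.

Lemma soliton_12 x : U x -> hor12 E r (tpart x) = 0.
Proof.
move=> Ux; have := soliton_entry o0 o1 Ux.
rewrite (ricci_12 openV e0E sE sa sc sh sr E0 r0 d2a openU UV sg metric_tab Ux).
rewrite soliton_2z // !metric_tab // /entry /om /=.
by rewrite !(mul0r, mulr0, addr0, add0r).
Qed.

(** Subtracting [a] and [c] times the equations along the leaves replaces d_t1 by the horizontal
    field e1. The Lie derivative then drops out: the connection form vanishes on e1, and e1 is
    orthogonal to the leaves. *)
Lemma soliton_1z x : U x -> mix1 e0 E c r (tpart x) = 0.
Proof.
move=> Ux; have := soliton_entry o0 o2 Ux.
have := soliton_z11 Ux; have := soliton_z12 Ux.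
rewrite (ricci_1z openV e0E sE sa sc sh sr E0 r0 d2a openU UV sg metric_tab Ux).
rewrite !metric_tab // /entry /om /=.
move: (mix1 _ _ _ _ _) (ric_zz11 _ _ _ _ _ _) (ric_zz12 _ _ _ _) (b1 x) (b2 x).
move: (a (tpart x)) (c (tpart x)) (h (tpart x)) (r (tpart x)) => A C H S m p q B1 B2.
move=> e1 e2 e3; have {}e1 : q = Lam * S - 2^-1 * (S * B1) by rewrite -e1; ring.
have {}e2 : p = Lam * H - (H * B1 + S * B2) by rewrite -e2; ring.
have -> : m = m + A * p + C * q - A * p - C * q by ring.
rewrite -[m + A * p + C * q](addrK (2^-1 * (A * (H * B1 + S * B2) + 1 * ((A * H + C * S) * B1 + A * S * B2)))).
by rewrite e3 e1 e2; field.
Qed.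

Lemma soliton_11 x : U x -> hor11 e0 E r (tpart x) = Lam * E (tpart x).
Proof.
move=> Ux; have := soliton_entry o0 o0 Ux.
have := soliton_z11 Ux; have := soliton_z12 Ux; have := soliton_1z Ux.
rewrite (ricci_11 openV e0E sE sa sc sh sr E0 r0 d2a openU UV sg metric_tab Ux).
rewrite !metric_tab // /entry /om /=.
move: (mix1 _ _ _ _ _) (ric_zz11 _ _ _ _ _ _) (ric_zz12 _ _ _ _) (hor11 _ _ _ _) (b1 x) (b2 x).
move: (a (tpart x)) (c (tpart x)) (h (tpart x)) (r (tpart x)) (E (tpart x)).
move=> A C H S E' m p q k B1 B2 -> e1 e2.
have {}e1 : q = Lam * S - 2^-1 * (S * B1) by rewrite -e1; ring.
have {}e2 : p = Lam * H - (H * B1 + S * B2) by rewrite -e2; ring.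
rewrite e1 e2 => e3; apply/eqP; rewrite -subr_eq0.
move/eqP: e3; rewrite -subr_eq0 => /eqP e3; rewrite -[X in _ == X]e3.
by apply/eqP; field.
Qed.

Let H11 u : V u -> hor11 e0 E r u = Lam * E u.
Proof. by case=> x Ux <-; exact: soliton_11. Qed.
Let H12 u : V u -> hor12 E r u = 0.
Proof. by case=> x Ux <-; exact: soliton_12. Qed.
Let H22 u : V u -> hor22 e0 E r u = Lam * (e0 * E u).
Proof. by case=> x Ux <-; exact: soliton_22. Qed.

(** The z1 z2 equation solved for [b1]. It shows that this derivative of [X] is a function of (t1,
    t2), as [derivative_of_tpart] requires. *)
Let weight u := 2 * Lam + lap e0 r u / (E u * r u).

Let smooth_weight : smooth_on V weight.
Proof.
have sr1 := smooth_partial 0 sr; have sr2 := smooth_partial 1 sr.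
rewrite /weight /lap; smooth_auto.
by move=> u Vu; rewrite mulf_neq0 ?E0 ?r0.
Qed.

Let weightE x : U x -> b1 x = weight (tpart x).
Proof.
move=> Ux; have := soliton_z12 Ux; have En := E0 (UV Ux); have rn := r0 (UV Ux).
rewrite /weight /ric_zz12; move: (lap _ _ _) (E _) (r _) (b1 x) En rn => l E' S b En rn e.
have -> : b = 2 * (2^-1 * (S * b)) / S by field.
have -> : 2^-1 * (S * b) = Lam * S + l / (2 * E') by rewrite -e; ring.
by field; rewrite En rn.
Qed.

Let lapr u : V u -> lap e0 r u = E u * (weight u - 2 * Lam) * r u.
Proof.
move=> Vu; rewrite /weight; have En := E0 Vu; have rn := r0 Vu.
by move: (lap _ _ _) (E u) (r u) En rn => l E' S En rn; field; rewrite En rn.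
Qed.

Let grad_weight := derivative_of_tpart (m := 0) smooth_weight weightE.

Lemma field_o2_constant x : U x -> b1 x = 0.
Proof.
move=> Ux; rewrite weightE //.
exact: (weight_eq0 openV e0E sE sr E0 r0 H11 H12 H22 lapr grad_weight r1_neq0 (UV Ux)).
Qed.

Lemma soliton_gaussK_grad u : V u ->
  2 * r u * d1 (gaussK e0 E) u = (Lam - 3 * gaussK e0 E u) * d1 r u /\
  2 * r u * d2 (gaussK e0 E) u = (Lam - 3 * gaussK e0 E u) * d2 r u.
Proof. exact: (gaussK_grad openV e0E sE sr E0 r0 H11 H12 H22). Qed.

Lemma soliton_norm_dr u : V u -> dotp e0 r r u = - 4 * r u ^+ 2 * E u * gaussK e0 E u.
Proof. exact: (norm_dr openV e0E sE sr E0 r0 H11 H12 H22 lapr grad_weight r1_neq0). Qed.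

Lemma soliton_lap_r u : V u -> lap e0 r u = - 2 * Lam * E u * r u.
Proof. exact: (lap_r openV e0E sE sr E0 r0 H11 H12 H22 lapr grad_weight r1_neq0). Qed.

Lemma twist_constant u : V u -> has_grad (fun u => r u ^+ 2 * d2 c u / E u) u (fun=> 0).
Proof.
move=> Vu; have gr f : smooth_on V f -> has_grad f u (fun i => partial i f u).
  by move=> sf; exact/has_gradE/(smooth_differentiable sf).
have En := E0 Vu; have rn := r0 Vu.
have := has_gradM (has_gradM (has_gradX 2 (gr _ sr)) (gr _ (smooth_partial 1 sc)))
  (has_gradV En (gr _ sE)).
move=> H; apply: has_grad_eq H _.
have m1 : mix1 e0 E c r u = 0 by case: Vu => x Ux <-; exact: soliton_1z.
have m2 : mix2 E c r u = 0 by case: Vu => x Ux <-; exact: soliton_2z.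
have e00 : e0 != 0 by case: e0E => ->; rewrite ?oppr_eq0 oner_eq0.
elim/ord2P => /=.
  rewrite -[RHS](mulr0 (2 * r u)) -m2 /mix2.
  move: (d1 (d2 c) u) (d2 c u) (d1 r u) (d1 E u) (r u) (E u) En => ? ? ? ? ? ? En'.
  by field.
rewrite -[RHS](mulr0 (- 2 * r u / e0)) -m1 /mix1.
move: (d2 (d2 c) u) (d2 c u) (d2 r u) (d2 E u) (r u) (E u) En => ? ? ? ? ? ? En'.
by field; rewrite ?e00 ?En'.
Qed.

(** The z1-derivative of the z2-component of [X], solved from the z1 z1 equation with [b1 = 0]; up
    to scale it becomes the constant a2. *)
Definition drift u := (Lam * h u - ric_zz11 e0 E c h r u) / r u.

Lemma driftE u : V u -> ric_zz11 e0 E c h r u = Lam * h u - r u * drift u.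
Proof.
move=> Vu; have rn := r0 Vu; rewrite /drift.
by move: (ric_zz11 _ _ _ _ _ _) (h u) (r u) rn => z H S Sn; field.
Qed.

Lemma field_o3_drift x : U x -> b2 x = drift (tpart x).
Proof.
move=> Ux; have rn := r0 (UV Ux); rewrite /drift -(soliton_z11 Ux) field_o2_constant //.
by rewrite mulr0 add0r addrAC subrr add0r [r _ * _]mulrC mulfK.
Qed.

Let smooth_drift : smooth_on V drift.
Proof.
have sr1 := smooth_partial 0 sr; have sr2 := smooth_partial 1 sr.
have sh1 := smooth_partial 0 sh; have sh2 := smooth_partial 1 sh.
have two : (2 : R) != 0 by rewrite pnatr_eq0.
rewrite /drift /ric_zz11 /lap /dotp; smooth_auto.
all: by move=> u Vu; rewrite ?mulf_neq0 ?expf_neq0 ?E0 ?r0.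
Qed.

Lemma drift_constant u : V u -> has_grad drift u (fun=> 0).
Proof. exact: (derivative_of_tpart (m := 1) smooth_drift field_o3_drift). Qed.

Lemma field_grad x : U x ->
  has_grad (fun y => X y 0 o2) x (fun=> 0) /\
  has_grad (fun y => X y 0 o3) x (fun i => om x i * drift (tpart x)).
Proof.
move=> Ux; split; split; try exact: (smooth_differentiable (sX _ _) Ux).
  by move=> i; rewrite (partial_field i Ux).1 field_o2_constant // mulr0.
by move=> i; rewrite (partial_field i Ux).2 field_o3_drift.
Qed.

End Soliton.

(** * Change of adapted coordinates *)

Section LiftCoordinates.
Context {R : realType}.
Local Notation pt := 'rV[R]_(2 + 2).
Variables (U : set pt) (W W' : set 'rV[R]_2) (T S : 'rV[R]_2 -> 'rV[R]_2).
Variables (F G : 'rV[R]_2 -> R) (al be : R).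
Hypotheses (openU : open U) (cc : coordinate_change W W' T S) (al0 : al != 0) (be0 : be != 0).
Hypotheses (sF : smooth_on W F) (sG : smooth_on W G).

(** The shift [F] is meant to absorb the form a dt1, and [G] the exact part of c dt1; the scales
    [al] and [be] normalise the remaining constants. *)
Definition lift_to (x : pt) : pt := row_mx (T (tpart x))
  (pair2 ((zpart x 0 0 + F (tpart x)) / al) ((zpart x 0 1 + G (tpart x)) / be)).
Definition lift_from (q : pt) : pt := row_mx (S (tpart q))
  (pair2 (al * zpart q 0 0 - F (S (tpart q))) (be * zpart q 0 1 - G (S (tpart q)))).
Definition lift_dom : set pt := U `&` tpart @^-1` W.
Definition lift_cod : set pt := (tpart @^-1` W') `&` (lift_from @^-1` U).

Lemma continuous_tpart : continuous (@tpart R).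
Proof.
move=> x; apply: differentiable_continuous; apply: differentiable_row => j.
have -> : (fun y : pt => tpart y 0 j) = (fun y => y 0 (lshift 2 j)).
  by apply/funext => y; rewrite mxE.
exact: (has_grad_coord x _).1.
Qed.

Lemma lift_change : coordinate_change lift_dom lift_cod lift_to lift_from.
Proof.
have [[oW oW'] [sT sS] ST TS] := cc.
have oD : open (tpart @^-1` W : set pt) by apply: open_comp oW => x _; exact: continuous_tpart.
have oC : open (tpart @^-1` W' : set pt) by apply: open_comp oW' => x _; exact: continuous_tpart.
have oU : open lift_dom by exact: openI.
have sz (O : set pt) j : open O -> smooth_on O (fun x => zpart x 0 j).
  move=> oO; apply: (smooth_eq oO (smooth_coord oO (rshift 2 j))) => x _.
  by rewrite mxE.
have sf : smooth_mx (tpart @^-1` W' : set pt) lift_from.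
  have cS : forall x : pt, (tpart @^-1` W') x -> W' (tpart x) by [].
  have sFS : smooth_on W' (fun u => F (S u)) by apply: (smooth_comp oW' sS _ sF) => u /TS[].
  have sGS : smooth_on W' (fun u => G (S u)) by apply: (smooth_comp oW' sS _ sG) => u /TS[].
  move=> i j; rewrite ord1; elim/ord4P : j.
  - by apply: (smooth_eq oC (smooth_tpart oC cS (sS 0 0))) => x _; rewrite row_mxEl.
  - by apply: (smooth_eq oC (smooth_tpart oC cS (sS 0 1))) => x _; rewrite row_mxEl.
  - apply: (smooth_eq oC (smooth_add oC (smooth_mul oC (smooth_cst oC al) (sz _ 0 oC))
      (smooth_opp oC (smooth_tpart oC cS sFS)))) => x _.
    by rewrite row_mxEr pair2E.
  - apply: (smooth_eq oC (smooth_add oC (smooth_mul oC (smooth_cst oC be) (sz _ 1 oC))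
      (smooth_opp oC (smooth_tpart oC cS sGS)))) => x _.
    by rewrite row_mxEr pair2E.
have oW2 : open lift_cod.
  rewrite openE => q [Wq Uq]; apply: filterI.
    by apply: open_nbhs_nbhs.
  have cf : {for q, continuous lift_from}.
    apply: differentiable_continuous; apply: differentiable_row => j.
    exact: (smooth_differentiable (sf 0 j)).
  by apply: cf; apply: open_nbhs_nbhs.
have lT x : lift_dom x -> lift_from (lift_to x) = x.
  move=> [_ Wx]; have tl : tpart (lift_to x) = T (tpart x) by exact: tpart_row.
  rewrite /lift_from tl zpart_row (ST _ Wx).2 !pair2E -[RHS]row_parts.
  congr row_mx; rewrite -[RHS]pair2K; congr pair2.
    by rewrite mulrC divfK // addrK.
  by rewrite mulrC divfK // addrK.
have tT q : lift_cod q -> lift_to (lift_from q) = q.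
  move=> [Wq _]; have tl : tpart (lift_from q) = S (tpart q) by exact: tpart_row.
  rewrite /lift_to tl zpart_row (TS _ Wq).2 !pair2E !subrK -[RHS]row_parts.
  by congr row_mx; rewrite -[RHS]pair2K ![_ * zpart _ _ _]mulrC !mulfK.
split.
- by split.
- split; last by move=> i j; apply: smooth_sub (sf i j) => q [].
  have cS : forall x : pt, lift_dom x -> W (tpart x) by move=> x [].
  move=> i j; rewrite ord1; elim/ord4P : j.
  - by apply: (smooth_eq oU (smooth_tpart oU cS (sT 0 0))) => x _; rewrite row_mxEl.
  - by apply: (smooth_eq oU (smooth_tpart oU cS (sT 0 1))) => x _; rewrite row_mxEl.
  - apply: (smooth_eq oU (smooth_mul oU (smooth_add oU (sz _ 0 oU) (smooth_tpart oU cS sF))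
      (smooth_cst oU al^-1))) => x _.
    by rewrite row_mxEr pair2E.
  - apply: (smooth_eq oU (smooth_mul oU (smooth_add oU (sz _ 1 oU) (smooth_tpart oU cS sG))
      (smooth_cst oU be^-1))) => x _.
    by rewrite row_mxEr pair2E.
- move=> x Dx; rewrite lT //; split => //; split; last by rewrite /= lT //; case: Dx.
  by rewrite /= tpart_row; case: Dx => _ /ST[].
- move=> q Cq; rewrite tT //; split => //; case: (Cq) => Wq Uq; split => //=.
  by rewrite tpart_row; case: (TS _ Wq).
Qed.

(* Rows are the old coordinates, columns the new ones. *)
Lemma dmx_lift_to x : lift_dom x ->
  let u := tpart x in let J := dmx lift_to x in
  [/\ [/\ J o0 o0 = dmx T u 0 0, J o0 o1 = dmx T u 0 1, J o0 o2 = d1 F u / al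
        & J o0 o3 = d1 G u / be],
     [/\ J o1 o0 = dmx T u 1 0, J o1 o1 = dmx T u 1 1, J o1 o2 = d2 F u / al
        & J o1 o3 = d2 G u / be],
     [/\ J o2 o0 = 0, J o2 o1 = 0, J o2 o2 = al^-1 & J o2 o3 = 0] &
     [/\ J o3 o0 = 0, J o3 o1 = 0, J o3 o2 = 0 & J o3 o3 = be^-1]].
Proof.
move=> [_ Wx] u J; have [[oW oW'] [sT sS] ST TS] := cc.
have gT j := has_grad_tpart (has_gradE (smooth_differentiable (sT 0 j) Wx)).
have gF := has_grad_tpart (has_gradE (smooth_differentiable sF Wx)).
have gG := has_grad_tpart (has_gradE (smooth_differentiable sG Wx)).
have gz j : has_grad (fun x => zpart x 0 j) x (fun i => (i == rshift 2 j)%:R).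
  apply: has_grad_near (has_grad_coord x (rshift 2 j)).
  by near=> y; rewrite mxE.
have J0 i j : J i (lshift 2 j) = of_tpart (fun m => dmx T u m j) i.
  rewrite mxE (_ : (fun y => lift_to y 0 (lshift 2 j)) = fun y => T (tpart y) 0 j).
    by rewrite (gT j).2; elim/ord4P : i; rewrite !of_tpartE ?mxE.
  by apply/funext => y; rewrite row_mxEl.
have J2 i : J i o2 = ((i == o2)%:R + of_tpart (fun m => partial m F u) i) / al.
  rewrite mxE (_ : (fun y => lift_to y 0 o2) = fun y => (zpart y 0 0 + F (tpart y)) * al^-1).
    by rewrite (has_gradM (has_gradD (gz 0) gF) (has_grad_cst al^-1 x)).2 mulr0 addr0.
  by apply/funext => y; rewrite row_mxEr pair2E.
have J3 i : J i o3 = ((i == o3)%:R + of_tpart (fun m => partial m G u) i) / be.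
  rewrite mxE (_ : (fun y => lift_to y 0 o3) = fun y => (zpart y 0 1 + G (tpart y)) * be^-1).
    by rewrite (has_gradM (has_gradD (gz 1) gG) (has_grad_cst be^-1 x)).2 mulr0 addr0.
  by apply/funext => y; rewrite row_mxEr pair2E.
split; split; rewrite ?J0 ?J2 ?J3 ?of_tpartE /= ?add0r ?addr0 ?mul0r ?mul1r //.
Unshelve. all: by end_near. Qed.

End LiftCoordinates.

Lemma det_mx2 (R : realType) (M : 'M[R]_2) : \det M = M 0 0 * M 1 1 - M 0 1 * M 1 0.
Proof.
have l0 : lift (0 : 'I_2) (0 : 'I_1) = 1 by apply: val_inj.
have l1 : lift (1 : 'I_2) (0 : 'I_1) = 0 by apply: val_inj.
rewrite (expand_det_row _ 0) sum2E /cofactor !det_mx11 !mxE l0 l1 /=.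
by rewrite expr0 expr1 mul1r mulN1r mulrN.
Qed.

Section NormalPlane.
Context {R : realType}.
Variables (q : 'rV[R]_2) (d e0 be : R).
Variables (a c T1 X X' phi phi' : 'rV[R]_2 -> R).
Let Q := ball q d.
Hypotheses (d0 : 0 < d) (e0E : e0 = 1 \/ e0 = -1).
Hypotheses (sa : smooth_on Q a) (sc : smooth_on Q c) (sT1 : smooth_on Q T1)
  (sX : smooth_on Q X) (sphi : smooth_on Q phi).
Hypotheses (d2a : forall u, Q u -> d2 a u = 0)
  (X0 : forall u, Q u -> X u != 0)
  (N0 : forall u, Q u -> dotp e0 T1 T1 u != 0)
  (gX : forall u, Q u -> forall i, partial i X u = X' u * partial i T1 u)
  (gphi : forall u, Q u -> forall i, partial i phi u = phi' u * partial i T1 u)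
  (lapT1 : forall u, Q u -> X u * lap e0 T1 u = - X' u * dotp e0 T1 T1 u)
  (c2 : forall u, Q u -> d2 c u = be * phi u * X u * dotp e0 T1 T1 u).

(** A weighted harmonic conjugate of [T1]: [lapT1] says that the divergence of [X] times the
    gradient of [T1] vanishes, which is the closedness of the rotated form. *)
Lemma conjugate_coordinate : exists T2, smooth_on (ball q (d / 2)) T2 /\
  forall u, ball q (d / 2) u ->
    d1 T2 u = - e0 * (X u * d2 T1 u) /\ d2 T2 u = X u * d1 T1 u.
Proof.
have oQ : open Q by exact: ball_open.
have sT11 := smooth_partial 0 sT1; have sT12 := smooth_partial 1 sT1.
apply: poincare => //.
- apply: smooth_mul => //; first exact: smooth_cst.
  by apply: smooth_mul.
- by apply: smooth_mul.
- move=> u Qu; have gr f : smooth_on Q f -> has_grad f u (fun i => partial i f u).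
    by move=> sf; exact/has_gradE/(smooth_differentiable sf).
  rewrite (has_gradM (has_grad_cst (- e0) u) (has_gradM (gr _ sX) (gr _ sT12))).2.
  rewrite (has_gradM (gr _ sX) (gr _ sT11)).2 !gX //.
  have := lapT1 Qu; rewrite /lap /dotp.
  move: (X u) (X' u) (d1 T1 u) (d2 T1 u) (d1 (d1 T1) u) (d2 (d2 T1) u).
  move=> x x' t1 t2 t11 t22 /eqP; rewrite -subr_eq0 => /eqP e.
  by apply/eqP; rewrite -subr_eq0 -[X in _ == X]oppr0 -[in X in _ == X]e; apply/eqP; ring.
Qed.

(** [c2] is the statement that [c dt1 - be phi T2 dT1] is closed, and [G] is its primitive. The map
    [(T1, T2)] is a coordinate system because its Jacobian determinant is [X] times |dT1|^2. *)
Lemma normal_plane : exists (W W' : set 'rV[R]_2) (T S : 'rV[R]_2 -> 'rV[R]_2)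
    (F G : 'rV[R]_2 -> R),
  [/\ [/\ coordinate_change W W' T S, W q & W `<=` Q],
    [/\ smooth_on (ball q (d / 2 / 2)) F, smooth_on W G & W `<=` ball q (d / 2 / 2)],
    forall u, T u 0 0 = T1 u,
    forall u, W u -> d1 (fun v => T v 0 1) u = - e0 * (X u * d2 T1 u) /\
      d2 (fun v => T v 0 1) u = X u * d1 T1 u &
    (forall u, ball q (d / 2 / 2) u -> d1 F u = a u /\ d2 F u = 0) /\
    (forall u, W u -> d1 G u = c u - be * phi u * T u 0 1 * d1 T1 u /\
      d2 G u = - (be * phi u * T u 0 1 * d2 T1 u))].
Proof.
have [T2 [sT2 dT2]] := conjugate_coordinate.
have oQ : open Q by exact: ball_open.
(* Every primitive costs half of the radius; the form for [G] contains [T2], so [G] lives on the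
   quarter ball. *)
pose Q2 := ball q (d / 2); pose Q4 := ball q (d / 2 / 2).
have oQ2 : open Q2 by exact: ball_open. have oQ4 : open Q4 by exact: ball_open.
have d20 : 0 < d / 2 by rewrite divr_gt0.
have d40 : 0 < d / 2 / 2 by rewrite divr_gt0.
have Q2Q : Q2 `<=` Q by apply: le_ball; rewrite ler_pdivrMr // ler_pMr // ler1n.
have Q4Q2 : Q4 `<=` Q2 by apply: le_ball; rewrite ler_pdivrMr // ler_pMr // ler1n.
have sT11 := smooth_partial 0 sT1; have sT12 := smooth_partial 1 sT1.
have [F [sF dF]] : exists F, smooth_on Q2 F /\
    forall u, Q2 u -> d1 F u = a u /\ d2 F u = 0.
  apply: poincare => //; first exact: smooth_cst.
  by move=> u Qu; rewrite d2a // (has_grad_cst (0 : R) u).2.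
have [G [sG dG]] : exists G, smooth_on Q4 G /\ forall u, Q4 u ->
    d1 G u = c u - be * phi u * T2 u * d1 T1 u /\
    d2 G u = - (be * phi u * T2 u * d2 T1 u).
  have sp : smooth_on Q2 (fun u => be * phi u * T2 u).
    apply: smooth_mul => //; apply: smooth_mul => //; first exact: smooth_cst.
    exact: smooth_sub sphi.
  apply: poincare => //.
  - apply: smooth_add => //; first exact: smooth_sub sc.
    apply: smooth_opp => //; apply: smooth_mul => //; exact: smooth_sub sT11.
  - apply: smooth_opp => //; apply: smooth_mul => //; exact: smooth_sub sT12.
  - move=> u Q2u; have Qu := Q2Q _ Q2u.
    have gr f : smooth_on Q f -> has_grad f u (fun i => partial i f u).
      by move=> sf; exact/has_gradE/(smooth_differentiable sf).
    have gT2 := has_gradE (smooth_differentiable sT2 Q2u).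
    have gp := has_gradM (has_gradM (has_grad_cst be u) (gr _ sphi)) gT2.
    have g1 := has_gradD (gr _ sc) (has_gradN (has_gradM gp (gr _ sT11))).
    have g2 := has_gradN (has_gradM gp (gr _ sT12)).
    rewrite g1.2 g2.2 !gphi // c2 //; have [-> ->] := dT2 u Q2u.
    rewrite (smooth_partial_comm 0 1 oQ sT1 Qu) /dotp.
    move: (phi u) (phi' u) (X u) (T2 u) (d1 T1 u) (d2 T1 u) (d1 (d2 T1) u).
    by move=> ? ? ? ? ? ? ?; ring.
pose T u := pair2 (T1 u) (T2 u).
have sT : smooth_mx Q4 T.
  move=> i j; rewrite ord1; elim/ord2P : j.
    apply: (smooth_eq oQ4 (smooth_sub _ sT1)) => [u /Q4Q2/Q2Q//|u _].
    by rewrite pair2E.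
  by apply: (smooth_eq oQ4 (smooth_sub Q4Q2 sT2)) => u _; rewrite pair2E.
have TE : (fun u => T u 0 0) = T1 /\ (fun u => T u 0 1) = T2.
  by split; apply/funext => u; rewrite pair2E.
have [W [W' [S [cc Wq WQ]]]] : exists (W W' : set 'rV[R]_2) S,
    [/\ coordinate_change W W' T S, W q & W `<=` Q4].
  apply: inverse_function => // u Q4u; have Q2u := Q4Q2 _ Q4u; have Qu := Q2Q _ Q2u.
  have [e1 e2] := dT2 u Q2u.
  rewrite unitmxE unitfE (det_mx2 (dmx T u)) !mxE TE.1 TE.2 e1 e2.
  have -> : d1 T1 u * (X u * d1 T1 u) - - e0 * (X u * d2 T1 u) * d2 T1 u =
    X u * dotp e0 T1 T1 u by rewrite /dotp; ring.
  by rewrite mulf_neq0 ?X0 ?N0.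
exists W, W', T, S, F, G; split => //.
- by split => // u /WQ/Q4Q2/Q2Q.
- by split => //; [apply: smooth_sub sF|apply: smooth_sub sG].
- by move=> u; rewrite pair2E.
- by move=> u Wu; rewrite TE.2; apply: dT2; exact/Q4Q2/WQ.
- split=> u Wu; first by have [-> ->] := dF u (Q4Q2 _ Wu).
  by have [-> ->] := dG u (WQ _ Wu); rewrite pair2E.
Qed.

End NormalPlane.

Section PullBack.
Context {R : realType}.
Variables (W W' : set 'rV[R]_2) (T S : 'rV[R]_2 -> 'rV[R]_2) (e0 : R).
Variables (h T1 X X' : 'rV[R]_2 -> R).
Hypotheses (cc : coordinate_change W W' T S) (e0E : e0 = 1 \/ e0 = -1).
Hypotheses (sh : smooth_on W h) (sT1 : smooth_on W T1) (sX : smooth_on W X).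
Hypotheses (TT1 : forall u, T u 0 0 = T1 u)
  (dT2 : forall u, W u -> d1 (fun v => T v 0 1) u = - e0 * (X u * d2 T1 u) /\
      d2 (fun v => T v 0 1) u = X u * d1 T1 u)
  (gX : forall u, W u -> forall i, partial i X u = X' u * partial i T1 u).
Let H t := h (S t).

Lemma smooth_pull_back : smooth_on W' H.
Proof.
have [[oW oW'] [sT sS] ST TS] := cc.
by apply: (smooth_comp oW' sS _ sh) => t /TS[].
Qed.

(** The coordinates are orthogonal, so no mixed derivative appears, and |dT2|^2 is [e0 * X ^+ 2]
    times |dT1|^2. There is no first-order term in T2 either: [X] is a function of [T1], so [T2] is
    harmonic. *)
Lemma pull_back_lap u : W u ->
  dotp e0 T1 h u = dotp e0 T1 T1 u * d1 H (T u) /\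
  lap e0 h u = dotp e0 T1 T1 u * (d1 (d1 H) (T u) + e0 * X u ^+ 2 * d2 (d2 H) (T u))
    + lap e0 T1 u * d1 H (T u).
Proof.
have [[oW oW'] [sT sS] ST TS] := cc.
have TE0 : (fun u => T u 0 0) = T1 by apply/funext.
have gc (f : 'rV[R]_2 -> R) v : smooth_on W' f -> W v -> has_grad (fun v => f (T v)) v
    (fun i => if i == 0
       then d1 T1 v * d1 f (T v) - e0 * (X v * d2 T1 v) * d2 f (T v)
       else d2 T1 v * d1 f (T v) + X v * d1 T1 v * d2 f (T v)).
  move=> sf Wv; have [Wt _] := ST v Wv.
  have df := has_gradE (smooth_differentiable sf Wt).
  have dT j := has_gradE (smooth_differentiable (sT 0 j) Wv).
  have [e1 e2] := dT2 Wv.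
  have [dfT dfTE] := has_grad_comp df dT.
  apply: has_grad2 => //; rewrite dfTE sum2E TE0 ?e1 ?e2 //; ring.
have gh v : W v -> has_grad h v (fun i => if i == 0
       then d1 T1 v * d1 H (T v) - e0 * (X v * d2 T1 v) * d2 H (T v)
       else d2 T1 v * d1 H (T v) + X v * d1 T1 v * d2 H (T v)).
  move=> Wv; apply: has_grad_near (gc H v smooth_pull_back Wv).
  by apply: (@open_near_eq _ _ W (fun v => H (T v)) h) => // w /ST[_ Sw]; rewrite /H Sw.
move=> Wu; have [_ ghu] := gh u Wu; rewrite /dotp (ghu 0) (ghu 1) /=.
have gr f : smooth_on W f -> has_grad f u (fun i => partial i f u).
  by move=> sf; exact/has_gradE/(smooth_differentiable sf).
have gp := gc (d1 H) u (smooth_partial 0 smooth_pull_back) Wu.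
have gs := gc (d2 H) u (smooth_partial 1 smooth_pull_back) Wu.
have t1 := gr _ (smooth_partial 0 sT1); have t2 := gr _ (smooth_partial 1 sT1).
have G1 := has_gradD (has_gradM t1 gp) (has_gradN (has_gradM (has_gradM
  (has_grad_cst e0 u) (has_gradM (gr _ sX) t2)) gs)).
have G2 := has_gradD (has_gradM t2 gp) (has_gradM (has_gradM (gr _ sX) t1) gs).
have n1 : \near u, d1 T1 u * d1 H (T u) - e0 * (X u * d2 T1 u) * d2 H (T u) = d1 h u.
  by apply: (open_near_eq oW Wu) => v Wv; rewrite ((gh v Wv).2 0).
have n2 : \near u, d2 T1 u * d1 H (T u) + X u * d1 T1 u * d2 H (T u) = d2 h u.
  by apply: (open_near_eq oW Wu) => v Wv; rewrite ((gh v Wv).2 1).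
have E1 := (has_grad_near n1 G1).2 0; have E2 := (has_grad_near n2 G2).2 1.
rewrite /= in E1 E2; have s12 := smooth_partial_comm 0 1 oW sT1 Wu.
have [x1 x2] := (gX Wu 0, gX Wu 1).
rewrite x1 in E1; rewrite x2 s12 in E2.
rewrite /lap E1 E2.
move: (d1 (d1 H) (T u)) (d2 (d1 H) (T u)) (d1 (d2 H) (T u)) (d2 (d2 H) (T u))
  (d1 H (T u)) (d2 H (T u)) (d1 (d1 T1) u) (d1 (d2 T1) u) (d2 (d2 T1) u)
  (d1 T1 u) (d2 T1 u) (X u) (X' u) => *.
by split; case: e0E => ->; ring.
Qed.

End PullBack.

Lemma soliton_metricE (R : realType) (a11 a22 b h11 h12 : R) i j :
  soliton_metric a11 a22 b h11 h12 i j = entry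
    [:: [:: a11; 0; b; 0]; [:: 0; a22; 0; 0]; [:: b; 0; h11; h12]; [:: 0; 0; h12; 0]] i j.
Proof.
rewrite /soliton_metric; elim/ord4P : i; elim/ord4P : j; rewrite /entry /=.
all: by rewrite ?block_mxEul ?block_mxEur ?block_mxEdl ?block_mxEdr ?mx2E.
Qed.

Section NewEquation.
Context {R : realType}.

(* Pure algebra at a point: [N], [p] are the values of [dotp T1 T1] and of the
   first derivative of the pulled back [h]. *)
Lemma new_equation (e0 sg Lam E r h c2 K A X X' H H' phi al be w0 k : R)
    (laph drh drr lapT N p p11 p22 : R) :
  e0 = 1 \/ e0 = -1 -> sg = 1 \/ sg = -1 ->
  E != 0 -> r != 0 -> A != 0 -> X != 0 -> H != 0 -> al != 0 -> be != 0 -> N != 0 ->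
  A * N = sg * E -> sg * al * be * r = H -> sg * K = k ->
  drh = H' / (sg * al * be) * (N * p) -> drr = - 4 * r ^+ 2 * E * K ->
  c2 = be * phi * X * N -> X * lapT = - X' * N ->
  laph = N * (p11 + e0 * X ^+ 2 * p22) + lapT * p ->
  (- laph + drh / r - h * drr / r ^+ 2 + e0 * (r * c2) ^+ 2 / E) / (2 * E) =
    Lam * h - r * w0 ->
  let y := sg * al ^+ 2 in
  y * p11 + e0 * X ^+ 2 * (y * p22) - (X' / X + H' / H) * (y * p)
    - (4 * k - 2 * (sg * Lam)) * A * (y * h)
  = e0 * H ^+ 2 * phi ^+ 2 * X ^+ 2 / A + 2 * A * H * (sg * w0 * al / be).
Proof.
move=> e0E sgE En rn An Xn Hn aln ben Nn AN rH sK -> -> -> XL -> eq y.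
have L : lapT = - X' * N / X by rewrite -XL; field.
have EE : E = sg * (A * N) by rewrite AN; case: sgE => ->; ring.
have rE : r = H / (sg * al * be).
  by rewrite -rH; field; rewrite aln ben; case: sgE => ->; rewrite ?oppr_eq0 oner_eq0.
rewrite -sK /y; move: eq; rewrite L EE rE => /eqP; rewrite -subr_eq0 => /eqP eq.
apply/eqP; rewrite -subr_eq0 -(mulr0 (- 2 * al ^+ 2 * sg * sg * A)) -[in X in _ == X]eq; apply/eqP.
by case: sgE => ->; case: e0E => ->; field; rewrite An Xn Hn aln ben Nn.
Qed.

End NewEquation.

(** The pull-back [J M J^T] of the canonical matrix. The relation between [A] and [E] settles the
    orbit metric, the one between [H] and [r] the leaves, and the last columns of [J] absorb [a] and
    [c]. *)
Lemma transform_metric (R : realType) (J M : 'M[R]_(2 + 2))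
    (e0 sg E a c h r A X H phi T2 t1 t2 al be : R) i j :
  e0 = 1 \/ e0 = -1 -> sg = 1 \/ sg = -1 -> A != 0 -> X != 0 -> H != 0 -> al != 0 -> be != 0 ->
  A * (t1 * t1 + e0 * (t2 * t2)) = sg * E -> sg * al * be * r = H ->
  (forall i j, J i j = entry
    [:: [:: t1; - e0 * (X * t2); a / al; (c - be * phi * T2 * t1) / be];
        [:: t2; X * t1; 0; - (be * phi * T2 * t2) / be];
        [:: 0; 0; al^-1; 0]; [:: 0; 0; 0; be^-1]] i j) ->
  (forall i j, M i j = entry
    [:: [:: A; 0; phi * T2 * H; 0]; [:: 0; e0 * A / X ^+ 2; 0; 0];
        [:: phi * T2 * H; 0; sg * al ^+ 2 * h; H]; [:: 0; 0; H; 0]] i j) ->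
  sg * entry [:: [:: E + 2 * a * c * r + a ^+ 2 * h; 0; a * h + c * r; a * r];
    [:: 0; E * e0; 0; 0]; [:: a * h + c * r; 0; h; r]; [:: a * r; 0; r; 0]] i j =
  (J *m M *m J^T) i j.
Proof.
move=> e0E sgE A0 X0 H0 al0 be0 EN rH JE ME.
have EE : E = sg * (A * (t1 * t1 + e0 * (t2 * t2))).
  by rewrite EN; case: sgE => ->; ring.
have rE : r = sg * H / (al * be).
  by rewrite -rH; case: sgE => ->; field; rewrite al0 be0.
rewrite EE rE.
rewrite !mxE sum4E ![(J *m M) _ _]mxE !sum4E ![J^T _ _]mxE !JE !ME.
elim/ord4P : i; elim/ord4P : j; rewrite /entry /=.
all: by case: sgE => ->; case: e0E => ->; field; rewrite ?A0 ?X0 ?H0 ?al0 ?be0.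
Qed.

Section LocalForm.
Context {R : realType}.
Local Notation pt := 'rV[R]_(2 + 2).
Variables (g : pt -> 'M[R]_(2 + 2)) (xi : 'I_2 -> pt -> pt) (F4 : pt -> pt)
  (Lam e0 sg al be w0 d : R) (p : pt) (E r h a c K T1 : 'rV[R]_2 -> R)
  (Af Xf X'f Hf H'f phif phi'f kf : R -> R).
Let Q := ball (tpart p) d.
Hypotheses (d0 : 0 < d) (e0E : e0 = 1 \/ e0 = -1) (sgE : sg = 1 \/ sg = -1)
  (al0 : al != 0) (be0 : be != 0).
Hypotheses (sh : smooth_on Q h) (sa : smooth_on Q a) (sc : smooth_on Q c)
  (sT1 : smooth_on Q T1) (sX : smooth_on Q (fun u => Xf (T1 u)))
  (sphi : smooth_on Q (fun u => phif (T1 u))).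
Hypotheses (E0 : forall u, Q u -> E u != 0) (r0 : forall u, Q u -> r u != 0)
  (A0 : forall u, Q u -> Af (T1 u) != 0) (X0 : forall u, Q u -> Xf (T1 u) != 0)
  (H0 : forall u, Q u -> Hf (T1 u) != 0)
  (d2a : forall u, Q u -> d2 a u = 0).
Hypotheses
  (AN : forall u, Q u -> Af (T1 u) * dotp e0 T1 T1 u = sg * E u)
  (rH : forall u, Q u -> sg * al * be * r u = Hf (T1 u))
  (dr : forall u, Q u -> forall i, partial i r u = H'f (T1 u) / (sg * al * be) * partial i T1 u)
  (sK : forall u, Q u -> sg * K u = kf (T1 u))
  (drr : forall u, Q u -> dotp e0 r r u = - 4 * r u ^+ 2 * E u * K u)
  (gX : forall u, Q u -> forall i,
    partial i (fun u => Xf (T1 u)) u = X'f (T1 u) * partial i T1 u)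
  (gphi : forall u, Q u -> forall i,
    partial i (fun u => phif (T1 u)) u = phi'f (T1 u) * partial i T1 u)
  (lapT1 : forall u, Q u -> Xf (T1 u) * lap e0 T1 u = - X'f (T1 u) * dotp e0 T1 T1 u)
  (c2 : forall u, Q u -> d2 c u = be * phif (T1 u) * Xf (T1 u) * dotp e0 T1 T1 u)
  (ric : forall u, Q u -> ric_zz11 e0 E c h r u = Lam * h u - r u * w0).
Hypotheses
  (gE : forall x, ball p d x -> forall i j, g x i j = entry (g_tab e0 E a c h r (tpart x)) i j)
  (xiE : exists2 A : 'M[R]_2, A \in unitmx &
    forall i x, ball p d x -> xi i x = \sum_k A i k *: dz k)
  (F4t : forall x, ball p d x -> F4 x 0 o0 = 0 /\ F4 x 0 o1 = 0)
  (F4z : forall x, ball p d x -> has_grad (fun y => F4 y 0 o2) x (fun=> 0) /\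
    has_grad (fun y => F4 y 0 o3) x (fun i => nth 0 [:: a (tpart x); 0; 1; 0] i * w0)).

Lemma tpart_ball x e : ball p e x -> ball (tpart p) e (tpart x).
Proof.
move=> /ballP px; apply/ballP; apply: le_lt_trans px.
apply: norm_le_coord => // i.
by have := norm_coord_le (x - p) (lshift 2 i); rewrite !mxE.
Qed.

(** The part common to both types, which differ only in functions of [T1]: [Af] and [Hf] are the new
    entries for dt1^2 and dz1 dz2, [Xf] is the weight that defines T2, [phif] the factor of T2 in
    the new connection, and [kf] the curvature of the orbit metric of [sg *: g]. *)
Theorem local_form : exists (W W' : set pt) (y x : pt -> pt) (a1 a3 : R) (hh : 'rV[R]_2 -> R),
  [/\ [/\ coordinate_change W W' y x, W p, W `<=` ball p d &
    adapted W' (fun i => field_in y x (xi i))],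
   [/\ smooth_on (tpart @` W') hh,
     forall u, (tpart @` W') u -> exists2 v, Q v & T1 v = u 0 0 &
     forall u, (tpart @` W') u -> let t := u 0 0 in
       d1 (d1 hh) u + e0 * Xf t ^+ 2 * d2 (d2 hh) u - (X'f t / Xf t + H'f t / Hf t) * d1 hh u
       - (4 * kf t - 2 * (sg * Lam)) * Af t * hh u
       = e0 * Hf t ^+ 2 * phif t ^+ 2 * Xf t ^+ 2 / Af t
         + 2 * Af t * Hf t * (sg * w0 * al / be)],
   forall q, W' q -> let u := tpart q in let t := u 0 0 in
     metric_in x (fun x => sg *: g x) q = soliton_metric (Af t) (e0 * Af t / Xf t ^+ 2)
       (phif t * u 0 1 * Hf t) (hh u) (Hf t) &
   forall q, W' q ->
     field_in y x (fun x => sg *: F4 x) q = soliton_field a1 (sg * w0 * al / be) a3 q].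
Proof.
have oQ : open Q by exact: ball_open.
have sg0 : sg != 0 by case: sgE => ->; rewrite ?oppr_eq0 oner_eq0.
have N0 u : Q u -> dotp e0 T1 T1 u != 0.
  move=> Qu; apply/negP => /eqP z; have := AN Qu; rewrite z mulr0 => /esym/eqP.
  by rewrite mulf_eq0 (negPf sg0) (negPf (E0 Qu)).
have [W2 [W2' [T [S [F [G [[cc Wq WQ] [sF sG W4] TT1 dT2 [dF dG]]]]]]]] :=
  normal_plane d0 sa sc sT1 sX sphi d2a X0 N0 gX gphi lapT1 c2.
have [[oW2 oW2'] [sT sS] ST TS] := cc.
have sFW : smooth_on W2 F by exact: smooth_sub sF.
pose B4 := ball p (d / 2 / 2).
have d40 : 0 < d / 2 / 2 by rewrite !divr_gt0.
have B4d : B4 `<=` ball p d.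
  by apply: le_ball; lra.
have oB4 : open B4 by exact: ball_open.
have CC := lift_change oB4 cc al0 be0 sFW sG.
set y := lift_to T F G al be in CC; set x := lift_from S F G al be in CC.
set W := lift_dom B4 W2 in CC; set W' := lift_cod _ _ _ _ _ _ _ in CC.
have [[oW oW'] [sy sx] xy yx] := CC.
have WB q : W q -> ball p d q by move=> [/B4d].
pose hh u := sg * al ^+ 2 * h (S u).
have shW : smooth_on W2 h by exact: smooth_sub sh.
have Vt u : (tpart @` W') u -> W2' u by move=> [q [Wq' _] <-].
have tx q : W' q -> W2 (tpart (x q)) /\ T (tpart (x q)) = tpart q.
  move=> Wq'; have [[_ Wx] yxq] := yx q Wq'; split=> //.
  by have := congr1 (@tpart R) yxq; rewrite tpart_row.
have F4c q : W q -> F4 q 0 o2 = F4 p 0 o2.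
  move=> Wq'; apply: (@ball_constant _ _ (fun q => F4 q 0 o2) p d) => [z /F4z[]//|].
  exact: WB.
(* By the choice of [F], the connection form is d(z1 + F). Hence [w0 * (z1 + F)] is the whole
   variation of the last component of the field, and the constant [Psi] provides a3. *)
pose Psi q := F4 q 0 o3 - w0 * (zpart q 0 0 + F (tpart q)).
have Psic q : W q -> Psi q = Psi p.
  move=> [Bq _]; apply: (@ball_constant _ _ Psi p (d / 2 / 2)) => // z Bz.
  have [_ g3] := F4z (B4d _ Bz).
  have tz := tpart_ball Bz; have [f1 f2] := dF _ tz.
  have gF := has_grad_tpart (has_gradE (smooth_differentiable sF tz)).
  have gz : has_grad (fun x => zpart x 0 0) z (fun i => (i == o2)%:R).
    apply: has_grad_near (has_grad_coord z o2).
    by near=> v; rewrite mxE.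
  have := has_gradD g3 (has_gradN (has_gradM (has_grad_cst w0 z) (has_gradD gz gF))).
  move=> gP; apply: has_grad_eq gP _; elim/ord4P; rewrite of_tpartE /= ?f1 ?f2; ring.
have TE0 : (fun u => T u 0 0) = T1 by apply/funext.
have JE q : W q -> forall i j, dmx y q i j = let u := tpart q in entry
    [:: [:: d1 T1 u; - e0 * (Xf (T1 u) * d2 T1 u); a u / al;
           (c u - be * phif (T1 u) * T u 0 1 * d1 T1 u) / be];
        [:: d2 T1 u; Xf (T1 u) * d1 T1 u; 0; - (be * phif (T1 u) * T u 0 1 * d2 T1 u) / be];
        [:: 0; 0; al^-1; 0]; [:: 0; 0; 0; be^-1]] i j.
  move=> Wq'; have [Bq W2q] := Wq'.
  have [[j1 j2 j3 j4] [j5 j6 j7 j8] [k1 k2 k3 k4] [k5 k6 k7 k8]] :=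
    dmx_lift_to al be cc sFW sG Wq'.
  have [t1 t2] := dT2 _ W2q; have [f1 f2] := dF _ (W4 _ W2q); have [g1 g2] := dG _ W2q.
  have dT i j : dmx T (tpart q) i j = partial i (fun v => T v 0 j) (tpart q) by rewrite mxE.
  rewrite dT TE0 in j1; rewrite dT in j2; rewrite dT TE0 in j5; rewrite dT in j6.
  rewrite t1 in j2; rewrite t2 in j6; rewrite f1 in j3; rewrite f2 mul0r in j7.
  rewrite g1 in j4; rewrite g2 in j8.
  by elim/ord4P; elim/ord4P; rewrite /entry /=; assumption.
have sH : smooth_on W2' (fun u => h (S u)) by exact: smooth_pull_back cc shW.
have dhh f i u : smooth_on W2' f -> W2' u ->
    partial i (fun u => sg * al ^+ 2 * f u) u = sg * al ^+ 2 * partial i f u.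
  move=> sf Wu; have gf := has_gradE (smooth_differentiable sf Wu).
  by rewrite (has_gradM (has_grad_cst (sg * al ^+ 2) u) gf).2 mul0r add0r.
have ddhh i u : W2' u ->
    partial i (partial i hh) u = sg * al ^+ 2 * partial i (partial i (fun u => h (S u))) u.
  move=> Wu; rewrite -dhh //; last exact: smooth_partial.
  have n : \near u, sg * al ^+ 2 * partial i (fun u => h (S u)) u = partial i hh u.
    by apply: (open_near_eq oW2' Wu) => v Wv; rewrite /hh dhh.
  have sp := smooth_mul oW2' (smooth_cst oW2' (sg * al ^+ 2)) (smooth_partial i sH).
  by rewrite (has_grad_near n (has_gradE (smooth_differentiable sp Wu))).2.
exists W, W', y, x, (sg * F4 p 0 o2 / al), (sg * Psi p / be), hh; split.
- split=> //; first by split; [exact: ballxx|].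
  (* In the rescaled coordinates [dz 0] and [dz 1] acquire the factors [1 / al] and [1 / be]. *)
  have [A uA xiA] := xiE; exists (\matrix_(i, k) (A i k / (if k == 0 then al else be))).
    have -> : \matrix_(i, k) (A i k / (if k == 0 then al else be)) =
        A *m diag_mx (\row_k (if k == 0 then al else be)^-1).
      by apply/matrixP => i k; rewrite mul_mx_diag !mxE.
    rewrite unitmx_mul uA unitmxE det_diag unitfE prodf_seq_neq0; apply/allP => k _.
    by rewrite mxE invr_eq0; case: ifP.
  move=> i q /yx[Wx _]; rewrite /field_in (smooth_jacobian sy Wx) (xiA _ _ (WB _ Wx)).
  rewrite mulmx_suml; apply: eq_bigr => k _; rewrite -scalemxAl mxE -scalerA; congr (_ *: _).
  apply/rowP => j; rewrite mxE [RHS]mxE sum4E !JE //.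
  by elim/ord2P : k; elim/ord4P : j; rewrite /entry !dzE /= !(mul0r, mulr0, mul1r, mulr1, add0r, addr0).
- split.
  + exact: smooth_sub Vt (smooth_mul oW2' (smooth_cst oW2' (sg * al ^+ 2)) sH).
  + move=> u /Vt Wu; have [WS TSu] := TS u Wu; exists (S u); first exact: WQ.
    by rewrite -TT1 TSu.
  + move=> u /Vt Wu t; have [WS TSu] := TS u Wu; have Qv := WQ _ WS.
    have tE : t = T1 (S u) by rewrite -TT1 TSu.
    have gXW v : W2 v -> forall i,
      partial i (fun u => Xf (T1 u)) v = X'f (T1 v) * partial i T1 v by move=> /WQ /gX.
    have [pb1 pb2] := pull_back_lap cc e0E shW (smooth_sub WQ sT1) (smooth_sub WQ sX)
      TT1 dT2 gXW WS.
    rewrite TSu in pb1 pb2.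
    rewrite !ddhh // /hh dhh // tE.
    apply: (@new_equation _ e0 sg Lam (E (S u)) (r (S u)) (h (S u)) (d2 c (S u)) (K (S u))
      (Af (T1 (S u))) (Xf (T1 (S u))) (X'f (T1 (S u))) (Hf (T1 (S u))) (H'f (T1 (S u)))
      (phif (T1 (S u))) al be w0 (kf (T1 (S u))) (lap e0 h (S u)) (dotp e0 r h (S u))
      (dotp e0 r r (S u)) (lap e0 T1 (S u)) (dotp e0 T1 T1 (S u))) => //.
    * exact: E0.
    * exact: r0.
    * exact: A0.
    * exact: X0.
    * exact: H0.
    * exact: N0.
    * exact: AN.
    * exact: rH.
    * exact: sK.
    * by rewrite -pb1 /dotp !dr //; move: (_ / _) => k; ring.
    * exact: drr.
    * exact: c2.
    * exact: lapT1.
    * exact: ric.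
- move=> q Wq' u t; have [Wx Txq] := tx q Wq'.
  have [Wxq _] := yx q Wq'; have Bx := WB _ Wxq; have Qx := tpart_ball Bx.
  have tE : t = T1 (tpart (x q)) by rewrite -TT1 Txq.
  apply: (metric_in_eq CC Wq'); apply/matrixP => i j; rewrite mxE gE //.
  have e := transform_metric i j e0E sgE (A0 Qx) (X0 Qx) (H0 Qx) al0 be0 (AN Qx) (rH Qx) (JE _ Wxq).
  apply: e => {}i {}j; rewrite soliton_metricE tE /hh Txq.
  suff -> : S u = tpart (x q) by [].
  by rewrite [RHS]tpart_row.
- move=> q Wq'; have [Wxq yxq] := yx q Wq'; have Bx := WB _ Wxq.
  have z1 : zpart q 0 0 = (zpart (x q) 0 0 + F (tpart (x q))) / al.
    by have := congr1 (@zpart R) yxq; rewrite zpart_row => <-; rewrite pair2E.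
  have [X0' X1'] := F4t Bx; have X2 := F4c _ Wxq; have X3 := Psic _ Wxq.
  rewrite /field_in (smooth_jacobian sy Wxq).
  have {}X3 : F4 (x q) 0 o3 = Psi p + w0 * al * zpart q 0 0.
    by rewrite -X3 /Psi z1; field.
  have sF4 k : (sg *: F4 (x q)) 0 k = sg * F4 (x q) 0 k by rewrite mxE.
  apply/rowP => j; rewrite mxE sum4E !JE // !sF4 X0' X1' X2 X3.
  rewrite ![soliton_field _ _ _ _ _ _]mxE ![(_ *: dz _) _ _]mxE.
  move: (zpart q 0 0) (Psi p) (F4 p 0 o2) => z v w.
  by elim/ord4P : j; rewrite /entry !dzE /=; field; rewrite ?al0 ?be0.
Unshelve. all: by end_near. Qed.

End LocalForm.

(** * The two canonical forms *)

Section SquareRoot.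
Context {R : realType}.
Variables (V : set 'rV[R]_2) (e0 s Lam : R) (E r K : 'rV[R]_2 -> R).
Hypotheses (openV : open V) (sr : smooth_on V r) (sE : s = 1 \/ s = -1)
  (rpos : forall u, V u -> 0 < s * r u)
  (drr : forall u, V u -> dotp e0 r r u = - 4 * r u ^+ 2 * E u * K u)
  (lapr : forall u, V u -> lap e0 r u = - 2 * Lam * E u * r u).

(** Here [s] is the constant sign of [r], so this is |r|^(1/2). *)
Definition root u := Num.sqrt (s * r u).

Lemma root_gt0 u : V u -> 0 < root u.
Proof. by move=> Vu; rewrite sqrtr_gt0 rpos. Qed.

Lemma root_sqr u : V u -> root u ^+ 2 = s * r u.
Proof. by move=> Vu; rewrite sqr_sqrtr // ltW // rpos. Qed.

Lemma root_r u : V u -> r u = s * root u ^+ 2.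
Proof. by move=> Vu; rewrite root_sqr //; case: sE => ->; ring. Qed.

Lemma root_grad u : V u -> has_grad root u (fun i => s * partial i r u / (2 * root u)).
Proof.
move=> Vu; have gr := has_gradE (smooth_differentiable sr Vu).
have gsr := has_gradM (has_grad_cst s u) gr.
apply: has_grad_eq (has_grad_comp1 (is_derive1_sqrt (rpos Vu)) gsr) _ => i.
by rewrite mul0r add0r mulrC.
Qed.

Lemma smooth_root : smooth_on V root.
Proof.
apply: (@smooth_ode _ _ _ openV _ (fun i f u => f u * (partial i r u / (2 * r u)))) => [u Vu|i].
  apply: has_grad_eq (root_grad Vu) _ => i; rewrite (root_r Vu).
  have w0 := lt0r_neq0 (root_gt0 Vu); move: (root u) (partial i r u) w0 => w ri w0.
  by case: sE => ->; field.
apply: gen_mul; first by apply: gen_base; left.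
apply: gen_base; right; have sri := smooth_partial i sr; smooth_auto => //.
move=> u Vu; rewrite mulf_neq0 ?pnatr_eq0 //; apply/negP => /eqP r0.
by have := rpos Vu; rewrite r0 mulr0 ltxx.
Qed.

Lemma partial_root i u : V u -> partial i r u = 2 * s * root u * partial i root u.
Proof.
move=> Vu; rewrite (root_grad Vu).2; have w0 := lt0r_neq0 (root_gt0 Vu).
by move: (root u) (partial i r u) w0 => w ri w0; case: sE => ->; field.
Qed.

Lemma root_dotp u : V u -> dotp e0 root root u = - root u ^+ 2 * E u * K u.
Proof.
move=> Vu; have := drr Vu; rewrite /dotp !(partial_root _ Vu) (root_r Vu).
have w0 := lt0r_neq0 (root_gt0 Vu).
move: (root u) (partial 0 root u) (partial 1 root u) (E u) (K u) w0 => w w1 w2 e k w0 eq.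
rewrite -[LHS](mulKf (_ : 4 * s ^+ 2 * w ^+ 2 != 0)); last first.
  by rewrite !mulf_neq0 ?expf_neq0 ?pnatr_eq0 //; case: sE => ->; rewrite ?oppr_eq0 oner_eq0.
rewrite (_ : 4 * s ^+ 2 * w ^+ 2 * (w1 * w1 + e0 * (w2 * w2)) =
  2 * s * w * w1 * (2 * s * w * w1) + e0 * (2 * s * w * w2 * (2 * s * w * w2))); last by ring.
by rewrite eq; case: sE => ->; field.
Qed.

(** With [r = s w^2] the Laplacian of [r] is [2 s] times |dw|^2 + w lap w, and [root_dotp] removes
    the first summand. *)
Lemma root_lap u : V u -> lap e0 root u = root u * E u * (K u - Lam).
Proof.
move=> Vu; have w0 := lt0r_neq0 (root_gt0 Vu).
have gw := has_gradE (smooth_differentiable smooth_root Vu).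
have dd i : partial i (partial i r) u =
    2 * s * (partial i root u * partial i root u + root u * partial i (partial i root) u).
  have n : \near u, 2 * s * root u * partial i root u = partial i r u.
    by apply: (open_near_eq openV Vu) => v Vv; rewrite partial_root.
  have gp := has_gradE (smooth_differentiable (smooth_partial i smooth_root) Vu).
  rewrite (has_grad_near n (has_gradM (has_gradM (has_grad_cst (2 * s) u) gw) gp)).2.
  by move: (root u) (partial i root u) (partial i (partial i root) u) => *; ring.
have := lapr Vu; have := root_dotp Vu; rewrite /lap /dotp !dd (root_r Vu).
move: (root u) (partial 0 root u) (partial 1 root u) (partial 0 (partial 0 root) u)
  (partial 1 (partial 1 root) u) (E u) (K u) w0 => w w1 w2 w11 w22 e k w0 e1 e2.
have s0 : 2 * s * w != 0.
  by rewrite !mulf_neq0 ?pnatr_eq0 //; case: sE => ->; rewrite ?oppr_eq0 oner_eq0.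
apply: (mulfI s0).
rewrite (_ : 2 * s * w * (w11 + e0 * w22) = 2 * s * (w1 * w1 + w * w11)
  + e0 * (2 * s * (w2 * w2 + w * w22)) - 2 * s * (w1 * w1 + e0 * (w2 * w2))); last by ring.
by rewrite e1 e2; ring.
Qed.

(** In terms of w the compatibility condition reads w dK = (Lam - 3 K) dw, and [3 w^2] is an
    integrating factor. *)
Lemma root_scaled_constant u : V u ->
  2 * r u * d1 K u = (Lam - 3 * K u) * d1 r u /\ 2 * r u * d2 K u = (Lam - 3 * K u) * d2 r u ->
  differentiable K u -> has_grad (fun v => (3 * K v - Lam) * root v ^+ 3) u (fun=> 0).
Proof.
move=> Vu kr dK; have w0 := lt0r_neq0 (root_gt0 Vu).
have gw := has_gradE (smooth_differentiable smooth_root Vu).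
have G := has_gradM (has_gradD (has_gradM (has_grad_cst 3 u) (has_gradE dK))
  (has_gradN (has_grad_cst Lam u))) (has_gradX 3 gw).
apply: has_grad_eq G _ => i.
have {kr} : 2 * r u * partial i K u = (Lam - 3 * K u) * partial i r u.
  by move: i; elim/ord2P; case: kr.
rewrite (partial_root _ Vu) (root_r Vu).
move: (root u) (partial i root u) (partial i K u) (K u) w0 => w wi ki k w0 eq.
have s0 : s != 0 by case: sE => ->; rewrite ?oppr_eq0 oner_eq0.
have -> : ki = (2 * (s * w ^+ 2) * ki) / (2 * s * w ^+ 2) by field; rewrite s0 w0.
by rewrite eq /=; field; rewrite s0 w0.
Qed.

End SquareRoot.

(** * Rescaling of the coefficient of dz1^2 *)

Section RescaledFunction.
Context {R : realType}.
Variables (V : set 'rV[R]_2) (h P P1 P2 Q Q1 Q2 : 'rV[R]_2 -> R).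
Hypotheses (openV : open V) (sh : smooth_on V h).
Hypotheses
  (gP : forall u, V u -> has_grad P u (fun i => if i == 0 then P1 u else 0))
  (gP1 : forall u, V u -> has_grad P1 u (fun i => if i == 0 then P2 u else 0))
  (gQ : forall u, V u -> has_grad Q u (fun i => if i == 0 then Q1 u else 0))
  (gQ1 : forall u, V u -> has_grad Q1 u (fun i => if i == 0 then Q2 u else 0)).
Let psi u := h u * P u + Q u.

(** In both types the function psi arises from the coefficient of dz1^2 by an affine change whose
    coefficients depend on t1 only; this computation serves both. *)
Lemma rescaled_derivatives u : V u ->
  [/\ d1 psi u = d1 h u * P u + h u * P1 u + Q1 u,
      d1 (d1 psi) u = d1 (d1 h) u * P u + 2 * d1 h u * P1 u + h u * P2 u + Q2 u &
      d2 (d2 psi) u = d2 (d2 h) u * P u].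
Proof.
have gpsi v : V v -> has_grad psi v (fun i => partial i h v * P v
    + h v * (if i == 0 then P1 v else 0) + (if i == 0 then Q1 v else 0)).
  move=> Vv; have gh := has_gradE (smooth_differentiable sh Vv).
  exact: (has_gradD (has_gradM gh (gP Vv)) (gQ Vv)).
move=> Vu; have gh := has_gradE (smooth_differentiable sh Vu).
have g1 := has_gradE (smooth_differentiable (smooth_partial 0 sh) Vu).
have g2 := has_gradE (smooth_differentiable (smooth_partial 1 sh) Vu).
split; first by rewrite (gpsi _ Vu).2.
  have n : \near u, d1 h u * P u + h u * P1 u + Q1 u = d1 psi u.
    by apply: (open_near_eq openV Vu) => v Vv; rewrite (gpsi _ Vv).2.
  have G := has_gradD (has_gradD (has_gradM g1 (gP Vu)) (has_gradM gh (gP1 Vu))) (gQ1 Vu).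
  rewrite (has_grad_near n G).2 /=.
  by move: (d1 (d1 h) u) (d1 h u) (h u) (P u) (P1 u) (P2 u) (Q2 u) => *; ring.
have n : \near u, d2 h u * P u = d2 psi u.
  by apply: (open_near_eq openV Vu) => v Vv; rewrite (gpsi _ Vv).2 /= mulr0 !addr0.
by rewrite (has_grad_near n (has_gradM g2 (gP Vu))).2 /= mulr0 addr0.
Qed.

End RescaledFunction.

Section Coordinate.
Context {R : realType}.

(** After the change of coordinates f_1^1 = 0 and f_1^2 = b. Since h22 = 0, completing the square
    then adds nothing to the dt1^2 coefficient. *)
Lemma soliton_orbit_metric (W : set 'rV[R]_(2 + 2)) g (A B b H h : 'rV[R]_2 -> R) :
  (forall u, (tpart @` W) u -> H u != 0) ->
  (forall q, W q -> let u := tpart q in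
    g q = soliton_metric (A u) (B u) (b u * H u) (h u) (H u)) ->
  orbit_metric W g (fun u => mx2 (A u) 0 0 (B u)).
Proof.
move=> H0 gE; exists (fun u => mx2 (h u) (H u) (H u) 0), (fun u => mx2 0 (b u) 0 0) => q Wq.
have Hn : H (tpart q) != 0 by apply: H0; exists q.
split; first by rewrite det_mx2 !mx2E /= mulr0 sub0r oppr_eq0 mulf_neq0.
rewrite gE //; apply/matrixP => i j; rewrite soliton_metricE /adapted_metric.
elim/ord4P : i; elim/ord4P : j; rewrite /entry /=.
all: rewrite ?block_mxEul ?block_mxEur ?block_mxEdl ?block_mxEdr.
all: rewrite ?mxE ?sum2E ?mxE ?sum2E ?mx2E ?mxE ?sum2E ?mx2E /=.
all: by ring.
Qed.

End Coordinate.

Section Monomials.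
Context {R : realType}.
Implicit Types (u : 'rV[R]_2) (V : set 'rV[R]_2).

Lemma has_grad_monomial b k u : has_grad (fun v : 'rV[R]_2 => b * v 0 0 ^+ k) u
  (fun i => if i == 0 then b * (k%:R * u 0 0 ^+ k.-1) else 0).
Proof.
apply: has_grad_eq (has_gradM (has_grad_cst b u) (has_gradX k (has_grad_coord u 0))) _ => i.
by case: (i == 0); rewrite ?mulr1 ?mulr0 ?mul0r ?add0r.
Qed.

Lemma has_grad_inv_monomial b k u : u 0 0 != 0 ->
  has_grad (fun v : 'rV[R]_2 => b * (v 0 0 ^+ k)^-1) u
  (fun i => if i == 0 then - k%:R * b * (u 0 0 ^+ k.+1)^-1 else 0).
Proof.
move=> t0; have tk : u 0 0 ^+ k != 0 by rewrite expf_neq0.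
apply: has_grad_eq (has_gradM (has_grad_cst b u)
  (has_gradV tk (has_gradX k (has_grad_coord u 0)))) _ => i.
case: (i == 0); rewrite ?mulr1 ?mulr0 ?mul0r ?add0r ?oppr0 ?mulr0 //.
case: k tk => [|k] tk; first by rewrite !(mulr0n, mul0r, oppr0, mulr0).
have xn : u 0 0 ^+ k != 0 by rewrite expf_neq0.
rewrite /= !exprS; move: (u 0 0) (u 0 0 ^+ k) t0 xn => t x t0 xn.
by field; rewrite t0 xn.
Qed.

End Monomials.

(** * Curvature and linear equation of type A *)

Section TypeA.
Context {R : realType}.
Variables (L e0 c1 : R) (V : set 'rV[R]_2).
Hypotheses (openV : open V) (L0 : L != 0) (c0 : c1 != 0) (e0E : e0 = 1 \/ e0 = -1).
Hypotheses (t0 : forall u, V u -> u 0 0 != 0)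
  (D0 : forall u, V u -> c1 ^+ 2 * u 0 0 ^+ 3 + 1 != 0).

Lemma orbitA_gauss_curvature : gauss_curvature V (orbitA L e0 c1) (curvatureA L c1).
Proof.
pose A (u : 'rV[R]_2) := - (3 * c1 ^+ 2 * u 0 0) / (L * (c1 ^+ 2 * u 0 0 ^+ 3 + 1)).
pose B (u : 'rV[R]_2) := e0 * (c1 ^+ 2 * u 0 0 ^+ 3 + 1) / u 0 0.
have e00 : e0 != 0 by case: e0E => ->; rewrite ?oppr_eq0 oner_eq0.
have sA : smooth_on V A.
  have st := smooth_coord openV 0; rewrite /A; smooth_auto => //.
  by move=> u Vu; rewrite mulf_neq0 ?D0.
have sB : smooth_on V B by have st := smooth_coord openV 0; rewrite /B; smooth_auto.
have gA u : V u -> has_grad A u (fun i => if i == 0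
    then - (3 * c1 ^+ 2 / L) * (1 - 2 * c1 ^+ 2 * u 0 0 ^+ 3) / (c1 ^+ 2 * u 0 0 ^+ 3 + 1) ^+ 2
    else 0).
  move=> Vu; have LD : L * (c1 ^+ 2 * u 0 0 ^+ 3 + 1) != 0 by rewrite mulf_neq0 ?D0.
  have gn := has_gradN (has_gradM (has_grad_cst (3 * c1 ^+ 2) u) (has_grad_coord u 0)).
  have gd := has_gradM (has_grad_cst L u)
    (has_gradD (has_grad_monomial (c1 ^+ 2) 3 u) (has_grad_cst 1 u)).
  apply: has_grad_eq (has_gradM gn (has_gradV LD gd)) _ => i; have := D0 Vu.
  move: (u 0 0) => t Dn; case: (i == 0) => /=; last by field; rewrite L0 Dn.
  by field; rewrite L0 Dn.
have gB u : V u -> has_grad B u (fun i => if i == 0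
    then e0 * c1 ^+ 2 * 2 * u 0 0 - e0 * (u 0 0 ^+ 2)^-1 else 0).
  move=> Vu; have := has_gradD (has_grad_monomial (e0 * c1 ^+ 2) 2 u)
    (has_grad_inv_monomial e0 1 (t0 Vu)).
  move=> G; apply: has_grad_eq (has_grad_near _ G) _ => [|i]; last first.
    by case: (i == 0) => /=; ring.
  by apply: (open_near_eq openV Vu) => v /t0 tn; rewrite /B; field.
have d11B u : V u -> d1 (d1 B) u = e0 * c1 ^+ 2 * 2 + 2 * e0 * (u 0 0 ^+ 3)^-1.
  move=> Vu; have := has_gradD (has_grad_monomial (e0 * c1 ^+ 2 * 2) 1 u)
    (has_grad_inv_monomial (- e0) 2 (t0 Vu)).
  move=> G; rewrite (has_grad_near _ G).2 /=; first by ring.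
  by apply: (open_near_eq openV Vu) => v Vv; rewrite (gB _ Vv).2 /=; ring.
move=> u Vu; have A0 v : V v -> A v != 0.
  by move=> Vv; rewrite /A mulf_neq0 ?oppr_eq0 ?invr_eq0 ?mulf_neq0 ?expf_neq0 ?D0 ?t0 ?pnatr_eq0.
have B0 v : V v -> B v != 0 by move=> Vv; rewrite /B !mulf_neq0 ?invr_eq0 ?D0 ?t0.
have d2A v : V v -> d2 A v = 0 by move=> Vv; rewrite (gA _ Vv).2.
have d2B v : V v -> d2 B v = 0 by move=> Vv; rewrite (gB _ Vv).2.
rewrite (diag_gauss_curvature openV sA sB A0 B0 d2A d2B Vu); congr (_ *: _).
rewrite /diag_curvature d11B // (gA _ Vu).2 (gB _ Vu).2 /= /A /B /curvatureA.
have := t0 Vu; have := D0 Vu; move: (u 0 0) => t Dn tn.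
by field; rewrite L0 e00 c0 Dn tn.
Qed.

(** Here h = t^2 psi + e0 / t. The summand e0 / t is a particular solution for the source
    [e0 H^2 phi^2 X^2 / A] created by the twist, so that only the source with [a2] survives in the
    equation for psi. *)
Lemma equationA_change a2 (h : 'rV[R]_2 -> R) u : smooth_on V h -> V u ->
  let t := u 0 0 in let A := - (3 * c1 ^+ 2 * t) / (L * (c1 ^+ 2 * t ^+ 3 + 1)) in
  d1 (d1 h) u + e0 * (- L / (3 * c1 ^+ 2) * A ^+ 2) * d2 (d2 h) u
  - ((1 - 2 * c1 ^+ 2 * t ^+ 3) / (t * (c1 ^+ 2 * t ^+ 3 + 1)) + 2 / t) * d1 h u
  - (4 * (L * (c1 ^+ 2 * t ^+ 3 + 1) / (3 * c1 ^+ 2 * t ^+ 3)) - 2 * L) * A * h u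
  = e0 * (- t ^+ 2) ^+ 2 * (3 / t ^+ 4) ^+ 2 * (- L / (3 * c1 ^+ 2) * A ^+ 2) / A
    + 2 * A * (- t ^+ 2) * a2 ->
  equationA L e0 1 c1 a2 (fun u => h u * (u 0 0 ^+ 2)^-1 + - e0 * (u 0 0 ^+ 3)^-1) u.
Proof.
move=> sh Vu t A pde.
have m b k v (Vv : V v) := has_grad_inv_monomial b k (t0 Vv).
have m1 k v : V v -> has_grad (fun v : 'rV[R]_2 => (v 0 0 ^+ k)^-1) v
    (fun i => if i == 0 then - k%:R * (v 0 0 ^+ k.+1)^-1 else 0).
  move=> Vv; have -> : (fun v : 'rV[R]_2 => (v 0 0 ^+ k)^-1) = fun v => 1 * (v 0 0 ^+ k)^-1.
    by apply/funext => w; rewrite mul1r.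
  by apply: has_grad_eq (m 1 k v Vv) _ => i; rewrite mulr1.
have [d1p d11p d22p] := rescaled_derivatives openV sh (m1 2%N) (m (- 2%:R) 3%N)
  (m (- e0) 3%N) (m (- 3%:R * - e0) 4%N) Vu.
rewrite /equationA d1p d11p d22p.
have := t0 Vu; have := D0 Vu; move: pde; rewrite /A /t => {t A d1p d11p d22p}.
move: (u 0 0) (d1 (d1 h) u) (d2 (d2 h) u) (d1 h u) (h u) => t h11 h22 h1 h0 pde Dn tn.
have C0 : c1 ^+ 2 != 0 by rewrite expf_neq0.
move: (c1 ^+ 2) C0 Dn pde => C C0 Dn /eqP; rewrite -subr_eq0 => /eqP pde.
apply/eqP; rewrite -subr_eq0 -[X in _ == X](mulr0 (t ^+ 2)^-1) -[in X in _ == X]pde.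
by apply/eqP; field; rewrite L0 C0 Dn tn.
Qed.

End TypeA.

(** * Curvature and linear equation of type B *)

Section TypeB.
Context {R : realType}.
Variables (L e0 : R) (V : set 'rV[R]_2).
Hypotheses (openV : open V) (L0 : L != 0) (e0E : e0 = 1 \/ e0 = -1).
Hypotheses (t0 : forall u, V u -> u 0 0 != 0).

Lemma orbitB_mx2 : orbitB L e0 =
  (fun u => mx2 (- 3 / (L * u 0 0 ^+ 2)) 0 0 (- 3 / (L * u 0 0 ^+ 2) * e0)).
Proof.
apply/funext => u; apply/matrixP; elim/ord2P; elim/ord2P; rewrite /orbitB !mxE /=.
all: by rewrite ?mulr1 ?mulr0.
Qed.

Lemma orbitB_gauss_curvature : gauss_curvature V (orbitB L e0) (fun=> L / 3).
Proof.
pose A (u : 'rV[R]_2) := - 3 / (L * u 0 0 ^+ 2).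
pose B (u : 'rV[R]_2) := - 3 / (L * u 0 0 ^+ 2) * e0.
have e00 : e0 != 0 by case: e0E => ->; rewrite ?oppr_eq0 oner_eq0.
have st := smooth_coord openV 0.
have Lt v : V v -> L * v 0 0 ^+ 2 != 0 by move=> Vv; rewrite mulf_neq0 ?expf_neq0 ?t0.
have sA : smooth_on V A by rewrite /A; smooth_auto.
have sB : smooth_on V B by rewrite /B; smooth_auto.
have g b (f : 'rV[R]_2 -> R) k u : V u -> (forall v, V v -> f v = b * (v 0 0 ^+ k)^-1) ->
    has_grad f u (fun i => if i == 0 then - k%:R * b * (u 0 0 ^+ k.+1)^-1 else 0).
  move=> Vu fE; apply: has_grad_near (has_grad_inv_monomial b k (t0 Vu)).
  by apply: (open_near_eq openV Vu) => v Vv; rewrite fE.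
have gA u (Vu : V u) : has_grad A u (fun i => if i == 0 then - 2%:R * (- 3 / L) * (u 0 0 ^+ 3)^-1 else 0).
  by apply: (g (- 3 / L) A 2%N) => // v /t0 tn; rewrite /A; field; rewrite L0 tn.
have gB u (Vu : V u) : has_grad B u (fun i => if i == 0 then - 2%:R * (- 3 * e0 / L) * (u 0 0 ^+ 3)^-1 else 0).
  by apply: (g (- 3 * e0 / L) B 2%N) => // v /t0 tn; rewrite /B; field; rewrite L0 tn.
have d11B u : V u -> d1 (d1 B) u = - 3%:R * (- 2%:R * (- 3 * e0 / L)) * (u 0 0 ^+ 4)^-1.
  move=> Vu; rewrite (g (- 2%:R * (- 3 * e0 / L)) (d1 B) 3%N u Vu _).2 // => v Vv.
  by rewrite (gB _ Vv).2.
rewrite orbitB_mx2 => u Vu.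
have A0 v : V v -> A v != 0.
  by move=> Vv; rewrite /A mulf_neq0 ?oppr_eq0 ?invr_eq0 ?Lt ?pnatr_eq0.
have B0 v : V v -> B v != 0 by move=> Vv; rewrite /B mulf_neq0 // A0.
have d2A v : V v -> d2 A v = 0 by move=> Vv; rewrite (gA _ Vv).2.
have d2B v : V v -> d2 B v = 0 by move=> Vv; rewrite (gB _ Vv).2.
rewrite (diag_gauss_curvature openV sA sB A0 B0 d2A d2B Vu); congr (_ *: _).
rewrite /diag_curvature d11B // (gA _ Vu).2 (gB _ Vu).2 /= /A /B.
by have := t0 Vu; move: (u 0 0) => t tn; field; rewrite L0 e00 tn.
Qed.

(** Here psi = 4 t^2 h, and the twist source [e0 / A] is kept: it becomes the term in t^4. The
    summand 0 only matches the form treated by [rescaled_derivatives]. *)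
Lemma equationB_change a2 (h : 'rV[R]_2 -> R) u : smooth_on V h -> V u ->
  let t := u 0 0 in let A := - 3 / (L * t ^+ 2) in
  d1 (d1 h) u + e0 * d2 (d2 h) u + 2 / t * d1 h u - (4 * (L / 3) - 2 * L) * A * h u
  = e0 / A + 2 * A * (2 * t ^+ 2)^-1 * a2 ->
  equationB L e0 a2 (fun u => h u * (4 * u 0 0 ^+ 2) + 0) u.
Proof.
move=> sh Vu t A pde.
have m b k v (Vv : V v) := has_grad_monomial b k v.
have m1 v (Vv : V v) : has_grad (fun v : 'rV[R]_2 => 4 * (2%:R * v 0 0 ^+ 1)) v
    (fun i => if i == 0 then 8 * (1%:R * v 0 0 ^+ 0) else 0).
  apply: has_grad_eq (has_gradM (has_grad_cst 4 v) (has_grad_monomial 2 1 v)) _ => i.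
  by case: (i == 0) => /=; ring.
have z v (Vv : V v) : has_grad (fun _ : 'rV[R]_2 => 0) v (fun i => if i == 0 then 0 else 0).
  by apply: has_grad_eq (has_grad_cst 0 v) _ => i; case: (i == 0).
have [d1p d11p d22p] := rescaled_derivatives openV sh (m 4 2%N) m1 z z Vu.
rewrite /equationB d1p d11p d22p.
have := t0 Vu; move: pde; rewrite /A /t => {t A d1p d11p d22p} /=.
move: (u 0 0) (d1 (d1 h) u) (d2 (d2 h) u) (d1 h u) (h u) => t h11 h22 h1 h0 pde tn.
move: pde => /eqP; rewrite -subr_eq0 => /eqP pde.
apply/eqP; rewrite -subr_eq0 -[X in _ == X](mulr0 (4 * t ^+ 2)) -[in X in _ == X]pde.
by apply/eqP; field; rewrite L0 tn.
Qed.

End TypeB.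

Section CanonicalForms.
Context {R : realType}.
Local Notation pt := 'rV[R]_(2 + 2).
Variables (g : pt -> 'M[R]_(2 + 2)) (xi : 'I_2 -> pt -> pt) (F4 : pt -> pt)
  (Lam e0 sg s w0 k d : R) (p : pt) (E r h a c K : 'rV[R]_2 -> R).
Let Q := ball (tpart p) d.
Let w := root s r.
Hypotheses (d0 : 0 < d) (e0E : e0 = 1 \/ e0 = -1) (sgE : sg = 1 \/ sg = -1)
  (sE : s = 1 \/ s = -1) (sgL : sg * Lam < 0) (k0 : k != 0).
Hypotheses (sh : smooth_on Q h) (sa : smooth_on Q a) (sc : smooth_on Q c)
  (sr : smooth_on Q r).
Hypotheses (E0 : forall u, Q u -> E u != 0) (rpos : forall u, Q u -> 0 < s * r u)
  (K0 : forall u, Q u -> K u != 0)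
  (d2a : forall u, Q u -> d2 a u = 0)
  (drr : forall u, Q u -> dotp e0 r r u = - 4 * r u ^+ 2 * E u * K u)
  (lapr : forall u, Q u -> lap e0 r u = - 2 * Lam * E u * r u)
  (twist : forall u, Q u -> r u ^+ 2 * d2 c u = k * E u)
  (ric : forall u, Q u -> ric_zz11 e0 E c h r u = Lam * h u - r u * w0).
Hypotheses
  (gE : forall x, ball p d x -> forall i j, g x i j = entry (g_tab e0 E a c h r (tpart x)) i j)
  (xiE : exists2 A : 'M[R]_2, A \in unitmx &
    forall i x, ball p d x -> xi i x = \sum_k A i k *: dz k)
  (F4t : forall x, ball p d x -> F4 x 0 o0 = 0 /\ F4 x 0 o1 = 0)
  (F4z : forall x, ball p d x -> has_grad (fun y => F4 y 0 o2) x (fun=> 0) /\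
    has_grad (fun y => F4 y 0 o3) x (fun i => nth 0 [:: a (tpart x); 0; 1; 0] i * w0)).

Let oQ : open Q. Proof. exact: ball_open. Qed.
Let L := sg * Lam.
Let L0 : L != 0. Proof. by rewrite lt_eqF. Qed.
Let s0 : s != 0. Proof. by case: sE => ->; rewrite ?oppr_eq0 oner_eq0. Qed.
Let sg0 : sg != 0. Proof. by case: sgE => ->; rewrite ?oppr_eq0 oner_eq0. Qed.
Let wn u : Q u -> w u != 0.
Proof. by move=> Qu; rewrite gt_eqF // (root_gt0 rpos Qu). Qed.

(** The sign [sg] makes [L = sg * Lam] negative; the two values of [sg] correspond to the two
    alternatives of the theorem. *)
Definition reducible (type : set pt -> (pt -> 'M[R]_(2 + 2)) -> (pt -> pt) -> R -> R -> Prop) :=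
  exists (W W' : set pt) (y x : pt -> pt),
    [/\ coordinate_change W W' y x, W p, W `<=` ball p d,
        adapted W' (fun i => field_in y x (xi i)) &
        type W' (metric_in x (fun x => sg *: g x)) (field_in y x (fun x => sg *: F4 x)) L e0].

Lemma reducible_typeA (m0 : R) : m0 != 0 ->
  (forall u, Q u -> (3 * K u - Lam) * w u ^+ 3 = m0) -> reducible typeA.
Proof.
move=> mn mE.
have Lam0 : Lam != 0 by move: L0; rewrite mulf_eq0 negb_or => /andP[].
(* With [T1 = io * w], the constant [m0] gives (3 K - Lam) T1^3 = io m0. Requiring this to be Lam /
   c1^2 forces c1^2 = io Lam / m0, and [io] is chosen to make it positive. *)
have [io ioE ioL] : exists2 io : R, io = 1 \/ io = -1 & 0 < io * (Lam / m0).
  have : Lam / m0 != 0 by rewrite mulf_neq0 ?invr_eq0.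
  rewrite neq_lt => /orP[n|n]; last by exists 1; [left|rewrite mul1r].
  by exists (-1); [right|rewrite mulN1r oppr_gt0].
pose c1 := Num.sqrt (io * (Lam / m0)).
have c1E : c1 ^+ 2 = io * (Lam / m0) by rewrite sqr_sqrtr // ltW.
have c0 : c1 != 0 by rewrite gt_eqF // sqrtr_gt0.
have C0 : c1 ^+ 2 != 0 by rewrite expf_neq0.
(* [nu] normalises T2: with [Xf = nu Af] the coefficient [e0 A / X^2] of dt2^2 becomes
   [e0 (c1^2 t^3 + 1) / t]. The radicand is positive because [L < 0]. *)
pose nu := Num.sqrt (- L / (3 * c1 ^+ 2)).
have nupos : 0 < - L / (3 * c1 ^+ 2).
  by rewrite divr_gt0 ?oppr_gt0 // mulr_gt0 ?ltr0n // lt_neqAle eq_sym C0 sqr_ge0.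
have nuE : nu ^+ 2 = - L / (3 * c1 ^+ 2) by rewrite sqr_sqrtr // ltW.
have nu0 : nu != 0 by rewrite gt_eqF // sqrtr_gt0.
pose T1 u := io * w u.
have sw : smooth_on Q w by exact: (smooth_root oQ sr sE rpos).
have sT1 : smooth_on Q T1 by apply: smooth_mul => //; exact: smooth_cst.
have io0 : io != 0 by case: ioE => ->; rewrite ?oppr_eq0 oner_eq0.
have io2 : io ^+ 2 = 1 by case: ioE => ->; ring.
have Tn u : Q u -> T1 u != 0 by move=> Qu; rewrite mulf_neq0 // wn.
have T2 u : Q u -> r u = s * T1 u ^+ 2.
  by move=> Qu; rewrite (root_r sE rpos Qu) /T1 exprMn io2 mul1r.
have gT u : Q u -> has_grad T1 u (fun i => partial i T1 u).
  by move=> Qu; exact: has_gradE (smooth_differentiable sT1 Qu).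
have dT i u : Q u -> partial i T1 u = io * partial i w u.
  move=> Qu; have gw := has_gradE (smooth_differentiable sw Qu).
  by rewrite (has_gradM (has_grad_cst io u) gw).2 mul0r add0r.
have ddT i u : Q u -> partial i (partial i T1) u = io * partial i (partial i w) u.
  move=> Qu; have gw := has_gradE (smooth_differentiable (smooth_partial i sw) Qu).
  have n : \near u, io * partial i w u = partial i T1 u.
    by apply: (open_near_eq oQ Qu) => v Qv; rewrite dT.
  by rewrite (has_grad_near n (has_gradM (has_grad_cst io u) gw)).2 mul0r add0r.
have NT u : Q u -> dotp e0 T1 T1 u = - T1 u ^+ 2 * E u * K u.
  move=> Qu; have := root_dotp sr sE rpos drr Qu; rewrite /dotp !dT // /T1 -/w.
  move: (d1 w u) (d2 w u) (w u) (E u) (K u) => w1 w2 w' E' K' eq.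
  have -> : io * w1 * (io * w1) + e0 * (io * w2 * (io * w2)) =
    io ^+ 2 * (w1 * w1 + e0 * (w2 * w2)) by ring.
  by rewrite eq; ring.
have lapT u : Q u -> lap e0 T1 u = T1 u * E u * (K u - Lam).
  move=> Qu; have := root_lap oQ sr sE rpos drr lapr Qu; rewrite /lap !ddT // /T1 -/w.
  move: (d1 (d1 w) u) (d2 (d2 w) u) (w u) (E u) (K u) => w11 w22 w' E' K' eq.
  by rewrite mulrCA -mulrDr eq; ring.
(* [(3 K - Lam) w ^ 3] is constant: this is where [c1] comes from. *)
have key u : Q u -> 3 * K u * c1 ^+ 2 * T1 u ^+ 3 = Lam * (c1 ^+ 2 * T1 u ^+ 3 + 1).
  move=> Qu; have := mE u Qu; rewrite c1E /T1.
  move: (K u) (w u) => K' w' eq.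
  have -> : io * (Lam / m0) * (io * w') ^+ 3 = io ^+ 2 ^+ 2 * (Lam / m0 * w' ^+ 3) by ring.
  have -> : 3 * K' * (io * (Lam / m0)) * (io * w') ^+ 3 =
    io ^+ 2 ^+ 2 * (Lam / m0 * ((3 * K' - Lam) * w' ^+ 3) + Lam * (Lam / m0 * w' ^+ 3)).
    by ring.
  by rewrite io2 !expr1n !mul1r eq divfK // mulrDr mulr1 addrC.
(* A zero here would be a zero of [K], hence a point where [dr] is null. *)
have D0 u : Q u -> c1 ^+ 2 * T1 u ^+ 3 + 1 != 0.
  move=> Qu; apply/negP => /eqP z; have := key u Qu; rewrite z mulr0 => /eqP; apply/negP.
  by rewrite mulf_neq0 ?expf_neq0 ?Tn // !mulf_neq0 ?pnatr_eq0 ?K0.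
have KE u : Q u -> K u = Lam * (c1 ^+ 2 * T1 u ^+ 3 + 1) / (3 * c1 ^+ 2 * T1 u ^+ 3).
  move=> Qu; rewrite -key //; have := Tn u Qu.
  by move: (K u) (T1 u) => K' t tn; field; rewrite c0 tn.
(* [be] is forced by the twist equation and [al] by [sg al be r = - T1^2]. The sign of the twist
   constant [k] goes into [be], which is why eps can be taken to be 1. *)
pose be := k * sg / (3 * nu); pose al := - (sg * s) / be.
have be0 : be != 0.
  by apply: mulf_neq0; [exact: mulf_neq0|rewrite invr_eq0 mulf_neq0 ?pnatr_eq0].
have al0 : al != 0.
  by apply: mulf_neq0; [rewrite oppr_eq0 mulf_neq0|rewrite invr_eq0].
have ab : sg * al * be = - s.
  rewrite -mulrA divfK //; by case: sgE => ->; ring.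
(* [Af] is solved from [Af |dT1|^2 = sg E]. Closedness of the form for T2 requires the logarithmic
   derivative of [Xf] to be (K - Lam) / (K t), which is that of [Af]; hence the two are
   proportional. *)
pose Af t := - (3 * c1 ^+ 2 * t) / (L * (c1 ^+ 2 * t ^+ 3 + 1)).
pose Xf t := nu * Af t.
pose X'f t := - (nu * (3 * c1 ^+ 2) / L) * (1 - 2 * c1 ^+ 2 * t ^+ 3)
  / (c1 ^+ 2 * t ^+ 3 + 1) ^+ 2.
pose Hf (t : R) := - t ^+ 2; pose H'f (t : R) := - (2 * t).
pose phif (t : R) := 3 / t ^+ 4; pose phi'f (t : R) := - 12 / t ^+ 5.
pose kf t := L * (c1 ^+ 2 * t ^+ 3 + 1) / (3 * c1 ^+ 2 * t ^+ 3).
have LD u : Q u -> L * (c1 ^+ 2 * T1 u ^+ 3 + 1) != 0 by move=> Qu; rewrite mulf_neq0 ?D0.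
have A0 u : Q u -> Af (T1 u) != 0.
  move=> Qu; apply: mulf_neq0; last by rewrite invr_eq0 LD.
  by rewrite oppr_eq0; apply: mulf_neq0; [rewrite mulf_neq0 ?pnatr_eq0|exact: Tn].
have X0 u : Q u -> Xf (T1 u) != 0 by move=> Qu; rewrite mulf_neq0 // A0.
have H0 u : Q u -> Hf (T1 u) != 0 by move=> Qu; rewrite oppr_eq0 expf_neq0 // Tn.
have t4 u : Q u -> T1 u ^+ 4 != 0 by move=> Qu; rewrite expf_neq0 // Tn.
have sX : smooth_on Q (fun u => Xf (T1 u)) by rewrite /Xf /Af; smooth_auto.
have sphi : smooth_on Q (fun u => phif (T1 u)) by rewrite /phif; smooth_auto.
have r0 u : Q u -> r u != 0 by move=> Qu; rewrite T2 // mulf_neq0 // expf_neq0 // Tn.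
have AN u : Q u -> Af (T1 u) * dotp e0 T1 T1 u = sg * E u.
  move=> Qu; rewrite NT // KE // /Af /L; have := D0 u Qu; have := Tn u Qu.
  move: (T1 u) (E u) => t E' tn Dn.
  by case: sgE => ->; field; rewrite Lam0 c0 Dn tn.
have rH u : Q u -> sg * al * be * r u = Hf (T1 u).
  by move=> Qu; rewrite ab T2 // /Hf; move: (T1 u) => t; case: sE => ->; ring.
have dr u : Q u -> forall i, partial i r u = H'f (T1 u) / (sg * al * be) * partial i T1 u.
  move=> Qu i; rewrite ab; have n : \near u, s * T1 u ^+ 2 = r u.
    by apply: (open_near_eq oQ Qu) => v Qv; rewrite T2.
  rewrite (has_grad_near n (has_gradM (has_grad_cst s u) (has_gradX 2 (gT u Qu)))).2 /H'f /=.
  by move: (T1 u) (partial i T1 u) => t ti; case: sE => ->; field.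
have sK u : Q u -> sg * K u = kf (T1 u).
  by move=> Qu; rewrite KE // /kf /L !mulrA.
have gX u : Q u -> forall i,
    partial i (fun u => Xf (T1 u)) u = X'f (T1 u) * partial i T1 u.
  move=> Qu i; have gd := has_gradM (has_grad_cst L u) (has_gradD (has_gradM
    (has_grad_cst (c1 ^+ 2) u) (has_gradX 3 (gT u Qu))) (has_grad_cst 1 u)).
  have gn := has_gradN (has_gradM (has_grad_cst (3 * c1 ^+ 2) u) (gT u Qu)).
  have G := has_gradM (has_grad_cst nu u) (has_gradM gn (has_gradV (LD u Qu) gd)).
  rewrite [LHS](G.2 i) /= /X'f; have := D0 u Qu.
  move: (T1 u) (partial i T1 u) => t ti Dn.
  by field; rewrite L0 Dn.
have gphi u : Q u -> forall i,
    partial i (fun u => phif (T1 u)) u = phi'f (T1 u) * partial i T1 u.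
  move=> Qu i; have G := has_gradM (has_grad_cst 3 u) (has_gradV (t4 u Qu) (has_gradX 4 (gT u Qu))).
  rewrite [LHS](G.2 i) /= /phi'f; have := Tn u Qu.
  by move: (T1 u) (partial i T1 u) => t ti tn; field; rewrite tn.
have lapT1 u : Q u -> Xf (T1 u) * lap e0 T1 u = - X'f (T1 u) * dotp e0 T1 T1 u.
  move=> Qu; rewrite NT // lapT // KE // /Xf /X'f /Af; have := D0 u Qu; have := Tn u Qu.
  by move: (T1 u) (E u) => t E' tn Dn; field; rewrite L0 c0 Dn tn.
have c2 u : Q u -> d2 c u = be * phif (T1 u) * Xf (T1 u) * dotp e0 T1 T1 u.
  move=> Qu; rewrite /Xf -[_ * dotp _ _ _ _]mulrA -(mulrA nu) AN // /be /phif; have := twist Qu; rewrite T2 //.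
  have := Tn u Qu; move: (T1 u) (E u) (d2 c u) => t E' c' tn.
  move=> eq; apply: (mulfI (_ : s ^+ 2 * t ^+ 4 != 0)); first by rewrite mulf_neq0 ?expf_neq0.
  rewrite [LHS](_ : _ = (s * t ^+ 2) ^+ 2 * c'); last by ring.
  by rewrite eq; case: sE => ->; case: sgE => ->; field; rewrite nu0 tn.
have [W [W' [y [x [a1 [a3 [hh [[cc Wp WQ ad] [shh VT pde] mE' fE]]]]]]]] :=
  local_form d0 e0E sgE al0 be0 sh sa sc sT1 sX sphi E0 r0 A0 X0 H0 d2a AN rH dr sK drr
    gX gphi lapT1 c2 ric gE xiE F4t F4z.
exists W, W', y, x; split=> //.
have oV : open (tpart @` W') by apply: open_tpart; case: cc => -[].
have t0 u : (tpart @` W') u -> u 0 0 != 0 by move=> /VT[v Qv <-]; exact: Tn.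
have Dn u : (tpart @` W') u -> c1 ^+ 2 * u 0 0 ^+ 3 + 1 != 0.
  by move=> /VT[v Qv <-]; exact: D0.
pose psi u := hh u * (u 0 0 ^+ 2)^-1 + - e0 * (u 0 0 ^+ 3)^-1.
exists 1, c1, a1, (sg * w0 * al / be), a3, psi; split.
  split=> //; first by left.
    have st := smooth_coord oV 0; rewrite /psi; smooth_auto => //.
      by move=> u /t0 tn; rewrite expf_neq0.
    by move=> u /t0 tn; rewrite expf_neq0.
  move=> u Vu; split; [exact: t0|exact: Dn|].
  apply: (equationA_change oV L0 c0 t0 Dn shh Vu).
  have := pde u Vu; have := t0 u Vu; have := Dn u Vu; move: (u 0 0) => t Dt tn /=.
  rewrite /Xf exprMn nuE /kf /phif /Hf /H'f /X'f -/L.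
  have -> : - (nu * (3 * c1 ^+ 2) / L) * (1 - 2 * c1 ^+ 2 * t ^+ 3)
      / (c1 ^+ 2 * t ^+ 3 + 1) ^+ 2 / (nu * Af t) + - (2 * t) / - t ^+ 2
    = (1 - 2 * c1 ^+ 2 * t ^+ 3) / (t * (c1 ^+ 2 * t ^+ 3 + 1)) + 2 / t.
    by rewrite /Af; field; rewrite nu0 L0 c0 Dt tn.
  by [].
have BE u : (tpart @` W') u ->
    e0 * Af (u 0 0) / Xf (u 0 0) ^+ 2 = e0 * (c1 ^+ 2 * u 0 0 ^+ 3 + 1) / u 0 0.
  move=> Vu; have := t0 _ Vu; have := Dn _ Vu; rewrite /Xf exprMn nuE.
  by move: (u 0 0) => t Dt tn; rewrite /Af; field; rewrite L0 Dt tn c0.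
have Vq q : W' q -> (tpart @` W') (tpart q) by exists q.
split.
- move=> q Wq; rewrite mE' // /metricA (BE _ (Vq q Wq)).
  have := t0 _ (Vq q Wq); rewrite /psi.
  move: (hh (tpart q)) (tpart q 0 0) (tpart q 0 1) => h' t t2 tn.
  by congr soliton_metric; [rewrite /phif /Hf; field|field].
- exact: fE.
- apply: (@soliton_orbit_metric _ W' _ (fun u => Af (u 0 0))
    (fun u => e0 * (c1 ^+ 2 * u 0 0 ^+ 3 + 1) / u 0 0) (fun u => phif (u 0 0) * u 0 1)
    (fun u => Hf (u 0 0)) hh) => [u /t0 tn|q Wq u].
    by rewrite oppr_eq0 expf_neq0.
  by rewrite mE' // (BE _ (Vq q Wq)).
- exact: orbitA_gauss_curvature.
Qed.

Lemma reducible_typeB : (forall u, Q u -> 3 * K u = Lam) -> reducible typeB.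
Proof.
move=> K3; have Lam0 : Lam != 0 by move: L0; rewrite mulf_eq0 negb_or => /andP[].
have KE u : Q u -> K u = Lam / 3 by move=> Qu; rewrite -(K3 u Qu) mulrC mulKf ?pnatr_eq0.
pose T1 u := (w u)^-1.
have sw : smooth_on Q w by exact: (smooth_root oQ sr sE rpos).
have sT1 : smooth_on Q T1 by apply: smooth_inv.
have Tn u : Q u -> T1 u != 0 by move=> Qu; rewrite invr_eq0 wn.
have T2 u : Q u -> r u = s / T1 u ^+ 2.
  by move=> Qu; rewrite (root_r sE rpos Qu) /T1 exprVn invrK.
have gT u : Q u -> has_grad T1 u (fun i => partial i T1 u).
  by move=> Qu; exact: has_gradE (smooth_differentiable sT1 Qu).
have gw u : Q u -> has_grad w u (fun i => partial i w u).
  by move=> Qu; exact: has_gradE (smooth_differentiable sw Qu).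
have dT i u : Q u -> partial i T1 u = - (partial i w u / w u ^+ 2).
  by move=> Qu; rewrite (has_gradV (wn Qu) (gw u Qu)).2.
have ddT i u : Q u -> partial i (partial i T1) u =
    - (partial i (partial i w) u / w u ^+ 2) + 2 * partial i w u ^+ 2 / w u ^+ 3.
  move=> Qu; have gi := has_gradE (smooth_differentiable (smooth_partial i sw) Qu).
  have n : \near u, - (partial i w u * (w u ^+ 2)^-1) = partial i T1 u.
    by apply: (open_near_eq oQ Qu) => v Qv; rewrite dT.
  have w2 : w u ^+ 2 != 0 by rewrite expf_neq0 // wn.
  rewrite (has_grad_near n (has_gradN (has_gradM gi (has_gradV w2 (has_gradX 2 (gw u Qu)))))).2.
  have := wn Qu; move: (w u) (partial i w u) (partial i (partial i w) u) => w' wi wii wz /=.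
  by field; rewrite wz.
have NT u : Q u -> dotp e0 T1 T1 u = - T1 u ^+ 2 * E u * K u.
  move=> Qu; have := root_dotp sr sE rpos drr Qu; rewrite /dotp !dT // /T1 -/w.
  have := wn Qu; move: (d1 w u) (d2 w u) (w u) (E u) (K u) => w1 w2 w' E' K' wz eq.
  have -> : - (w1 / w' ^+ 2) * - (w1 / w' ^+ 2) + e0 * (- (w2 / w' ^+ 2) * - (w2 / w' ^+ 2)) =
    (w1 * w1 + e0 * (w2 * w2)) / w' ^+ 4 by field; rewrite wz.
  by rewrite eq; field; rewrite wz.
(* When 3 K = Lam the function 1 / w is harmonic: the weight [Xf] can be 1, and the new coordinates
   of the orbit space are isothermal. *)
have lapT u : Q u -> lap e0 T1 u = 0.
  move=> Qu; have := root_lap oQ sr sE rpos drr lapr Qu.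
  have := root_dotp sr sE rpos drr Qu; rewrite /lap /dotp !ddT // -/w KE //.
  have := wn Qu; move: (d1 (d1 w) u) (d2 (d2 w) u) (d1 w u) (d2 w u) (w u) (E u).
  move=> w11 w22 w1 w2 w' E' wz e1 e2.
  rewrite [LHS](_ : _ = - ((w11 + e0 * w22) / w' ^+ 2)
    + 2 * (w1 * w1 + e0 * (w2 * w2)) / w' ^+ 3); last by field; rewrite wz.
  by rewrite e1 e2; field; rewrite wz.
(* Again [be] comes from the twist equation and [al] from the normalisation
   [sg al be r = 1 / (2 T1^2)]; below, [phif Hf = 1] makes the dt1 dz1 entry equal to t2. *)
pose be := - (3 * k * sg) / (2 * L); pose al := sg * s / (2 * be).
have be0 : be != 0.
  apply: mulf_neq0; last by rewrite invr_eq0 mulf_neq0 ?pnatr_eq0.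
  by rewrite oppr_eq0; apply: mulf_neq0; [rewrite mulf_neq0 ?pnatr_eq0|].
have al0 : al != 0.
  by apply: mulf_neq0; [rewrite mulf_neq0|rewrite invr_eq0 mulf_neq0 ?pnatr_eq0].
have ab : sg * al * be = s / 2.
  rewrite /al; move: (be) be0 => b bn; case: sgE => ->; field; exact: bn.
pose Af t := - 3 / (L * t ^+ 2).
pose Xf (t : R) : R := 1. pose X'f (t : R) : R := 0.
pose Hf (t : R) := (2 * t ^+ 2)^-1; pose H'f (t : R) := - (t ^+ 3)^-1.
pose phif (t : R) := 2 * t ^+ 2; pose phi'f (t : R) := 4 * t.
pose kf (t : R) := L / 3.
have A0 u : Q u -> Af (T1 u) != 0.
  move=> Qu; apply: mulf_neq0; first by rewrite oppr_eq0 pnatr_eq0.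
  by rewrite invr_eq0 mulf_neq0 // expf_neq0 // Tn.
have X0 u : Q u -> Xf (T1 u) != 0 by move=> _; exact: oner_neq0.
have H0 u : Q u -> Hf (T1 u) != 0.
  by move=> Qu; rewrite invr_eq0 mulf_neq0 ?pnatr_eq0 // expf_neq0 // Tn.
have sX : smooth_on Q (fun u => Xf (T1 u)) by exact: smooth_cst.
have sphi : smooth_on Q (fun u => phif (T1 u)) by rewrite /phif; smooth_auto.
have r0 u : Q u -> r u != 0.
  by move=> Qu; rewrite T2 //; apply: mulf_neq0; rewrite ?invr_eq0 ?expf_neq0 ?Tn.
have AN u : Q u -> Af (T1 u) * dotp e0 T1 T1 u = sg * E u.
  move=> Qu; rewrite NT // KE // /Af /L; have := Tn u Qu.
  move: (T1 u) (E u) => t E' tn.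
  by case: sgE => ->; field; rewrite Lam0 tn.
have rH u : Q u -> sg * al * be * r u = Hf (T1 u).
  move=> Qu; rewrite ab T2 // /Hf; have := Tn u Qu; move: (T1 u) => t tn.
  by case: sE => ->; field; rewrite tn.
have t2 u : Q u -> T1 u ^+ 2 != 0 by move=> Qu; rewrite expf_neq0 // Tn.
have dr u : Q u -> forall i, partial i r u = H'f (T1 u) / (sg * al * be) * partial i T1 u.
  move=> Qu i; rewrite ab; have n : \near u, s * (T1 u ^+ 2)^-1 = r u.
    by apply: (open_near_eq oQ Qu) => v Qv; rewrite T2.
  rewrite (has_grad_near n (has_gradM (has_grad_cst s u)
    (has_gradV (t2 u Qu) (has_gradX 2 (gT u Qu))))).2 /H'f /=.
  have := Tn u Qu; move: (T1 u) (partial i T1 u) => t ti tn.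
  by case: sE => ->; field; rewrite tn.
have sK u : Q u -> sg * K u = kf (T1 u) by move=> Qu; rewrite KE // /kf /L mulrA.
have gX u : Q u -> forall i,
    partial i (fun u => Xf (T1 u)) u = X'f (T1 u) * partial i T1 u.
  by move=> Qu i; rewrite mul0r; exact: (has_grad_cst 1 u).2.
have gphi u : Q u -> forall i,
    partial i (fun u => phif (T1 u)) u = phi'f (T1 u) * partial i T1 u.
  move=> Qu i; have G := has_gradM (has_grad_cst 2 u) (has_gradX 2 (gT u Qu)).
  by rewrite [LHS](G.2 i) /= /phi'f; move: (T1 u) (partial i T1 u) => t ti; ring.
have lapT1 u : Q u -> Xf (T1 u) * lap e0 T1 u = - X'f (T1 u) * dotp e0 T1 T1 u.
  by move=> Qu; rewrite lapT // /X'f oppr0 mulr0 mul0r.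
have c2 u : Q u -> d2 c u = be * phif (T1 u) * Xf (T1 u) * dotp e0 T1 T1 u.
  move=> Qu; rewrite NT // KE // /be /phif /Xf /L; have := twist Qu; rewrite T2 //.
  have := Tn u Qu; move: (T1 u) (E u) (d2 c u) => t E' c' tn.
  move=> eq; have -> : c' = s ^+ 2 * t ^+ 4 * ((s / t ^+ 2) ^+ 2 * c').
    by case: sE => ->; field; rewrite tn.
  by rewrite eq; case: sE => ->; case: sgE => ->; field; rewrite Lam0.
have [W [W' [y [x [a1 [a3 [hh [[cc Wp WQ ad] [shh VT pde] mE fE]]]]]]]] :=
  local_form d0 e0E sgE al0 be0 sh sa sc sT1 sX sphi E0 r0 A0 X0 H0 d2a AN rH dr sK drr
    gX gphi lapT1 c2 ric gE xiE F4t F4z.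
exists W, W', y, x; split=> //.
have oV : open (tpart @` W') by apply: open_tpart; case: cc => -[].
have t0 u : (tpart @` W') u -> u 0 0 != 0 by move=> /VT[v Qv <-]; exact: Tn.
pose psi u := hh u * (4 * u 0 0 ^+ 2) + 0.
have Vq q : W' q -> (tpart @` W') (tpart q) by exists q.
exists a1, (sg * w0 * al / be), a3, psi; split.
  split=> //; first by have st := smooth_coord oV 0; rewrite /psi; smooth_auto.
  move=> u Vu; split; first exact: t0.
  apply: (equationB_change oV L0 t0 shh Vu).
  have := pde u Vu; have := t0 u Vu; move: (u 0 0) => t tn /=.
  rewrite /Xf /kf /phif /Hf /H'f /X'f -/L expr1n !mulr1 mul0r add0r.
  rewrite (_ : - (t ^+ 3)^-1 / (2 * t ^+ 2)^-1 = - (2 / t)); last by field.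
  rewrite (mulNr (2 / t)) opprK => ->; congr (_ + _); congr (_ / _).
  by rewrite -mulrA -exprMn mulVf ?mulf_neq0 ?expf_neq0 ?pnatr_eq0 // expr1n mulr1.
split.
- move=> q Wq; rewrite mE // /metricB; have := t0 _ (Vq q Wq); rewrite /psi.
  move: (hh (tpart q)) (tpart q 0 0) (tpart q 0 1) => h' t t2' tn.
  congr soliton_metric; rewrite /Af /Xf /phif /Hf; field; rewrite ?L0 ?tn //.
- exact: fE.
- rewrite orbitB_mx2; apply: (@soliton_orbit_metric _ W' _ (fun u => Af (u 0 0))
    (fun u => Af (u 0 0) * e0) (fun u => phif (u 0 0) * u 0 1)
    (fun u => Hf (u 0 0)) hh) => [u /t0 tn|q Wq u].
    by rewrite invr_eq0 mulf_neq0 ?pnatr_eq0 // expf_neq0.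
  by rewrite mE // /Xf expr1n divr1 [e0 * _]mulrC.
- exact: orbitB_gauss_curvature.
Qed.


End CanonicalForms.

(** * From the soliton equation to the canonical forms *)

Section SolitonReduction.
Context {R : realType}.
Local Notation pt := 'rV[R]_(2 + 2).
Variables (U : set pt) (g : pt -> 'M[R]_(2 + 2)) (xi : 'I_2 -> pt -> pt)
  (X : pt -> pt) (Lam e0 : R) (P h r a c : 'rV[R]_2 -> R).
Let V := tpart @` U.
Hypotheses (openU : open U) (sg : smooth_mx U g) (sX : smooth_mx U X)
  (soliton : ricci_soliton U g X Lam)
  (N : normal_form U g xi e0 P h r a c)
  (XXi : section_Xi U xi X) (symX : symmetry_Xi_perp U g xi X)
  (d2a : forall x, U x -> d2 a (tpart x) = 0)
  (d1r : forall x, U x -> d1 r (tpart x) != 0)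
  (Lam0 : Lam != 0).
Local Notation E := (conformal P).
Local Notation K := (gaussK e0 E).

Let openV : open V := open_tpart openU.
Let e0E : e0 = 1 \/ e0 = -1. Proof. by case: N. Qed.
Let sr : smooth_on V r. Proof. by case: N => _ []. Qed.
Let E0 u : E u != 0. Proof. by rewrite gt_eqF // expR_gt0. Qed.
Let r0 u : V u -> r u != 0. Proof. by case: N => _ _ _ _ H /H[]. Qed.
Let d2c u : V u -> d2 c u != 0.
Proof.
move=> Vu; have [_ _ _ _ /(_ u Vu)[_]] := N; case: Vu => x Ux <-.
rewrite d2a // expr0n add0r; apply: contra => /eqP ->; by rewrite expr0n.
Qed.

Let gradK u (Vu : V u) := soliton_gaussK_grad openU sg sX soliton N XXi symX d2a d2c Vu.
Let drr u (Vu : V u) := soliton_norm_dr openU sg sX soliton N XXi symX d2a d2c d1r Vu.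
Let sK : smooth_on V K.
Proof. by apply: smooth_gaussK => //; exact: smooth_conformal openU N. Qed.

(* If [dr] were null on an open set, the curvature [K] would vanish there, hence
   also its derivative, which is [Lam d1 r / (2 r)]. *)
Lemma nonnull_dense : U `<=` closure (nonnull_dh12 U e0 r).
Proof.
move=> x Ux B nB; apply: contrapT => noB.
have : nbhs x (U `&` B) by apply: filterI => //; apply: open_nbhs_nbhs.
move=> /nbhs_ballP[e /= e_gt0 eUB].
have z u : (tpart @` ball x e) u -> K u = 0.
  move=> [y /eUB[Uy By] <-]; have Vy : V (tpart y) by exists y.
  have : dotp e0 r r (tpart y) = 0.
    apply: contrapT => nz; apply: noB; exists y; split => //; split => //=.
    by apply/negP => /eqP nz'; apply: nz; rewrite -[RHS]nz' /dotp !expr2.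
  have nz : - 4 * r (tpart y) ^+ 2 * E (tpart y) != 0.
    apply: mulf_neq0; last exact: E0.
    by apply: mulf_neq0; [rewrite oppr_eq0 pnatr_eq0|rewrite expf_neq0 // r0].
  by rewrite drr // => /eqP; rewrite mulf_eq0 (negPf nz) => /eqP.
have oB : open (tpart @` ball x e) by apply: open_tpart; exact: ball_open.
have Bx : (tpart @` ball x e) (tpart x) by exists x => //; exact: ballxx.
have Vx : V (tpart x) by exists x.
have n : \forall v \near tpart x, 0 = K v by apply: (open_near_eq oB Bx) => v /z ->.
have := (gradK Vx).1.
rewrite (has_grad_near n (has_grad_cst (0 : R) (tpart x))).2 z // mulr0.
by move=> /esym/eqP; rewrite ?mulr0 subr0 mulf_eq0 (negPf Lam0) (negPf (d1r Ux)).
Qed.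

(** On a small ball [dr] stays non-null and [r] keeps its sign. There the drift, the twist and (3 K
    - Lam) w^3 have zero gradient and are therefore constant; whether the last constant vanishes
    decides between the types. *)
Lemma soliton_reducible (s : R) p : s = 1 \/ s = -1 -> s * Lam < 0 -> nonnull_dh12 U e0 r p ->
  exists2 d, ball p d `<=` U &
    reducible g xi X Lam e0 s d p (@typeA R) \/ reducible g xi X Lam e0 s d p (@typeB R).
Proof.
move=> s1 sL [Up /= np].
have Vp : V (tpart p) by exists p.
have [t t1 tr] : exists2 t : R, t = 1 \/ t = -1 & 0 < t * r (tpart p).
  have := r0 Vp; rewrite neq_lt => /orP[n|n]; last by exists 1; [left|rewrite mul1r].
  by exists (-1); [right|rewrite mulN1r oppr_gt0].
have sN : smooth_on V (dotp e0 r r).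
  have s0 := smooth_partial 0 sr; have s2 := smooth_partial 1 sr.
  by rewrite /dotp; smooth_auto.
have str : smooth_on V (fun u => t * r u) by smooth_auto.
have cont f : smooth_on V f -> f v @[v --> tpart p] --> f (tpart p).
  by move=> sf; exact: differentiable_continuous (smooth_differentiable sf Vp).
have n1 : \forall v \near tpart p, dotp e0 r r v != 0.
  by apply: (cvgr_neq0 _ (cont _ sN)); rewrite /dotp -!expr2.
have n2 : \forall v \near tpart p, 0 < t * r v by apply: (cvgr_gt _ (cont _ str)).
have n3 : \forall v \near tpart p, V v by apply: open_nbhs_nbhs.
have /nbhs_ballP[d1' /= d1'0 B1] : \forall v \near tpart p, [/\ dotp e0 r r v != 0, 0 < t * r v & V v].
  by near=> v; split; near: v.
have /nbhs_ballP[d2' /= d2'0 B2] : nbhs p U by apply: open_nbhs_nbhs.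
pose d := Num.min d1' d2'.
have d0 : 0 < d by rewrite lt_min d1'0.
have le1 : d <= d1' by rewrite ge_min lexx.
have le2 : d <= d2' by rewrite ge_min lexx orbT.
have BU : ball p d `<=` U by move=> x /(le_ball le2) /B2.
exists d => //.
have Q1 u : ball (tpart p) d u -> [/\ dotp e0 r r u != 0, 0 < t * r u & V u].
  by move=> /(le_ball le1) /B1.
have QV : ball (tpart p) d `<=` V by move=> u /Q1[].
have K0 u : ball (tpart p) d u -> K u != 0.
  move=> Qu; have [nz _ Vu] := Q1 u Qu; apply: contra nz => /eqP kz.
  by rewrite drr // kz mulr0.
have driftp u : ball (tpart p) d u -> drift Lam e0 P h r c u = drift Lam e0 P h r c (tpart p).
  move=> Qu; apply: (ball_constant (d := d)) Qu => v /QV.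
  exact: (drift_constant openU sg sX soliton N XXi symX d2a d2c d1r).
pose k := r (tpart p) ^+ 2 * d2 c (tpart p) / E (tpart p).
have k0 : k != 0.
  by apply: mulf_neq0; [rewrite mulf_neq0 ?expf_neq0 ?r0 ?d2c|rewrite invr_eq0].
have twist u : ball (tpart p) d u -> r u ^+ 2 * d2 c u = k * E u.
  move=> Qu; have : r u ^+ 2 * d2 c u / E u = k.
    apply: (ball_constant (f := fun u => r u ^+ 2 * d2 c u / E u) (d := d)) Qu => v /QV.
    exact: (twist_constant openU sg sX soliton N XXi symX d2a d2c).
  by move=> <-; rewrite divfK.
pose m u := (3 * K u - Lam) * root t r u ^+ 3.
have srQ : smooth_on (ball (tpart p) d) r by exact: smooth_sub QV sr.
have rpos u : ball (tpart p) d u -> 0 < t * r u by move=> /Q1[].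
have mp u : ball (tpart p) d u -> m u = m (tpart p).
  move=> Qu; apply: (ball_constant (d := d)) Qu => v Qv; have Vv := QV _ Qv.
  apply: (root_scaled_constant (ball_open _ _) srQ t1 rpos Qv (gradK Vv)).
  exact: (smooth_differentiable sK Vv).
have [_ [sP sh _ sa sc] [xiA _] _ _] := N.
have sub f : smooth_on V f -> smooth_on (ball (tpart p) d) f by exact: smooth_sub.
have d2aQ u : ball (tpart p) d u -> d2 a u = 0 by move=> /QV[x Ux <-]; exact: d2a.
have drrQ u : ball (tpart p) d u -> dotp e0 r r u = - 4 * r u ^+ 2 * E u * K u.
  by move=> /QV; exact: drr.
have lapQ u : ball (tpart p) d u -> lap e0 r u = - 2 * Lam * E u * r u.
  by move=> /QV; exact: (soliton_lap_r openU sg sX soliton N XXi symX d2a d2c d1r).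
have ricQ u : ball (tpart p) d u ->
    ric_zz11 e0 E c h r u = Lam * h u - r u * drift Lam e0 P h r c (tpart p).
  by move=> Qu; rewrite (driftE Lam N (QV _ Qu)) driftp.
have gQ x : ball p d x -> forall i j, g x i j = entry (g_tab e0 E a c h r (tpart x)) i j.
  by move=> /BU Ux; exact: (metric_tab N Ux).
have xiQ : exists2 A : 'M[R]_2, A \in unitmx &
    forall i x, ball p d x -> xi i x = \sum_k A i k *: dz k.
  by have [A uA xiE] := xiA; exists A => // i x /BU; exact: xiE.
have XtQ x : ball p d x -> X x 0 o0 = 0 /\ X x 0 o1 = 0.
  by move=> /BU; exact: (field_tpart N XXi).
have XzQ x : ball p d x -> has_grad (fun y => X y 0 o2) x (fun=> 0) /\
    has_grad (fun y => X y 0 o3) x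
      (fun i => nth 0 [:: a (tpart x); 0; 1; 0] i * drift Lam e0 P h r c (tpart p)).
  move=> Bx; have Qx := tpart_ball Bx.
  have [g2 g3] := field_grad openU sg sX soliton N XXi symX d2a d2c d1r (BU _ Bx).
  by rewrite -(driftp _ Qx).
have E0Q u : ball (tpart p) d u -> E u != 0 by [].
have [mz|mz] := eqVneq (m (tpart p)) 0.
  right; apply: (reducible_typeB d0 e0E s1 t1 sL k0 (sub _ sh) (sub _ sa) (sub _ sc) srQ E0Q
    rpos d2aQ drrQ lapQ twist ricQ gQ xiQ XtQ XzQ) => u Qu.
  have := mp u Qu; rewrite mz /m => /eqP; rewrite mulf_eq0 expf_eq0 /=.
  by rewrite (gt_eqF (root_gt0 rpos Qu)) orbF subr_eq0 => /eqP.
left; exact: (reducible_typeA d0 e0E s1 t1 sL k0 (sub _ sh) (sub _ sa) (sub _ sc) srQ E0Q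
    rpos K0 d2aQ drrQ lapQ twist ricQ gQ xiQ XtQ XzQ mz).
Unshelve. all: by end_near. Qed.

End SolitonReduction.

Theorem theorem3 (R : realType) (U : set 'rV[R]_(2 + 2))
    (g : 'rV[R]_(2 + 2) -> 'M[R]_(2 + 2))
    (xi : 'I_2 -> 'rV[R]_(2 + 2) -> 'rV[R]_(2 + 2))
    (X : 'rV[R]_(2 + 2) -> 'rV[R]_(2 + 2)) (Lambda : R)
    (eps0 : R) (P h11 h12 f11 f12 : 'rV[R]_2 -> R)
    (openU : open U)
    (metric_g : pseudo_riemannian U g)
    (killing_xi : abelian_killing_algebra U g xi)
    (nonnull_xi : nonnull_leaves U g xi)
    (smooth_X : smooth_mx U X)
    (soliton : ricci_soliton U g X Lambda)
    (N : normal_form U g xi eps0 P h11 h12 f11 f12)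
    (orth_intransitive : forall x, U x ->
       curvature_field (nf_orbit eps0 P) (nf_f f11 f12) x != 0)
    (cond_i : forall x, U x ->
       inner (g x) (curvature_field (nf_orbit eps0 P) (nf_f f11 f12) x)
                   (curvature_field (nf_orbit eps0 P) (nf_f f11 f12) x) = 0)
    (cond_ii : has_null_vector U g xi)
    (cond_iii : section_Xi U xi X /\ symmetry_Xi_perp U g xi X)
    (df11 : forall x, U x -> partial 1 f11 (tpart x) = 0)
    (dh12 : forall x, U x -> partial 0 h12 (tpart x) != 0)
    (Lambda_neq0 : Lambda != 0) :
  U `<=` closure (nonnull_dh12 U eps0 h12) /\
  forall p, nonnull_dh12 U eps0 h12 p ->
    reduces_at U g xi X Lambda eps0 p \/
    reduces_at U (fun x => - g x) xi (fun x => - X x) (- Lambda) eps0 p.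
Proof.
have [sg _] := metric_g; have [XXi symX] := cond_iii.
split; first exact: (nonnull_dense openU sg smooth_X soliton N XXi symX df11 dh12 Lambda_neq0).
move=> p np.
have red := soliton_reducible openU sg smooth_X soliton N XXi symX df11 dh12.
move: (Lambda_neq0); rewrite neq_lt => /orP[Ln|Lp].
  have [||d BU R1] := red 1 p _ _ np; [by left|by rewrite mul1r|].
  left; have gg : (fun x => 1 *: g x) = g by apply/funext => x; rewrite scale1r.
  have XX : (fun x => 1 *: X x) = X by apply/funext => x; rewrite scale1r.
  by case: R1; rewrite /reducible gg XX mul1r => -[W [W' [y [x [cc Wp WB ad ty]]]]];
    exists W, W', y, x; split=> //; [exact: subset_trans BU|left|exact: subset_trans BU|right].
have [||d BU R1] := red (-1) p _ _ np; [by right|by rewrite mulN1r oppr_lt0|].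
right; have gg : (fun x => -1 *: g x) = (fun x => - g x).
  by apply/funext => x; rewrite scaleN1r.
have XX : (fun x => -1 *: X x) = (fun x => - X x) by apply/funext => x; rewrite scaleN1r.
by case: R1; rewrite /reducible gg XX mulN1r => -[W [W' [y [x [cc Wp WB ad ty]]]]];
  exists W, W', y, x; split=> //; [exact: subset_trans BU|left|exact: subset_trans BU|right].
Qed.
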